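(* Let $\phi=\{\phi_k: k=1,2,\dots,n\}$ be a multiplicative system of real random variables on a probability space with $\|\phi_k\|_\infty\le 1$ for all $k$. Then for every choice of real coefficients $a_1,\dots,a_n$ and every real $p>2$, $$\left\|\sum_{k=1}^n a_k\phi_k\right\|_p\le K(p)\left(\sum_{k=1}^n a_k^2\right)^{1/2},\qquad\text{where } K(p)=2^{1/2}\left(\frac{\Gamma((p+1)/2)}{\sqrt{\pi}}\right)^{1/p}.$$
   Context: A system of bounded random variables $\phi_1,\dots,\phi_n$ is multiplicative if $\mathbf{E}[\phi_{n_1}\phi_{n_2}\cdots\phi_{n_\nu}]=0$ for all possible choices of indices $n_1<n_2<\dots<n_\nu$ in $\{1,\dots,n\}$, $\nu\ge1$. $\|X\|_p=(\mathbf{E}|X|^p)^{1/p}$. The constant $K(p)$ is the known optimal constant in Khintchine's inequality for independent Rademacher ($\pm1$ with probability $1/2$) random variables. *)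

(* Defs.v *)
From HB Require Import structures.
From mathcomp Require Import all_boot all_order all_algebra.
From mathcomp Require Import all_classical all_reals all_analysis.

Set Implicit Arguments.
Unset Strict Implicit.
Unset Printing Implicit Defensive.

Import Order.TTheory GRing.Theory Num.Theory.
Import numFieldNormedType.Exports.

Local Open Scope classical_set_scope.
Local Open Scope ring_scope.

(* [A] is the set of the indices n_1 < ... < n_nu, with nu >= 1.  Boundedness
   is almost sure: the essential supremum of |phi k| is finite. *)
Definition multiplicative_system d (T : measurableType d) (R : realType)
    (P : probability T R) (n : nat) (phi : 'I_n -> {RV P >-> R}) : Prop :=
  (forall k : 'I_n, ('N[P]_+oo[EFin \o phi k] < +oo)%E) /\
  (forall A : {set 'I_n}, A != finset.set0 ->
     ('E_P[fun x => (\prod_(k in A) phi k x)%R] = 0)%E).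

(* Meaningful for s > 0 only: elsewhere the integral diverges and [Rintegral]
   returns 0. *)
Definition Gamma (R : realType) (s : R) : R :=
  \int[lebesgue_measure]_(t in `]0, +oo[) (t `^ (s - 1) * expR (- t)).

Definition khintchine_const (R : realType) (p : R) : R :=
  Num.sqrt 2 * (Gamma ((p + 1) / 2) / Num.sqrt pi) `^ p^-1.

(* Main.v *)
(* A convex function of [sum_k a_k phi_k] is at most its multilinear interpolation
   from the vertices of the cube, taken at the point [(phi_k)]; by
   multiplicativity only the constant coefficient survives integration, and it is
   the mean of the function at the Rademacher sum [S = sum_k a_k eps_k]. What
   remains is Khintchine's inequality with Haagerup's constant, for
   [sum_k a_k ^ 2 = 1].

   For 2 < p < 4, [|x| ^ p] is a multiple of the integral over t > 0 of
   [(cos (t x) - 1 + (t x) ^ 2 / 2) / t ^ (p + 1)], and [E cos (t S)] is the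
   product of the [cos (t a_k)]. By AM-GM with weights [a_k ^ 2], the case where
   all [a_k ^ 2 <= 1 / 2] reduces to the fact that replacing [|cos t| ^ s] by
   [exp (- s t ^ 2 / 2)] increases the integral for s >= 2. If some [a_k ^ 2]
   exceeds 1 / 2, one modifies the weights when it is at most 10 / 17 and p <= 3;
   otherwise the third or fourth moment of [S] is small enough, given explicit
   lower bounds for the Gamma factor. For p >= 4, the trapezoid rule gives
   [E |S| ^ p <= (p - 1) E |S| ^ (p - 2)], a recursion which the constants satisfy
   with equality. *)

Require Import Defs.
From HB Require Import structures.
From mathcomp Require Import all_boot all_order all_algebra.
From mathcomp Require Import all_classical all_reals all_analysis.
From mathcomp Require Import measurable_realfun ess_sup_inf ring lra.

Set Implicit Arguments.
Unset Strict Implicit.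
Unset Printing Implicit Defensive.

Import Order.TTheory GRing.Theory Num.Theory.
Import numFieldNormedType.Exports.

Local Open Scope classical_set_scope.
Local Open Scope ring_scope.

(* The unguided search through these instances is exponential; the tactic [der]
   below applies the rules syntactically instead. *)
#[local] Remove Hints is_deriveD is_deriveB is_deriveN is_deriveM is_deriveX
  is_deriveZ is_derive_sum is_derive_poly is_derive1_comp : typeclass_instances.

(** * Derivatives and elementary inequalities *)

(** The difficulty is the comparison of [|cos t| ^ s] with the Gaussian, which holds pointwise only
    up to [pi / 2]. The kernel is [t ^ (2 - p) * t ^ -3], and its decreasing first factor may be
    replaced by its value at [pi / 2], to the disadvantage of the Gaussian on both sides of that
    point. So [p] drops out, and for [s >= 2] a single number, 19 / 250, separates the gain before
    [pi / 2] from the loss after it. The exponents in AM-GM are the reciprocals of the weights, so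
    [s >= 2] means weights at most 1 / 2; this is why one large coefficient needs other arguments.
    At [p = 2] Khintchine's inequality is an equality for every choice of coefficients, so the
    bounds in that case have to be accurate to first order in [p - 2]. Most of the odd fractions
    come from there. The integral representation converges exactly for 2 < p < 4: its integrand is
    of order [t ^ (3 - p)] at 0 and [t ^ (1 - p)] at infinity. Its normalizing integral is never
    evaluated: the Gaussian moments are expressed through the same integral, and it cancels. *)

Section pointwise_derivatives.
Context {R : realType}.
Implicit Types (f g : R -> R) (x a b c : R).

Lemma der_cst c x : is_derive x 1 (fun=> c) (0 : R).
Proof. exact: is_derive_cst. Qed.

Lemma der_id x : is_derive x 1 (fun y => y) (1 : R).
Proof. exact: is_derive_id. Qed.

Lemma der_add f g x a b : is_derive x 1 f a -> is_derive x 1 g b ->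
  is_derive x 1 (fun y => f y + g y) (a + b).
Proof. by move=> ? ?; exact: is_deriveD. Qed.

Lemma der_opp f x a : is_derive x 1 f a -> is_derive x 1 (fun y => - f y) (- a).
Proof. by move=> ?; exact: is_deriveN. Qed.

Lemma der_mul f g x a b : is_derive x 1 f a -> is_derive x 1 g b ->
  is_derive x 1 (fun y => f y * g y) (f x * b + a * g x).
Proof.
move=> df dg; apply: (is_derive_eq (is_deriveM df dg)).
by rewrite /GRing.scale /= (mulrC a).
Qed.

Lemma der_mull c f x a : is_derive x 1 f a ->
  is_derive x 1 (fun y => c * f y) (c * a).
Proof.
move=> df; apply: (is_derive_eq (der_mul (der_cst c x) df)).
by rewrite mul0r addr0.
Qed.

Lemma der_mulr c f x a : is_derive x 1 f a ->
  is_derive x 1 (fun y => f y * c) (a * c).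
Proof.
move=> df; apply: (is_derive_eq (der_mul df (der_cst c x))).
by rewrite mulr0 add0r.
Qed.

Lemma der_exp f n x a : is_derive x 1 f a ->
  is_derive x 1 (fun y => f y ^+ n) (n%:R * f x ^+ n.-1 * a).
Proof.
move=> df; have -> : (fun y => f y ^+ n) = f ^+ n by rewrite exprfctE.
exact: (is_derive_eq (is_deriveX n df)).
Qed.

Lemma der_comp (h : R -> R) f x a b : is_derive (f x) 1 h b ->
  is_derive x 1 f a -> is_derive x 1 (fun y => h (f y)) (b * a).
Proof. by move=> dh df; exact: is_derive1_comp. Qed.

Lemma der_inv f x a : f x != 0 -> is_derive x 1 f a ->
  is_derive x 1 (fun y => (f y)^-1) (- (f x) ^- 2 * a).
Proof. by move=> fx df; exact: (@is_deriveV R f x a 1 fx df). Qed.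

Lemma der_powR f c x a : 0 < f x -> is_derive x 1 f a ->
  is_derive x 1 (fun y => f y `^ c) (c * f x `^ (c - 1) * a).
Proof.
move=> fx df; apply: (der_comp (h := fun y => y `^ c)) df.
exact: is_derive1_powR.
Qed.

End pointwise_derivatives.

(** Leaves fall back on the context, so the derivative of a local function can be supplied as a
    hypothesis. Positivity and nonvanishing conditions remain as goals. *)
Ltac der_rec :=
  lazymatch goal with
  | |- is_derive _ _ (fun y => y) _ => apply: der_id
  | |- is_derive _ _ (fun y => @?f y + @?g y) _ =>
      apply: (@der_add _ f g); der_rec
  | |- is_derive _ _ (fun y => - @?f y) _ => apply: (@der_opp _ f); der_rec
  | |- is_derive _ _ (fun y => @?f y * @?g y) _ =>
      first [ let c := lazymatch f with fun _ => ?c => constr:(c) end in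
              apply: (@der_mull _ c g)
            | let c := lazymatch g with fun _ => ?c => constr:(c) end in
              apply: (@der_mulr _ c f)
            | apply: (@der_mul _ f g)]; der_rec
  | |- is_derive _ _ (fun y => @?f y ^+ ?n) _ => apply: (@der_exp _ f n); der_rec
  | |- is_derive _ _ (fun y => (@?f y)^-1) _ =>
      first [ let c := lazymatch f with fun _ => ?c => constr:(c) end in
              exact: (@der_cst _ c^-1)
            | apply: (@der_inv _ f); der_side]
  | |- is_derive _ _ (fun y => @?f y `^ ?c) _ =>
      apply: (@der_powR _ f c); der_side
  | |- is_derive _ _ (fun y => sin (@?f y)) _ =>
      apply: (@der_comp _ sin f); first [exact: is_derive_sin|der_rec]
  | |- is_derive _ _ (fun y => cos (@?f y)) _ =>
      apply: (@der_comp _ cos f); first [exact: is_derive_cos|der_rec]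
  | |- is_derive _ _ (fun y => expR (@?f y)) _ =>
      apply: (@der_comp _ expR f); first [exact: is_derive_expR|der_rec]
  | |- is_derive _ _ _ _ => first [apply: der_cst | eassumption]
  end
with der_side :=
  lazymatch goal with |- is_derive _ _ _ _ => der_rec | |- _ => idtac end.
Ltac der := eapply is_derive_eq; [der_rec|cbv beta].

Section elementary.
Context {R : realType}.
Implicit Types x y t : R.

Lemma is_derive_homo (f f' : R -> R) (a b : R) : a <= b ->
  (forall x, a <= x <= b -> is_derive x 1 f (f' x)) ->
  (forall x, a <= x <= b -> 0 <= f' x) -> f a <= f b.
Proof.
move=> ab df f'0.
have [c] : exists2 c, c \in `[a, b] & f b - f a = f' c * (b - a).
  apply: MVT_segment => // [x|].
    by rewrite in_itv /= => /andP[/ltW ? /ltW ?]; apply: df; apply/andP.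
  apply: derivable_within_continuous => x; rewrite in_itv /= => xab.
  by have [] := df x xab.
rewrite in_itv /= => cab E.
by rewrite -subr_ge0 E mulr_ge0 ?f'0 // subr_ge0.
Qed.

Lemma is_derive_ge0 (f f' : R -> R) : f 0 = 0 ->
  (forall x, is_derive x 1 f (f' x)) -> (forall x, 0 <= x -> 0 <= f' x) ->
  forall x, 0 <= x -> 0 <= f x.
Proof.
move=> f0 df f'0 x x0; rewrite -f0.
by apply: (@is_derive_homo f f') => // y /andP[y0 _]; exact: f'0.
Qed.

Lemma sin_leT1 x : 0 <= x -> sin x <= x.
Proof.
move=> x0; rewrite -subr_ge0; move: x x0.
apply: (@is_derive_ge0 (fun x => x - sin x) (fun x => 1 - cos x)).
- by rewrite sin0 subr0.
- by move=> x /=; der; lra.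
- by move=> x _; rewrite subr_ge0 cos_le1.
Qed.

Lemma cos_geT2 x : 0 <= x -> 1 - x ^+ 2 / 2 <= cos x.
Proof.
move=> x0; rewrite -subr_ge0; move: x x0.
apply: (@is_derive_ge0 (fun x => cos x - (1 - x ^+ 2 / 2)) (fun x => x - sin x)).
- by rewrite cos0; lra.
- by move=> x /=; der; rewrite /=; lra.
- by move=> x x0; rewrite subr_ge0 sin_leT1.
Qed.

Lemma sin_geT3 x : 0 <= x -> x - x ^+ 3 / 6 <= sin x.
Proof.
move=> x0; rewrite -subr_ge0; move: x x0.
apply: (@is_derive_ge0 (fun x => sin x - (x - x ^+ 3 / 6))
  (fun x => cos x - (1 - x ^+ 2 / 2))).
- by rewrite sin0; lra.
- by move=> x /=; der; rewrite /=; lra.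
- by move=> x x0; rewrite subr_ge0 cos_geT2.
Qed.

Lemma cos_leT4 x : 0 <= x -> cos x <= 1 - x ^+ 2 / 2 + x ^+ 4 / 24.
Proof.
move=> x0; rewrite -subr_ge0; move: x x0.
apply: (@is_derive_ge0 (fun x => 1 - x ^+ 2 / 2 + x ^+ 4 / 24 - cos x)
  (fun x => sin x - (x - x ^+ 3 / 6))).
- by rewrite cos0; lra.
- by move=> x /=; der; rewrite /=; lra.
- by move=> x x0; rewrite subr_ge0 sin_geT3.
Qed.

Lemma sin_leT5 x : 0 <= x -> sin x <= x - x ^+ 3 / 6 + x ^+ 5 / 120.
Proof.
move=> x0; rewrite -subr_ge0; move: x x0.
apply: (@is_derive_ge0 (fun x => x - x ^+ 3 / 6 + x ^+ 5 / 120 - sin x)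
  (fun x => 1 - x ^+ 2 / 2 + x ^+ 4 / 24 - cos x)).
- by rewrite sin0; lra.
- by move=> x /=; der; rewrite /=; lra.
- by move=> x x0; rewrite subr_ge0 cos_leT4.
Qed.

Lemma cos_geT6 x : 0 <= x -> 1 - x ^+ 2 / 2 + x ^+ 4 / 24 - x ^+ 6 / 720 <= cos x.
Proof.
move=> x0; rewrite -subr_ge0; move: x x0.
apply: (@is_derive_ge0
  (fun x => cos x - (1 - x ^+ 2 / 2 + x ^+ 4 / 24 - x ^+ 6 / 720))
  (fun x => x - x ^+ 3 / 6 + x ^+ 5 / 120 - sin x)).
- by rewrite cos0; lra.
- by move=> x /=; der; rewrite /=; lra.
- by move=> x x0; rewrite subr_ge0 sin_leT5.
Qed.

Lemma sin_geT7 x : 0 <= x ->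
  x - x ^+ 3 / 6 + x ^+ 5 / 120 - x ^+ 7 / (720 * 7) <= sin x.
Proof.
move=> x0; rewrite -subr_ge0; move: x x0.
apply: (@is_derive_ge0
  (fun x => sin x - (x - x ^+ 3 / 6 + x ^+ 5 / 120 - x ^+ 7 / (720 * 7)))
  (fun x => cos x - (1 - x ^+ 2 / 2 + x ^+ 4 / 24 - x ^+ 6 / 720))).
- by rewrite sin0; lra.
- by move=> x /=; der; rewrite /=; lra.
- by move=> x x0; rewrite subr_ge0 cos_geT6.
Qed.

Lemma cos_leT8 x : 0 <= x ->
  cos x <= 1 - x ^+ 2 / 2 + x ^+ 4 / 24 - x ^+ 6 / 720 + x ^+ 8 / (720 * 56).
Proof.
move=> x0; rewrite -subr_ge0; move: x x0.
apply: (@is_derive_ge0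
  (fun x => 1 - x ^+ 2 / 2 + x ^+ 4 / 24 - x ^+ 6 / 720 + x ^+ 8 / (720 * 56) - cos x)
  (fun x => sin x - (x - x ^+ 3 / 6 + x ^+ 5 / 120 - x ^+ 7 / (720 * 7)))).
- by rewrite cos0; lra.
- by move=> x /=; der; rewrite /=; lra.
- by move=> x x0; rewrite subr_ge0 sin_geT7.
Qed.

Lemma pihalf_lt : pi / 2 < 11 / 7 :> R.
Proof.
rewrite ltNge; apply/negP => h.
have : 0 <= cos (11 / 7 : R) by apply: cos_ge0_pihalf; rewrite h andbT; lra.
by have := @cos_leT8 (11 / 7) ltac:(lra); lra.
Qed.

(* The Taylor polynomials pin down [pi] better from here than from [pi / 2]. *)
Lemma sin_pi6 : sin (pi / 6) = 1 / 2 :> R.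
Proof.
have pi0 := pi_gt0 R.
have s0 : 0 < sin (pi / 6 : R) by apply: sin_gt0_pihalf; apply/andP; split; lra.
have c0 : 0 < cos (pi / 6 : R) by apply: cos_gt0_pihalf; apply/andP; split; lra.
have : cos (pi / 6 + pi / 6 + pi / 6) = 0 :> R.
  by rewrite -[RHS]cos_pihalf; congr cos; field.
rewrite !cosD !sinD => E.
have E2 : cos (pi / 6) ^+ 2 = 3 * sin (pi / 6) ^+ 2 :> R.
  by apply: (mulfI (lt0r_neq0 c0)); apply/eqP; rewrite -subr_eq0 -E; apply/eqP; ring.
have := cos2Dsin2 (pi / 6 : R); rewrite E2 => E3.
have : (sin (pi / 6) - 1 / 2) * (sin (pi / 6) + 1 / 2) = 0 :> R by lra.
by move/eqP; rewrite mulf_eq0 => /orP[] /eqP; lra.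
Qed.

Lemma pihalf_gt : 80 / 51 < pi / 2 :> R.
Proof.
rewrite ltNge; apply/negP => h.
have pi0 := pi_gt0 R.
have s_le : sin (pi / 6 : R) <= pi / 6 - (pi / 6) ^+ 3 / 6 + (pi / 6) ^+ 5 / 120.
  by apply: sin_leT5; lra.
rewrite sin_pi6 in s_le; set y := pi / 6 in s_le.
have y0 : 0 <= y by rewrite /y; lra.
have y1 : y <= 80 / 153 by rewrite /y; lra.
(* The quintic increases on this range, and its value at 80 / 153 is already below
   [1 / 2 = sin (pi / 6)]. *)
have : y - y ^+ 3 / 6 + y ^+ 5 / 120 <=
    80 / 153 - (80 / 153) ^+ 3 / 6 + (80 / 153) ^+ 5 / 120.
  rewrite -subr_ge0.
  pose d (y : R) := 1 - y ^+ 2 / 2 + y ^+ 4 / 24.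
  rewrite subr_ge0.
  apply: (@is_derive_homo (fun y => y - y ^+ 3 / 6 + y ^+ 5 / 120) d) => // t.
    by move=> _; der; rewrite /d /=; lra.
  by move=> /andP[t0 t1]; rewrite /d; nra.
by lra.
Qed.

Lemma expR_geT3 x : 0 <= x -> 1 + x + x ^+ 2 / 2 + x ^+ 3 / 6 <= expR x.
Proof.
have T2 t : 0 <= t -> 1 + t + t ^+ 2 / 2 <= expR t.
  move=> t0; rewrite -subr_ge0; move: t t0.
  apply: (@is_derive_ge0 (fun x => expR x - (1 + x + x ^+ 2 / 2))
    (fun x => expR x - (1 + x))).
  - by rewrite expR0; field.
  - by move=> t /=; der; rewrite /=; lra.
  - by move=> t _; rewrite subr_ge0 expR_ge1Dx.
move=> x0; rewrite -subr_ge0; move: x x0.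
apply: (@is_derive_ge0 (fun x => expR x - (1 + x + x ^+ 2 / 2 + x ^+ 3 / 6))
  (fun x => expR x - (1 + x + x ^+ 2 / 2))).
- by rewrite expR0; field.
- by move=> t /=; der; rewrite /=; lra.
- by move=> t t0; rewrite subr_ge0 T2.
Qed.

Lemma expRN_leT2 x : 0 <= x -> expR (- x) <= 1 - x + x ^+ 2 / 2.
Proof.
move=> x0; rewrite -subr_ge0; move: x x0.
apply: (@is_derive_ge0 (fun x => 1 - x + x ^+ 2 / 2 - expR (- x))
  (fun x => expR (- x) - (1 - x))).
- by rewrite oppr0 expR0; field.
- by move=> t /=; der; rewrite /=; lra.
- by move=> t t0; rewrite subr_ge0 expR_ge1Dx.
Qed.

(** This is [x <= artanh x]. The two sides agree to second order at 0, so raising the bound at a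
    small argument to a power gives sharp rational bounds on the exponential. *)
Lemma expR2_le x : 0 <= x < 1 -> expR (2 * x) <= (1 + x) / (1 - x).
Proof.
move=> /andP[x0 x1]; rewrite ler_pdivlMr ?subr_gt0 // -subr_ge0; move: x x0 {x1}.
have h x : 0 <= x -> 0 <= 1 - expR (2 * x) * (1 - 2 * x).
  move: x; apply: (@is_derive_ge0 (fun x => 1 - expR (2 * x) * (1 - 2 * x))
    (fun x => 4 * x * expR (2 * x))).
  - by rewrite mulr0 expR0; field.
  - by move=> t /=; der; rewrite /=; lra.
  - by move=> t t0; rewrite !mulr_ge0 ?expR_ge0.
apply: (@is_derive_ge0 (fun x => 1 + x - expR (2 * x) * (1 - x))
  (fun x => 1 - expR (2 * x) * (1 - 2 * x))) => //.
- by rewrite mulr0 expR0; field.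
- by move=> t /=; der; rewrite /=; lra.
Qed.

End elementary.

(** * Tangent-line inequalities for real powers *)

Section powR_inequalities.
Context {R : realType}.
Implicit Types x y t u c : R.

Lemma powR_expR x t : 0 < x -> x `^ t = expR (t * ln x).
Proof. by move=> x0; rewrite /powR gt_eqF. Qed.

Lemma ln_ge_1subV x : 0 < x -> 1 - x^-1 <= ln x.
Proof.
move=> x0; have := @le_ln1Dx R (x^-1 - 1).
have -> : 1 + (x^-1 - 1) = x^-1 by ring.
rewrite lnV ?posrE // => h.
have : - ln x <= x^-1 - 1 by apply: h; have := invr_gt0 x; rewrite x0; lra.
lra.
Qed.

Lemma powR_geV x t : 0 <= t -> 0 < x -> 1 + t * (1 - x^-1) <= x `^ t.
Proof.
move=> t0 x0; rewrite powR_expR //; apply: le_trans (expR_ge1Dx _).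
by rewrite lerD2l ler_wpM2l // ln_ge_1subV.
Qed.

(** Writing [x ^ t] as [x * x ^ (t - 1)], the bound in [x^-1] for the exponent [t - 1] becomes the
    tangent line at 1. *)
Lemma powR_ge_bernoulli x t : 1 <= t -> 0 <= x -> 1 + t * (x - 1) <= x `^ t.
Proof.
move=> t1; rewrite le_eqVlt => /predU1P[<-|x0].
  by rewrite powR0 ?lt0r_neq0 //; lra.
have -> : x `^ t = x * x `^ (t - 1) by rewrite mulr_powRB1 ?(ltW x0) //; lra.
apply: (@le_trans _ _ (x * (1 + (t - 1) * (1 - x^-1)))).
  by rewrite le_eqVlt; apply/orP; left; apply/eqP; field; rewrite gt_eqF.
by rewrite ler_wpM2l ?(ltW x0) // powR_geV //; lra.
Qed.

Lemma powR_le_bernoulli x t : 0 <= t <= 1 -> 0 <= x -> x `^ t <= 1 + t * (x - 1).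
Proof.
move=> /andP[]; rewrite le_eqVlt => /predU1P[<- _ _|t0 t1 x0].
  by rewrite powRr0; lra.
have := @powR_ge_bernoulli (x `^ t) t^-1.
rewrite -powRrM mulfV ?gt_eqF // powRr1 // invf_ge1 // t1 => /(_ isT (powR_ge0 _ _)).
rewrite -(ler_pM2l t0) mulrDr mulrA mulfV ?gt_eqF //; lra.
Qed.

(** The tangent at [c] of a concave power. When the mean of [x] is at most [c], taking expectations
    leaves just [c ^ t]; this is how a fractional moment is bounded by integer ones. *)
Lemma powR_le_interp x t c : 0 <= t <= 1 -> 0 <= x -> 0 < c ->
  x `^ t <= c `^ t * (1 + t * (x / c - 1)).
Proof.
move=> t01 x0 c0; have -> : x = c * (x / c) by rewrite mulrC divfK ?gt_eqF.
have xc : 0 <= x / c by rewrite divr_ge0 // ltW.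
rewrite powRM ?(ltW c0) // ler_wpM2l ?powR_ge0 //.
by have -> : c * (x / c) / c = x / c :> R; [field; rewrite gt_eqF|exact: powR_le_bernoulli].
Qed.

Lemma powR_sqr x t : (x ^+ 2) `^ t = `|x| `^ (2 * t).
Proof. by rewrite powRrM powR_mulrn ?normr_ge0 // real_normK ?num_real. Qed.

End powR_inequalities.

(** * Rademacher averages *)

Section rademacher.
Context {R : realType}.
Implicit Types (f g : R -> R) (s : seq R) (x y a c : R).

(* [rad f s x] is the expectation of [f (x + sum_(a <- s) a * eps_a)] for
   independent Rademacher signs [eps_a]. *)
Fixpoint rad f s x : R :=
  if s is a :: s' then (rad f s' (x + a) + rad f s' (x - a)) / 2 else f x.

Lemma rad_le f g s x : (forall y, f y <= g y) -> rad f s x <= rad g s x.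
Proof.
move=> fg; elim: s x => [|a s IH] x //=.
by rewrite ler_pM2r ?invr_gt0 // lerD.
Qed.

Lemma eq_rad f g s x : f =1 g -> rad f s x = rad g s x.
Proof. by move=> fg; elim: s x => [|a s IH] x //=; rewrite !IH. Qed.

Lemma rad_lin f g c d s x :
  rad (fun y => c * f y + d * g y) s x = c * rad f s x + d * rad g s x.
Proof. by elim: s x => [|a s IH] x //=; rewrite !IH; field. Qed.

Lemma rad_mull f c s x : rad (fun y => c * f y) s x = c * rad f s x.
Proof. by elim: s x => [|a s IH] x //=; rewrite !IH; field. Qed.

Lemma rad_cst c s x : rad (fun=> c) s x = c.
Proof. by elim: s x => [|a s IH] x //=; rewrite !IH; field. Qed.

Lemma rad_shift f s x y : rad f s (x + y) = rad (fun z => f (z + y)) s x.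
Proof. by elim: s x => [|a s IH] x //=; rewrite -!IH (addrAC x y a) (addrAC x y (- a)). Qed.

Lemma rad_scale f s c x :
  rad f [seq c * a | a <- s] (c * x) = rad (fun y => f (c * y)) s x.
Proof. by elim: s x => [|a s IH] x //=; rewrite -!IH mulrBr mulrDr. Qed.

Lemma rad_rem f s a x : a \in s -> rad f s x = rad f (a :: rem a s) x.
Proof.
elim: s x => [|b s IH] x //=; rewrite inE.
have [-> //|/= ab /= as_] := eqVneq.
rewrite !(IH _ as_) /=.
by rewrite !(addrAC x b) !(addrAC x (- b)); field.
Qed.

Lemma rad_cos t s x :
  rad (fun y => cos (t * y)) s x = cos (t * x) * \prod_(a <- s) cos (t * a).
Proof.
elim: s x => [|a s IH] x /=; first by rewrite big_nil mulr1.
by rewrite !IH big_cons mulrDr mulrBr cosD cosB; field.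
Qed.

Lemma rad_sqr s x : rad (fun y => y ^+ 2) s x = x ^+ 2 + \sum_(a <- s) a ^+ 2.
Proof.
elim: s x => [|a s IH] x /=; first by rewrite big_nil addr0.
by rewrite !IH big_cons; field.
Qed.

Lemma rad_pow4 s x : rad (fun y => y ^+ 4) s x =
  x ^+ 4 + 6 * x ^+ 2 * \sum_(a <- s) a ^+ 2 + 3 * (\sum_(a <- s) a ^+ 2) ^+ 2
  - 2 * \sum_(a <- s) a ^+ 4.
Proof.
elim: s x => [|a s IH] x /=; first by rewrite !big_nil; ring.
by rewrite !IH !big_cons; field.
Qed.

Lemma sum_sqr_ge0 s : 0 <= \sum_(a <- s) a ^+ 2.
Proof. by apply: sumr_ge0 => a _; exact: sqr_ge0. Qed.

(** The right side is the sixth moment of [x] plus a centred Gaussian of variance [v]. At each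
    inductive step it exceeds what one more sign contributes by a polynomial with nonnegative
    coefficients. *)
Lemma rad_pow6_le s x : let v := \sum_(a <- s) a ^+ 2 in
  rad (fun y => y ^+ 6) s x <=
  x ^+ 6 + 15 * x ^+ 4 * v + 45 * x ^+ 2 * v ^+ 2 + 15 * v ^+ 3.
Proof.
elim: s x => [|a s IH] x /=; first by rewrite big_nil; lra.
have := IH (x + a); have := IH (x - a); rewrite big_cons /=.
have := sum_sqr_ge0 s; set v := \sum_(a <- s) _ => v0 h1 h2.
apply: (@le_trans _ _ (x ^+ 6 + 15 * x ^+ 4 * a ^+ 2 + 15 * x ^+ 2 * a ^+ 4 + a ^+ 6
  + 15 * (x ^+ 4 + 6 * x ^+ 2 * a ^+ 2 + a ^+ 4) * v
  + 45 * (x ^+ 2 + a ^+ 2) * v ^+ 2 + 15 * v ^+ 3)).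
  by lra.
have x2 := sqr_ge0 x; have a2 := sqr_ge0 a.
set X := x ^+ 2 in x2 *; set A := a ^+ 2 in a2 *.
have -> : x ^+ 6 = X ^+ 3 by rewrite /X; ring.
have -> : x ^+ 4 = X ^+ 2 by rewrite /X; ring.
have -> : a ^+ 6 = A ^+ 3 by rewrite /A; ring.
have -> : a ^+ 4 = A ^+ 2 by rewrite /A; ring.
clearbody X A.
rewrite -subr_ge0.
have -> : X ^+ 3 + 15 * X ^+ 2 * (A + v) + 45 * X * (A + v) ^+ 2 + 15 * (A + v) ^+ 3 -
  (X ^+ 3 + 15 * X ^+ 2 * A + 15 * X * A ^+ 2 + A ^+ 3 +
   15 * (X ^+ 2 + 6 * X * A + A ^+ 2) * v + 45 * (X + A) * v ^+ 2 + 15 * v ^+ 3)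
  = 30 * X * A ^+ 2 + 14 * A ^+ 3 + 30 * A ^+ 2 * v by ring.
by rewrite !addr_ge0 ?mulr_ge0 ?exprn_ge0.
Qed.

End rademacher.

(** * Integrals on the half-line *)

Section integration_tools.
Context {R : realType}.
Notation mu := (@lebesgue_measure R).
Implicit Types (f g F G : R -> R) (x a b c l : R).

Lemma der_cont f x a : is_derive x 1 f a -> {for x, continuous f}.
Proof. by case=> df _; exact/differentiable_continuous/derivable1_diffP. Qed.

Lemma within_cont f (i : interval R) :
  (forall x, x \in i -> {for x, continuous f}) ->
  {within [set` i], continuous f}.
Proof. by move=> cf; apply: continuous_in_subspaceT => x /[!inE] /cf. Qed.

Lemma integral_FTC_cc f F a b : a <= b ->
  (forall x, a <= x <= b -> is_derive x 1 F (f x)) ->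
  (forall x, a <= x <= b -> {for x, continuous f}) ->
  (\int[mu]_(x in `[a, b]) (f x)%:E = (F b - F a)%:E)%E.
Proof.
rewrite le_eqVlt => /predU1P[<- _ _|ab dF cf].
  by rewrite set_itv1 integral_set1 subrr.
rewrite (@continuous_FTC2 _ f F) //.
- by apply: within_cont => x; rewrite in_itv; exact: cf.
- split.
  + by move=> x; rewrite in_itv /= => /andP[/ltW ax /ltW xb]; case: (dF x); rewrite ?ax.
  + apply: cvg_at_right_filter; apply: der_cont.
    by apply: dF; rewrite lexx ltW.
  + apply: cvg_at_left_filter; apply: der_cont.
    by apply: dF; rewrite lexx ltW.
- move=> x; rewrite in_itv /= => /andP[/ltW ax /ltW xb].
  by rewrite derive1E; have [] := dF x; rewrite ?ax.
Qed.

Lemma integral_FTC_cy f F a l :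
  (forall x, a <= x -> is_derive x 1 F (f x)) ->
  (forall x, a <= x -> {for x, continuous f}) ->
  (forall x, a <= x -> 0 <= f x) ->
  F x @[x --> +oo] --> l ->
  (\int[mu]_(x in `[a, +oo[) (f x)%:E = (l - F a)%:E)%E.
Proof.
move=> dF cf f0 Fl; rewrite (@ge0_continuous_FTC2y _ f F a l) //.
- by apply: within_cont => x; rewrite in_itv /= andbT; exact: cf.
- by move=> x /ltW/dF [].
- by apply: cvg_at_right_filter; apply: der_cont; exact: dF.
- move=> x; rewrite in_itv /= andbT => /ltW ax.
  by rewrite derive1E; have [] := dF x ax.
Qed.

Lemma measurable_pos f : (forall x, 0 < x -> {for x, continuous f}) ->
  measurable_fun `](0 : R), +oo[ f.
Proof.
move=> cf; apply: open_continuous_measurable_fun; first exact: interval_open.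
by move=> x; rewrite inE /= in_itv /= andbT; exact: cf.
Qed.

Let Kn (n : nat) : set R := `[n.+1%:R^-1, n.+1%:R]%classic.

Let bigcup_Kn : \bigcup_n Kn n = `]0, +oo[%classic.
Proof.
apply/seteqP; split => x.
  move=> [n _]; rewrite /Kn /= !in_itv /= andbT => /andP[+ _].
  by apply: lt_le_trans; rewrite invr_gt0.
rewrite /= in_itv /= andbT => x0.
have [n xn] : exists n : nat, x <= n.+1%:R.
  by exists (Num.truncn x); apply/ltW; rewrite truncnS_gt.
have [m xm] : exists m : nat, x^-1 <= m.+1%:R.
  by exists (Num.truncn x^-1); apply/ltW; rewrite truncnS_gt.
exists (maxn n m) => //; rewrite /Kn /= in_itv /=; apply/andP; split.
  rewrite -(invrK x) lef_pV2 ?posrE ?invr_gt0 //.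
  by rewrite (le_trans xm) // ler_nat ltnS leq_maxr.
by rewrite (le_trans xn) // ler_nat ltnS leq_maxl.
Qed.

Let Kn_sub n : Kn n `<=` `]0, +oo[%classic.
Proof. by rewrite -bigcup_Kn; exact: bigcup_sup. Qed.

(** The exhaustion by [[1 / (n + 1), n + 1]] stays away from both ends, so that calculus on compact
    segments applies to integrands that may be singular at 0. *)
Lemma cvg_integral_pos f : measurable_fun `](0 : R), +oo[ f ->
  (forall x, 0 < x -> 0 <= f x) ->
  (\int[mu]_(x in `[n.+1%:R^-1%R, n.+1%:R%R]) (f x)%:E @[n --> \oo] -->
   \int[mu]_(x in `]0%R, +oo[) (f x)%:E)%E.
Proof.
move=> mf f0; rewrite -bigcup_Kn.
apply: (@ge0_nondecreasing_set_cvg_integral _ (measurableTypeR R) R Kn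
  (fun x => (f x)%:E) mu).
- apply/nondecreasing_seqP => n; apply/subsetPset => x.
  rewrite /Kn /= !in_itv /= => /andP[h1 h2]; apply/andP; split.
    by apply: le_trans h1; rewrite lef_pV2 ?posrE // ler_nat.
  by rewrite (le_trans h2) // ler_nat.
- by move=> n; exact: measurable_itv.
- move=> n; apply/measurable_EFinP; apply: measurable_funS mf => //.
- by move=> n x /Kn_sub; rewrite /= in_itv /= andbT lee_fin; exact: f0.
Qed.

Lemma integral_pos_le f (c : \bar R) : measurable_fun `](0 : R), +oo[ f ->
  (forall x, 0 < x -> 0 <= f x) ->
  (forall a b, 0 < a -> a <= b -> (\int[mu]_(x in `[a, b]) (f x)%:E <= c)%E) ->
  (\int[mu]_(x in `]0%R, +oo[) (f x)%:E <= c)%E.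
Proof.
move=> mf f0 h; have cv := cvg_integral_pos mf f0.
rewrite -(cvg_lim _ cv) //; apply: lime_le; first by apply/cvg_ex; eexists; exact: cv.
apply: nearW => n; apply: h; first by rewrite invr_gt0.
by rewrite (le_trans (y := 1)) ?invf_le1 ?ler1n.
Qed.

Lemma integral_sub_pos f a b : measurable_fun `](0 : R), +oo[ f ->
  (forall x, 0 < x -> 0 <= f x) -> 0 < a ->
  (\int[mu]_(x in `[a, b]) (f x)%:E <= \int[mu]_(x in `]0%R, +oo[) (f x)%:E)%E.
Proof.
move=> mf f0 a0; apply: ge0_subset_integral => //.
- exact/measurable_EFinP.
- by move=> x; rewrite /= in_itv /= andbT lee_fin; exact: f0.
- by move=> x; rewrite /= !in_itv /= andbT => /andP[/(lt_le_trans a0)].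
Qed.

(* Monotone change of variable on the half-line, as an inequality: applied to a
   map and to its inverse it gives the equality. *)
Lemma integral_subst_le G (phi phi' : R -> R) :
  (forall x, 0 < x -> 0 < phi x) ->
  (forall x, 0 < x -> is_derive x 1 phi (phi' x)) ->
  (forall x, 0 < x -> {for x, continuous phi'}) ->
  (forall x, 0 < x -> 0 < phi' x) ->
  (forall x, 0 < x -> {for x, continuous G}) ->
  (forall x, 0 < x -> 0 <= G x) ->
  (\int[mu]_(x in `]0%R, +oo[) (G (phi x) * phi' x)%:E <=
   \int[mu]_(x in `]0%R, +oo[) (G x)%:E)%E.
Proof.
move=> phi0 dphi cphi' phi'0 cG G0.
have cphi x : 0 < x -> {for x, continuous phi} by move=> /dphi; exact: der_cont.
apply: integral_pos_le.
- apply: measurable_pos => x x0; apply: continuousM; last exact: cphi'.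
  apply: continuous_comp; first exact: cphi.
  exact/cG/phi0.
- by move=> x x0; rewrite mulr_ge0 ?G0 ?phi0 // ltW ?phi'0.
move=> a b a0 ab.
have phi'E x : 0 < x -> derive1 phi x = phi' x.
  by move=> x0; rewrite derive1E; have [] := dphi x x0.
have b0 := lt_le_trans a0 ab.
have near_phi' x : 0 < x -> derive1 phi y @[y --> x] --> phi' x.
  move=> x0; apply: cvg_trans (cphi' x x0); apply: near_eq_cvg.
  near=> y; rewrite phi'E //; near: y; exact: lt_nbhsr.
apply: le_trans (@integral_sub_pos G (phi a) (phi b) _ G0 (phi0 _ a0)); last first.
  exact: measurable_pos.
rewrite (@integration_by_substitution_increasing _ phi) //.
- rewrite le_eqVlt; apply/orP; left; apply/eqP; apply: eq_integral => x.
  rewrite inE /= in_itv /= => /andP[ax _].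
  by rewrite fctE /= phi'E // (lt_le_trans a0).
- move=> x y; rewrite !in_itv /= => /andP[ax _] /andP[_ yb] xy.
  have [c] : exists2 c, c \in `]x, y[ & phi y - phi x = phi' c * (y - x).
    apply: MVT => // [z|].
      by rewrite in_itv /= => /andP[xz _]; apply: dphi; rewrite (lt_trans _ xz) // (lt_le_trans a0).
    apply: within_cont => z; rewrite in_itv /= => /andP[xz _]; apply: cphi.
    by rewrite (lt_le_trans a0) // (le_trans ax).
  rewrite in_itv /= => /andP[xc _] E.
  rewrite -subr_gt0 E mulr_gt0 ?subr_gt0 // phi'0 //.
  by rewrite (lt_trans _ xc) // (lt_le_trans a0).
- move=> x; rewrite in_itv /= => /andP[ax _].
  have x0 := lt_trans a0 ax.
  by rewrite /continuous_at phi'E //; exact: near_phi'.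
- by apply/cvg_ex; exists (phi' a); apply: cvg_at_right_filter; exact: near_phi'.
- by apply/cvg_ex; exists (phi' b); apply: cvg_at_left_filter; exact: near_phi'.
- split.
  + by move=> x; rewrite in_itv /= => /andP[ax _]; case: (dphi x) => //; exact: lt_trans ax.
  + by apply: cvg_at_right_filter; exact: cphi.
  + by apply: cvg_at_left_filter; exact: cphi.
- apply: within_cont => x; rewrite in_itv /= => /andP[ax _]; apply: cG.
  by rewrite (lt_le_trans _ ax) // phi0.
Unshelve. all: by end_near. Qed.

Lemma integral_scale G c : 0 < c ->
  (forall x, 0 < x -> {for x, continuous G}) ->
  (forall x, 0 < x -> 0 <= G x) ->
  (\int[mu]_(x in `]0%R, +oo[) (c * G (c * x))%:E =
   \int[mu]_(x in `]0%R, +oo[) (G x)%:E)%E.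
Proof.
have le c' (H : R -> R) : 0 < c' -> (forall x, 0 < x -> {for x, continuous H}) ->
    (forall x, 0 < x -> 0 <= H x) ->
    (\int[mu]_(x in `]0%R, +oo[) (c' * H (c' * x)%R)%:E <=
     \int[mu]_(x in `]0%R, +oo[) (H x)%:E)%E.
  move=> c0 cH H0.
  under eq_integral do rewrite mulrC.
  apply: (@integral_subst_le H (fun x => c' * x) (fun=> c')) => // [x|x|x] x0.
  - by rewrite mulr_gt0.
  - by der; rewrite mulr1.
  - exact: cst_continuous.
move=> c0 cG G0; apply/le_anti/andP; split; first exact: le.
apply: (@le_trans _ _
  (\int[mu]_(x in `]0%R, +oo[) (c^-1 * (c * G (c * (c^-1 * x))%R))%:E)%E).
  rewrite le_eqVlt; apply/orP; left; apply/eqP; apply: eq_integral => x _; congr EFin.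
  by rewrite !mulrA mulVf ?gt_eqF // mul1r mulfV ?gt_eqF // mul1r.
apply: (le c^-1 (fun x => c * G (c * x))) => [|x x0|x x0].
- by rewrite invr_gt0.
- apply: continuousM; first exact: cst_continuous.
  apply: continuous_comp; first by apply: continuousM; [exact: cst_continuous|exact: cvg_id].
  by apply: cG; rewrite mulr_gt0.
- by rewrite mulr_ge0 ?G0 ?mulr_gt0 // ltW.
Qed.

End integration_tools.

(** * Powers of the cosine against a Gaussian *)

Section head_of_comparison.
Context {R : realType}.
Notation mu := (@lebesgue_measure R).
Implicit Types (s u x y r c : R).

(** The exponent agrees with [ln (cos u)] to fourth order and equals [- 1 / (2 * (r - 1 / 6))] for
    [r = u ^ -2]; the second property makes the integral below tractable. By the Taylor bounds,
    monotonicity comes down to [x ^ 5 * (9 - x ^ 2) >= 0]. *)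
Lemma cos_le_expR u : 0 <= u <= 11 / 7 ->
  cos u <= expR (- (3 * u ^+ 2 / (6 - u ^+ 2))).
Proof.
move=> /andP[u0 u1].
have D0 x : 0 <= x <= u -> 0 < 6 - x ^+ 2 by move=> /andP[x0 xu]; nra.
pose g x : R := - (cos x * expR (3 * x ^+ 2 * (6 - x ^+ 2)^-1)).
pose g' x : R := expR (3 * x ^+ 2 * (6 - x ^+ 2)^-1) *
  (sin x - cos x * (36 * x / (6 - x ^+ 2) ^+ 2)).
have : g 0 <= g u.
  apply: (@is_derive_homo _ g g') => // x xu.
    have Dx := D0 x xu; rewrite /g; der; first by rewrite gt_eqF.
    by rewrite /g' /=; field; rewrite gt_eqF.
  have Dx := D0 x xu; move: xu => /andP[x0 xu].
  rewrite mulr_ge0 ?expR_ge0 // subr_ge0.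
  have x2 : x ^+ 2 <= 4 by nra.
  rewrite mulrA ler_pdivrMr ?exprn_gt0 //.
  apply: (@le_trans _ _ ((x - x ^+ 3 / 6) * (6 - x ^+ 2) ^+ 2)); last first.
    by rewrite ler_pM2r ?exprn_gt0 // sin_geT3.
  apply: (@le_trans _ _ ((1 - x ^+ 2 / 2 + x ^+ 4 / 24) * (36 * x))).
    by rewrite ler_wpM2r ?cos_leT4 // mulr_ge0.
  rewrite -subr_ge0.
  have -> : (x - x ^+ 3 / 6) * (6 - x ^+ 2) ^+ 2 -
      (1 - x ^+ 2 / 2 + x ^+ 4 / 24) * (36 * x) =
      x * x ^+ 4 / 6 * (9 - x ^+ 2) by field.
  by rewrite mulr_ge0 ?divr_ge0 ?mulr_ge0 ?exprn_ge0 //; lra.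
rewrite /g expr0n /= mulr0 mul0r expR0 cos0 mulr1 lerN2 => h.
by rewrite expRN -[leRHS]mul1r ler_pdivlMr ?expR_gt0.
Qed.

Lemma primitive_exists (f : R -> R) (a : R) :
  (forall x, a <= x -> {for x, continuous f}) ->
  exists F : R -> R, forall x, a < x -> is_derive x 1 F (f x).
Proof.
move=> cf; exists (fun y => \int[mu]_(t in `[a, y]) f t)%R => x ax.
have [] := @continuous_FTC1_closed R f a x (x + 1) _ _ ax (cf x (ltW ax)).
- by rewrite ltrDl.
- apply: continuous_compact_integrable; first exact: segment_compact.
  by apply: within_cont => y; rewrite in_itv /= => /andP[/cf].
- by move=> dF dFE; split; [exact: dF|rewrite -derive1E; exact: dFE].
Qed.

(* In the variable [r = u ^- 2] the two Gaussian-like terms differ by the shift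
   [r |-> r - 1 / 6], so that the integral is that of [expR (- s / (2 * r))]
   over an interval of length [1 / 6] near infinity, minus the same near
   [(pi / 2) ^- 2]. *)
Lemma head_lower s : 2 <= s ->
  ((19 / 250)%:E <= \int[mu]_(u in `[((100 * s)^-1)%R, (pi / 2)%R])
     ((expR (- (s * u ^+ 2 / 2)) - `|cos u| `^ s) / u ^+ 3)%:E)%E.
Proof.
move=> s2; set e := (100 * s)^-1; set X := pi / 2.
have X0 : 80 / 51 < X := @pihalf_gt R.
have X1 : X < 11 / 7 := @pihalf_lt R.
have s0 : 0 < s by lra.
have e0 : 0 < e by rewrite invr_gt0; lra.
have e1 : e <= 1 / 200.
  by rewrite /e -[leRHS]invrK lef_pV2 ?posrE ?invr_gt0; lra.
have eX : e <= X by lra.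
(* The cutoff is chosen so that [e ^ -2] is of order [s ^ 2]; the exponential there is then close to
   1 uniformly in [s]. *)
have er : 1000 * s + 1 <= (e ^+ 2)^-1 by rewrite /e exprVn invrK; nra.
have cosX u : 0 <= u -> u <= X -> 0 <= cos u.
  move=> u0 uX; apply: cos_ge0_pihalf; rewrite uX andbT.
  by rewrite (le_trans _ u0) // oppr_le0 divr_ge0 ?pi_ge0.
move: er; clearbody e X.
pose E r : R := expR (- (s / 2) * r^-1).
have E_homo (r r' : R) : 0 < r -> r <= r' -> E r <= E r'.
  move=> r0 rr'; rewrite ler_expR !mulNr lerN2 ler_wpM2l //; first by lra.
  by rewrite lef_pV2 ?posrE // (lt_le_trans r0).
have E_der r : 0 < r -> is_derive r 1 E (expR (- (s / 2) * r^-1) * (s / 2 * r ^- 2)).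
  move=> r0; rewrite /E; der; first by rewrite gt_eqF.
  by field; rewrite gt_eqF.
have [Q dQ] : exists Q : R -> R, forall r, 1 / 10 < r -> is_derive r 1 Q (E r).
  apply: primitive_exists => r r10; apply: der_cont; apply: E_der; lra.
have Qmean r : 1 / 10 + 1 / 6 < r ->
    E (r - 1 / 6) * (1 / 6) <= Q r - Q (r - 1 / 6) <= E r * (1 / 6).
  move=> r0; have [c] : exists2 c, c \in `[r - 1 / 6, r] &
      Q r - Q (r - 1 / 6) = E c * (r - (r - 1 / 6)).
    apply: MVT_segment; first by lra.
      by move=> x; rewrite in_itv /= => /andP[? _]; apply: dQ; lra.
    apply: within_cont => x; rewrite in_itv /= => /andP[? _].
    by apply: der_cont; apply: dQ; lra.
  rewrite in_itv /= => /andP[c1 c2] ->.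
  have -> : r - (r - 1 / 6) = 1 / 6 by ring.
  by rewrite !ler_pM2r ?E_homo //; lra.
have rX u : e <= u <= X -> 2 / 5 < u ^- 2.
  move=> /andP[eu uX]; have u0 : 0 < u := lt_le_trans e0 eu.
  rewrite -[ltLHS]invrK ltf_pV2 ?posrE ?invr_gt0 ?exprn_gt0 //; nra.
pose h u := (E (u ^- 2) - E (u ^- 2 - 1 / 6)) / u ^+ 3.
pose H u := - (Q ((u ^+ 2)^-1) - Q ((u ^+ 2)^-1 - 1 / 6)) / 2.
have dH u : e <= u <= X -> is_derive u 1 H (h u).
  move=> euX; have r0 := rX u euX; move: euX => /andP[eu uX].
  have u0 : 0 < u := lt_le_trans e0 eu.
  have u20 : u ^+ 2 != 0 by rewrite gt_eqF ?exprn_gt0.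
  have d1 : is_derive u 1 (fun u => (u ^+ 2)^-1) (- 2 * u ^- 3).
    by der => //=; field; rewrite gt_eqF.
  have d2 : is_derive u 1 (fun u => (u ^+ 2)^-1 - 1 / 6) (- 2 * u ^- 3).
    apply: is_derive_eq (der_add d1 (der_cst (- (1 / 6)) u)) _.
    by rewrite addr0.
  have q1 := @der_comp R Q (fun u => (u ^+ 2)^-1) _ _ _ (dQ (u ^- 2) ltac:(lra)) d1.
  have q2 := @der_comp R Q (fun u => (u ^+ 2)^-1 - 1 / 6) _ _ _
    (dQ (u ^- 2 - 1 / 6) ltac:(lra)) d2.
  apply: (is_derive_eq (der_mulr 2^-1 (der_opp (der_add q1 (der_opp q2))))).
  by rewrite /h; field; rewrite gt_eqF.
have ch u : e <= u <= X -> {for u, continuous h}.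
  move=> euX; have r0 := rX u euX; move: euX => /andP[eu uX].
  have u0 : 0 < u := lt_le_trans e0 eu.
  have u20 : u ^+ 2 != 0 by rewrite gt_eqF ?exprn_gt0.
  have u30 : u ^+ 3 != 0 by rewrite gt_eqF ?exprn_gt0.
  rewrite /h /E; eapply der_cont; der_rec => //; rewrite gt_eqF //; lra.
have h_le u : e <= u <= X ->
    h u <= (expR (- (s * u ^+ 2 / 2)) - `|cos u| `^ s) / u ^+ 3.
  move=> euX; have r0 := rX u euX; move: euX => /andP[eu uX].
  have u0 : 0 < u := lt_le_trans e0 eu.
  have u2 : u ^+ 2 < 3 by nra.
  rewrite ler_pM2r ?invr_gt0 ?exprn_gt0 //; apply: lerB.
    rewrite /E ler_expR le_eqVlt; apply/orP; left; apply/eqP.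
    by field; rewrite gt_eqF.
  have cu : 0 <= cos u by apply: cosX => //; lra.
  rewrite ger0_norm //.
  have u1 : 0 <= u <= 11 / 7 by apply/andP; split; lra.
  apply: (le_trans (ge0_ler_powR _ _ _ (cos_le_expR u1))).
  - lra.
  - by rewrite nnegrE.
  - by rewrite nnegrE expR_ge0.
  rewrite -expRM ler_expR le_eqVlt; apply/orP; left; apply/eqP.
  by field; rewrite !gt_eqF //; nra.
have h_ge0 u : e <= u <= X -> 0 <= h u.
  move=> euX; have r0 := rX u euX; move: euX => /andP[eu uX].
  by rewrite divr_ge0 ?exprn_ge0 //; [rewrite subr_ge0; apply: E_homo; lra|lra].
move=> er; apply: (@le_trans _ _ (\int[mu]_(u in `[e, X]) (h u)%:E)%E); last first.
  apply: ge0_le_integral => //.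
  - apply/measurable_EFinP; apply: subspace_continuous_measurable_fun => //.
    by apply: within_cont => u; rewrite in_itv; exact: ch.
  - apply/measurable_EFinP; apply: measurable_funM.
      apply: measurable_funB.
        apply: measurable_funTS; apply: continuous_measurable_fun => u.
        by apply: der_cont; der_rec.
      apply: (measurableT_comp (measurable_powR s)) => //.
      apply: measurableT_comp => //; apply: measurable_funTS.
      by apply: continuous_measurable_fun; exact: continuous_cos.
    apply: subspace_continuous_measurable_fun => //.
    apply: within_cont => u; rewrite in_itv /= => /andP[eu _].
    by eapply der_cont; der_rec; rewrite gt_eqF ?exprn_gt0 //; lra.
rewrite (integral_FTC_cc eX dH ch) lee_fin /H.
have /andP[_ QX] := Qmean (X ^+ 2)^-1 ltac:(by have := rX X; rewrite lexx eX => /(_ isT); lra).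
have /andP[Qe _] := Qmean (e ^+ 2)^-1 ltac:(lra).
have Ee : 999 / 1000 <= E ((e ^+ 2)^-1 - 1 / 6).
  apply: (@le_trans _ _ (E (1000 * s))); last by apply: E_homo; lra.
  apply: le_trans (expR_ge1Dx _); rewrite invfM.
  have -> : - (s / 2) * (1000^-1 * s^-1) = - (1 / 2000) by field; rewrite gt_eqF.
  by lra.
(* The case [s = 2] is the worst. The number 123 / 400 is one eighth of 246 / 100, a lower bound for
   [X ^ 2]; after this division a cubic Taylor polynomial is accurate enough. *)
have EX : E ((X ^+ 2)^-1) <= 43 / 500.
  rewrite /E invrK mulNr expRN; set y := expR _.
  have y0 : 0 < y := expR_gt0 _.
  suff hy : 500 / 43 <= y.
    by rewrite -(ler_pM2l y0) mulfV ?gt_eqF //; lra.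
  have h8 : expR (123 / 400 : R) ^+ 8 <= y.
    by rewrite -expRM_natl ler_expR; nra.
  have h1 : 53 / 39 <= expR (123 / 400 : R).
    have := @expR_geT3 R (123 / 400) ltac:(lra); apply: le_trans.
    clear; lra.
  have h2 : (53 / 39) ^+ 8 <= expR (123 / 400 : R) ^+ 8.
    by apply: lerXn2r => //; rewrite nnegrE ?expR_ge0 //; lra.
  apply: le_trans h8; apply: le_trans h2.
  clear; lra.
lra.
Qed.

End head_of_comparison.

Section tail_of_comparison.
Context {R : realType}.
Notation mu := (@lebesgue_measure R).
Implicit Types (u x y z : R).

(* [h] majorizes [cos u ^ 2 / u ^ 3 = (1 + cos (2 * u)) / (2 * u ^ 3)] and has
   the explicit primitive [- H]. In [H], [3 / 8 / D] is a rational approximation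
   of the amplitude of the oscillating part; [W] is the defect it leaves, for
   which the extra [9 / 1000 * u ^- 3] compensates. *)
Let D u : R := u ^+ 4 + 7 / 2 * u ^+ 2 - 6 / 5.
Let D' u : R := 4 * u ^+ 3 + 7 * u.
Let D'' u : R := 12 * u ^+ 2 + 7.

Let H u : R := (1 / 4 + 9 / 2000) * u ^- 2 +
  (3 / 16 * D' u * (D u) ^- 2 - 1 / 4 * u ^- 3) * sin (2 * u) +
  3 / 8 * (D u)^-1 * cos (2 * u).

Let W u : R := 3 / 4 * (D u)^-1 - 3 / 16 * (D'' u * (D u) ^- 2 -
  2 * D' u ^+ 2 * (D u) ^- 3) - 3 / 4 * u ^- 4.

Let h u : R := (1 / 2 + 9 / 1000 + 1 / 2 * cos (2 * u)) * u ^- 3 + W u * sin (2 * u).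

Let D_gt0 u : 1 <= u -> 0 < D u.
Proof. by rewrite /D => u1; nra. Qed.

Let der_D u : is_derive u 1 D (D' u).
Proof. by rewrite /D; der; rewrite /D' /=; field. Qed.

Let der_D' u : is_derive u 1 D' (D'' u).
Proof. by rewrite /D'; der; rewrite /D'' /=; field. Qed.

Let der_negH u : 1 <= u -> is_derive u 1 (fun u => - H u) (h u).
Proof.
move=> u1; have D0 := D_gt0 u1; have u0 : 0 < u by lra.
have dD := der_D u; have dD' := der_D' u.
rewrite /H; der; rewrite ?gt_eqF ?exprn_gt0 //=.
by rewrite /h /W; field; rewrite !gt_eqF.
Qed.

Let W_le u : 80 / 51 <= u -> `|W u| <= 9 / 1000 * u ^- 3.
Proof.
move=> u0; have D0 : 0 < D u by apply: D_gt0; lra.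
set z := u ^+ 2.
have z0 : 246 / 100 <= z by rewrite /z; nra.
have DE : D u = z ^+ 2 + 7 / 2 * z - 6 / 5 by rewrite /D /z; ring.
pose N : R := 6 * z ^+ 5 - 151 / 5 * z ^+ 4 - 82 / 5 * z ^+ 3 + 4332 / 25 * z ^+ 2
  - 1512 / 25 * z + 864 / 125.
have WE : W u = 3 / 16 * N / (z ^+ 2 * D u ^+ 3).
  have D'E : D' u ^+ 2 = z * (4 * z + 7) ^+ 2 by rewrite /D' /z; ring.
  rewrite /W D'E /D'' -/z (_ : u ^- 4 = z ^- 2); last by rewrite /z -exprM.
  have zn0 : z != 0 by rewrite gt_eqF //; lra.
  transitivity ((3 / 16 * (4 * z ^+ 2 * D u ^+ 2 - (12 * z + 7) * z ^+ 2 * D u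
     + 2 * z ^+ 3 * (4 * z + 7) ^+ 2 - 4 * D u ^+ 3)) / (z ^+ 2 * D u ^+ 3)).
    by field; rewrite zn0 gt_eqF.
  by congr (_ / _); rewrite /N DE; field.
(* The inequality [u <= (u ^ 2 + 9) / 6], that is [(u - 3) ^ 2 >= 0], removes the odd power; the
   rest is polynomial in [z]. *)
have u3 : u ^+ 3 <= z * (z + 9) / 6.
  have -> : u ^+ 3 = z * u by rewrite /z; ring.
  rewrite -mulrA; apply: ler_wpM2l; first by lra.
  by have := sqr_ge0 (u - 3); rewrite /z; lra.
have u30 : 0 < u ^+ 3 by rewrite exprn_gt0 //; lra.
suff hN : `|N| * (z + 9) * (3 / 16) <= 27 / 500 * z * D u ^+ 3.
  have zD0 : 0 < z ^+ 2 * D u ^+ 3 by rewrite mulr_gt0 ?exprn_gt0 //; lra.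
  have -> : `|W u| = 3 / 16 * `|N| / (z ^+ 2 * D u ^+ 3).
    by rewrite WE normrM normfV (gtr0_norm zD0) normrM ger0_norm.
  rewrite ler_pdivrMr // [leRHS]mulrAC ler_pdivlMr //.
  apply: (@le_trans _ _ (3 / 16 * `|N| * (z * (z + 9) / 6))).
    by apply: ler_wpM2l => //; rewrite mulr_ge0.
  have z60 : 0 <= z / 6 by lra.
  by have := ler_wpM2l z60 hN; lra.
(* After the shift the powers of [y] are nonnegative and the claim is linear in them. Besides these
   signs, only [q0] is supplied, to absorb a negative middle coefficient. *)
have [y [y0 zy]] : exists y, 0 <= y /\ z = y + 12 / 5.
  by exists (z - 12 / 5); split; [lra|ring].
have q0 : 0 <= y ^+ 3 * (27 / 500 * y ^+ 4 - 21 / 5 * y ^+ 2 + 90).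
  apply: mulr_ge0; first exact: exprn_ge0.
  by have := sqr_ge0 (y ^+ 2 - 39); have := sqr_ge0 y; lra.
have y2 := exprn_ge0 2 y0; have y3 := exprn_ge0 3 y0; have y4 := exprn_ge0 4 y0.
have y5 := exprn_ge0 5 y0; have y6 := exprn_ge0 6 y0; have y7 := exprn_ge0 7 y0.
clear z0 u3 WE; rewrite DE; clear DE; have [_|_] := ger0P N; rewrite /N zy; clear N zy.
 lra.
 lra.
Qed.

(** Deliberately crude: it serves to make the primitive vanish at infinity. *)
Let H_le u : 1 <= u -> `|H u| <= 2 / u.
Proof.
move=> u1; have D0 := D_gt0 u1; have u0 : 0 < u by lra.
have V (x : R) : u <= x -> 0 <= x^-1 <= u^-1.
  by move=> ux; rewrite invr_ge0 lef_pV2 ?posrE ?(lt_le_trans u0 ux) // ux andbT; lra.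
have /andP[p2 v2] := V (u ^+ 2) ltac:(nra).
have /andP[p3 v3] := V (u ^+ 3) ltac:(nra).
have /andP[pD vD] := V (D u) ltac:(rewrite /D; nra).
have vD' : 0 <= D' u * (D u) ^- 2 <= 4 * (D u)^-1.
  rewrite divr_ge0 ?exprn_ge0 ?(ltW D0) //=; last by rewrite /D'; nra.
  have -> : 4 * (D u)^-1 = 4 * D u / D u ^+ 2 by field; rewrite gt_eqF.
  by rewrite ler_pM2r ?invr_gt0 ?exprn_gt0 // /D /D'; nra.
move: vD' => /andP[pD' vD'].
have bnd (c t x : R) : `|t| <= 1 -> `|c| <= x -> `|c * t| <= x.
  move=> t1 cx; rewrite normrM (le_trans _ cx) // ler_piMr //.
rewrite /H -mulrA; move: p2 v2 p3 v3 pD vD pD' vD'.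
move: (u ^- 2) (u ^- 3) (D' u * _) ((D u)^-1) (sin _) (cos _) (sin_max (2 * u)) (cos_max (2 * u)).
move=> x2 x3 a b S C S1 C1 p2 v2 p3 v3 pb vb pa va.
have h2 := bnd (3 / 16 * a - 1 / 4 * x3) S u^-1 S1.
have h3 := bnd (3 / 8 * b) C (1 / 2 * u^-1) C1.
apply: le_trans (ler_normD _ _) _; apply: le_trans (lerD (ler_normD _ _) (lexx _)) _.
have {}h2 : `|(3 / 16 * a - 1 / 4 * x3) * S| <= u^-1.
  by apply: h2; rewrite ler_norml; apply/andP; split; lra.
have {}h3 : `|3 / 8 * b * C| <= 1 / 2 * u^-1 by apply: h3; rewrite ger0_norm; lra.
by rewrite [X in X + _ + _]ger0_norm; lra.
Qed.

Lemma tail_upper :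
  (\int[mu]_(u in `[(pi / 2)%R, +oo[) (cos u ^+ 2 / u ^+ 3)%:E <= (19 / 250)%:E)%E.
Proof.
set X := pi / 2.
have X0 : 80 / 51 < X := @pihalf_gt R.
have X1 : X < 11 / 7 := @pihalf_lt R.
have hE u : X <= u -> cos u ^+ 2 / u ^+ 3 <= h u.
  move=> Xu; have u0 : 0 < u by lra.
  have Wu : `|W u| <= 9 / 1000 * u ^- 3 by apply: W_le; lra.
  have c2 : cos (2 * u) = 2 * cos u ^+ 2 - 1.
    by rewrite mulr_natl cos_mulr2n mulr_natl.
  rewrite /h c2.
  have : - (W u * sin (2 * u)) <= 9 / 1000 * u ^- 3.
    apply: le_trans Wu; apply: le_trans (ler_norm _) _.
    by rewrite normrN normrM ler_piMr // sin_max.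
  lra.
have h0 u : X <= u -> 0 <= h u.
  move=> Xu; apply: le_trans (hE u Xu).
  by rewrite divr_ge0 ?sqr_ge0 ?exprn_ge0 //; lra.
have ch u : X <= u -> {for u, continuous h}.
  move=> Xu; have u1 : 1 <= u by lra.
  have Du := D_gt0 u1; have dD := der_D u; have dD' := der_D' u.
  have dD'' : is_derive u 1 D'' (24 * u) by rewrite /D''; der; rewrite /=; field.
  by rewrite /h /W; eapply der_cont; der_rec; rewrite ?gt_eqF ?exprn_gt0 //; lra.
have cvH : (fun u => - H u) u @[u --> +oo] --> (0 : R).
  apply/cvgrPdist_le => e e0; near=> u.
  have u1 : 1 <= u by near: u; apply: nbhs_pinfty_ge; rewrite num_real.
  have ue : 2 / e <= u by near: u; apply: nbhs_pinfty_ge; rewrite num_real.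
  rewrite sub0r opprK; apply: le_trans (H_le u1) _.
  by rewrite ler_pdivrMr ?(lt_le_trans _ u1) // mulrC -ler_pdivrMr.
apply: (@le_trans _ _ (\int[mu]_(u in `[X, +oo[) (h u)%:E)%E).
  apply: ge0_le_integral => //.
  - move=> u; rewrite /= in_itv /= andbT lee_fin => Xu.
    by rewrite divr_ge0 ?sqr_ge0 ?exprn_ge0 //; lra.
  - apply/measurable_EFinP; apply: subspace_continuous_measurable_fun => //.
    apply: within_cont => u; rewrite in_itv /= andbT => Xu.
    by eapply der_cont; der_rec; rewrite ?gt_eqF ?exprn_gt0 //; lra.
  - apply/measurable_EFinP; apply: subspace_continuous_measurable_fun => //.
    by apply: within_cont => u; rewrite in_itv /= andbT => /ch.
  - by move=> u; rewrite /= in_itv /= andbT lee_fin; exact: hE.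
have dH u : X <= u -> is_derive u 1 (fun u => - H u) (h u).
  by move=> Xu; apply: der_negH; lra.
rewrite (integral_FTC_cy dH ch h0 cvH).
rewrite lee_fin sub0r opprK /H.
have -> : 2 * X = pi by rewrite /X; field.
rewrite cospi sinpi mulr0 addr0 mulrN1.
have Z0 : 246 / 100 <= X ^+ 2 by nra.
have Z2 : X ^+ 2 <= 121 / 49 by nra.
have D1 : D X <= 271 / 20.
  rewrite /D; have -> : X ^+ 4 = X ^+ 2 * X ^+ 2 by ring.
  have : (X ^+ 2) * (X ^+ 2) <= 121 / 49 * (121 / 49) by apply: ler_pM; lra.
  lra.
have Z1 : X ^- 2 <= 100 / 246.
  by rewrite -[leRHS]invrK lef_pV2 ?posrE; lra.
have D2 : 20 / 271 <= (D X)^-1.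
  have DX0 : 0 < D X by apply: D_gt0; lra.
  by rewrite -(ler_pM2r DX0) mulVf ?gt_eqF //; lra.
lra.
Unshelve. all: by end_near. Qed.

End tail_of_comparison.

(** * Cosine powers and Gaussians against the kernels [t ^ -(p + 1)] *)

Section fourier_comparison.
Context {R : realType}.
Notation mu := (@lebesgue_measure R).
Implicit Types (s t u x p : R).

(** With extended-real values, comparison and linearity for nonnegative [h] raise no question of
    convergence. *)
Definition riesz p (h : R -> R) : \bar R :=
  (\int[mu]_(t in `]0%R, +oo[) (h t * t `^ (- (p + 1)))%:E)%E.

Lemma measurable_powR_cos (s : R) (A : set R) :
  measurable_fun A (fun t => `|cos t| `^ s).
Proof.
apply: measurable_funTS; apply: (measurableT_comp (measurable_powR s)) => //.
by apply: measurableT_comp => //; apply: continuous_measurable_fun; exact: continuous_cos.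
Qed.

Lemma measurable_riesz p (h : R -> R) : measurable_fun `](0 : R), +oo[ h ->
  measurable_fun `](0 : R), +oo[ (fun t => h t * t `^ (- (p + 1))).
Proof.
move=> mh; apply: measurable_funM => //; apply: measurable_pos => t t0.
by eapply der_cont; der_rec.
Qed.

Lemma measurable_polyX2 (a b : R) (A : set R) :
  measurable_fun A (fun t : R => a + b * t ^+ 2).
Proof.
apply: measurable_funTS; apply: continuous_measurable_fun => t.
by apply: der_cont; der_rec.
Qed.

Lemma cos_pow_ge s t : 1 <= s -> 0 <= t -> 0 <= `|cos t| `^ s - 1 + s / 2 * t ^+ 2.
Proof.
move=> s1 t0; have := @powR_ge_bernoulli R `|cos t| s s1 (normr_ge0 _).
have := cos_geT2 t0; have := ler_norm (cos t).
set c := `|cos t| => h1 h2 h3.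
have : s * (- (t ^+ 2 / 2)) <= s * (c - 1) by rewrite ler_wpM2l //; lra.
lra.
Qed.

Lemma gauss_rem_ge s t : 0 <= expR (- (s / 2 * t ^+ 2)) - 1 + s / 2 * t ^+ 2.
Proof. by have := expR_ge1Dx (- (s / 2 * t ^+ 2)); lra. Qed.

Lemma cos_pow_le_gauss s t : 0 <= s -> 0 <= t <= pi / 2 ->
  `|cos t| `^ s <= expR (- (s / 2 * t ^+ 2)).
Proof.
move=> s0 /andP[t0 tX].
have c0 : 0 <= cos t.
  apply: cos_ge0_pihalf; rewrite tX andbT (le_trans _ t0) // oppr_le0.
  by rewrite divr_ge0 ?pi_ge0.
have t1 : 0 <= t <= 11 / 7 by have := @pihalf_lt R; rewrite t0 /=; lra.
have h : cos t <= expR (- (t ^+ 2 / 2)).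
  apply: le_trans (cos_le_expR t1) _; rewrite ler_expR lerN2.
  have h1 : 0 < 6 - t ^+ 2 by move: t1 => /andP[_ t1]; nra.
  by rewrite ler_pdivlMr //; have := sqr_ge0 (t ^+ 2); have := sqr_ge0 t; nra.
have -> : - (s / 2 * t ^+ 2) = - (t ^+ 2 / 2) * s by field.
by rewrite ger0_norm // expRM ge0_ler_powR ?nnegrE ?expR_ge0.
Qed.

(** The two integrals may be infinite, so they are not subtracted. Instead a gain [dd] before
    [pi / 2] is added on the left and a loss [uu] after [pi / 2] on the right. This makes the
    inequality pointwise, and the integrals of [dd] and [uu] are separated by the finite number
    [c * (19 / 250)]. *)
Lemma riesz_cos_pow_le p s : 2 < p -> 2 <= s ->
  (riesz p (fun t => (`|cos t| `^ s - 1 + s / 2 * t ^+ 2)%R) <=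
   riesz p (fun t => (expR (- (s / 2 * t ^+ 2)) - 1 + s / 2 * t ^+ 2)%R))%E.
Proof.
move=> p2 s2; set X : R := pi / 2.
have X0 : 80 / 51 < X := @pihalf_gt R.
have Xgt0 : 0 < X by lra.
pose e := (100 * s)^-1; have e0 : 0 < e by rewrite invr_gt0; lra.
have s0 : 0 <= s by lra.
(* The decreasing factor [t ^ (2 - p)] of the kernel is at least [c] before [X] and at most [c]
   after it. *)
pose c := X `^ (2 - p); have c0 : 0 < c by rewrite powR_gt0.
have kE t : 0 < t -> t `^ (- (p + 1)) = t `^ (2 - p) / t ^+ 3.
  move=> t0; have -> : - (p + 1) = (2 - p) - 3 by ring.
  rewrite powRB; last by rewrite (gt_eqF t0) implybT.
  by rewrite -(powR_mulrn _ (ltW t0)).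
have antitone t t' : 0 < t -> t <= t' -> t' `^ (2 - p) <= t `^ (2 - p).
  move=> t0 tt'; have -> : 2 - p = - (p - 2) by ring.
  have t'0 := lt_le_trans t0 tt'.
  rewrite !powRN lef_pV2 ?posrE ?powR_gt0 //.
  by rewrite ge0_ler_powR ?nnegrE ?(ltW t0) ?(ltW t'0) //; lra.
pose g t := (`|cos t| `^ s - 1 + s / 2 * t ^+ 2) * t `^ (- (p + 1)).
pose f t := (expR (- (s / 2 * t ^+ 2)) - 1 + s / 2 * t ^+ 2) * t `^ (- (p + 1)).
pose dd t := c * ((expR (- (s * t ^+ 2 / 2)) - `|cos t| `^ s) / t ^+ 3).
pose uu t := c * (cos t ^+ 2 / t ^+ 3).
pose D : set R := `]0, +oo[%classic.
pose A : set R := `[e, X]%classic.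
pose B : set R := `[X, +oo[%classic.
have AD : D `&` A = A.
  apply/setIidPr => t; rewrite /D /A /= !in_itv /= andbT => /andP[+ _].
  exact: lt_le_trans.
have BD : D `&` B = B.
  by apply/setIidPr => t; rewrite /D /B /= !in_itv /= !andbT; exact: lt_le_trans.
have g0 t : 0 < t -> 0 <= g t.
  by move=> t0; rewrite mulr_ge0 ?powR_ge0 ?cos_pow_ge ?(ltW t0) //; lra.
have f0 t : 0 < t -> 0 <= f t.
  by move=> t0; rewrite mulr_ge0 ?powR_ge0 ?gauss_rem_ge.
have dd0 t : A t -> 0 <= dd t.
  rewrite /A /= in_itv /= => /andP[et tX]; have t0 := lt_le_trans e0 et.
  rewrite mulr_ge0 ?(ltW c0) // divr_ge0 ?exprn_ge0 ?(ltW t0) // subr_ge0.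
  by rewrite mulrAC cos_pow_le_gauss // (ltW t0).
have uu0 t : B t -> 0 <= uu t.
  rewrite /B /= in_itv /= andbT => /(lt_le_trans Xgt0) t0.
  by rewrite mulr_ge0 ?(ltW c0) // divr_ge0 ?sqr_ge0 ?exprn_ge0 // ltW.
have mid t : 0 < t -> ((g t)%:E + ((EFin \o dd) \_ A) t <= (f t)%:E + ((EFin \o uu) \_ B) t)%E.
  move=> t0.
  have le_f : t <= X -> ((g t)%:E + ((EFin \o dd) \_ A) t <= (f t)%:E)%E.
    move=> tX; rewrite patchE; case: ifPn => [|_].
      rewrite inE /A /= in_itv /= => /andP[et _].
      rewrite -EFinD lee_fin /g /f /dd -subr_ge0.
      have k0 : 0 <= (t `^ (2 - p) - c) / t ^+ 3.
        by rewrite divr_ge0 ?exprn_ge0 ?(ltW t0) // subr_ge0 antitone.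
      have h : `|cos t| `^ s <= expR (- (s / 2 * t ^+ 2)).
        by rewrite cos_pow_le_gauss // (ltW t0).
      rewrite kE // (_ : s * t ^+ 2 / 2 = s / 2 * t ^+ 2); last by field.
      move: h; rewrite -subr_ge0 => h.
      by have := mulr_ge0 h k0; congr (_ <= _); field; rewrite gt_eqF.
    rewrite adde0 lee_fin /g /f ler_wpM2r ?powR_ge0 // !lerD2r.
    by rewrite cos_pow_le_gauss // (ltW t0).
  have [tX|Xt] := leP t X.
    apply: le_trans (le_f tX) _; rewrite leeDl // patchE; case: ifPn => // /[!inE] tB.
    by rewrite lee_fin uu0.
  rewrite [in leLHS]patchE memNset; last first.
    by rewrite /A /= in_itv /= => /andP[_]; rewrite leNgt Xt.
  rewrite adde0 patchE mem_set; last by rewrite /B /= in_itv /= andbT ltW.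
  rewrite -EFinD lee_fin /g /f /uu.
  have cs : `|cos t| `^ s <= cos t ^+ 2.
    rewrite -[leRHS]real_normK ?num_real // -[leRHS]powR_mulrn ?normr_ge0 //.
    have [->|cn0] := eqVneq `|cos t| 0; first by rewrite !powR0 //; lra.
    by apply: ger_powR => //; rewrite lt0r cn0 normr_ge0 cos_max.
  have h1 : `|cos t| `^ s * t `^ (- (p + 1)) <= c * (cos t ^+ 2 / t ^+ 3).
    rewrite kE // mulrA mulrA ler_pM2r ?invr_gt0 ?exprn_gt0 // mulrC.
    by rewrite ler_pM ?powR_ge0 // antitone // ltW.
  have h2 : 0 <= expR (- (s / 2 * t ^+ 2)) * t `^ (- (p + 1)).
    by rewrite mulr_ge0 ?expR_ge0 ?powR_ge0.
  lra.
have mD : measurable D by exact: measurable_itv.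
have mA : measurable A by exact: measurable_itv.
have mB : measurable B by exact: measurable_itv.
have mrem (h : R -> R) : measurable_fun D h -> measurable_fun D
    (fun t => ((h t - 1 + s / 2 * t ^+ 2) * t `^ (- (p + 1)))%:E).
  move=> mh; apply/measurable_EFinP.
  apply: (@measurable_riesz p (fun t => h t - 1 + s / 2 * t ^+ 2)).
  rewrite (_ : (fun t => _) = (fun t => h t + (- 1 + s / 2 * t ^+ 2))); last first.
    by apply/funext => t; rewrite addrA.
  apply: measurable_funD => //.
  exact: measurable_polyX2.
have mexp : measurable_fun D (fun t => expR (- (s / 2 * t ^+ 2))).
  apply: measurable_funTS; apply: continuous_measurable_fun => t.
  by apply: der_cont; der_rec.
have mg : measurable_fun D (EFin \o g) by apply: mrem; exact: measurable_powR_cos.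
have mf : measurable_fun D (EFin \o f) by exact: mrem.
have mX3 (C : set R) : measurable C -> C `<=` D -> measurable_fun C (fun t : R => (t ^+ 3)^-1).
  move=> mC CD; apply: (measurable_funS mD CD); apply: measurable_pos => t t0.
  by eapply der_cont; der_rec; rewrite gt_eqF ?exprn_gt0.
have mdd : measurable_fun A (EFin \o dd).
  apply/measurable_EFinP; apply: measurable_funM => //.
  apply: measurable_funM; last by apply: mX3 => //; rewrite -AD; exact: subIsetl.
  apply: measurable_funB; last exact: measurable_powR_cos.
  apply: measurable_funTS; apply: continuous_measurable_fun => t.
  by apply: der_cont; der_rec.
have muu : measurable_fun B (EFin \o uu).
  apply/measurable_EFinP; apply: measurable_funM => //.
  apply: measurable_funM; last by apply: mX3 => //; rewrite -BD; exact: subIsetl.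
  apply: measurable_funTS; apply: continuous_measurable_fun => t.
  by apply: der_cont; der_rec.
have intdd : ((c * (19 / 250))%:E <= \int[mu]_(t in D) ((EFin \o dd) \_ A) t)%E.
  rewrite -integral_mkcondr AD.
  under eq_integral do rewrite /= EFinM.
  rewrite ge0_integralZl_EFin //; last 3 first.
  - move=> t At; rewrite lee_fin -(pmulr_rge0 _ c0); exact: dd0.
  - apply/measurable_EFinP; move: mdd => /measurable_EFinP mdd.
    rewrite (_ : (fun t => _) = (fun t => c^-1 * dd t)); first exact: measurable_funM.
    by apply/funext => t; rewrite /dd mulKf // gt_eqF.
  - exact: ltW.
  by rewrite EFinM lee_wpmul2l ?lee_fin ?(ltW c0) // /A; exact: head_lower.
have intuu : (\int[mu]_(t in D) ((EFin \o uu) \_ B) t <= (c * (19 / 250))%:E)%E.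
  rewrite -integral_mkcondr BD.
  under eq_integral do rewrite /= EFinM.
  rewrite ge0_integralZl_EFin //; last 3 first.
  - move=> t Bt; rewrite lee_fin -(pmulr_rge0 _ c0); exact: uu0.
  - apply/measurable_EFinP; move: muu => /measurable_EFinP muu.
    rewrite (_ : (fun t => _) = (fun t => c^-1 * uu t)); first exact: measurable_funM.
    by apply/funext => t; rewrite /uu mulKf // gt_eqF.
  - exact: ltW.
  by rewrite EFinM lee_wpmul2l ?lee_fin ?(ltW c0) // /B; exact: tail_upper.
have mpd : measurable_fun D ((EFin \o dd) \_ A).
  by apply/(measurable_restrict _ mA mD); rewrite AD.
have mpu : measurable_fun D ((EFin \o uu) \_ B).
  by apply/(measurable_restrict _ mB mD); rewrite BD.
have pd0 t : (0 <= ((EFin \o dd) \_ A) t)%E.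
  by rewrite patchE; case: ifPn => // /[!inE]; rewrite lee_fin; exact: dd0.
have pu0 t : (0 <= ((EFin \o uu) \_ B) t)%E.
  by rewrite patchE; case: ifPn => // /[!inE]; rewrite lee_fin; exact: uu0.
have Dpos t : D t -> 0 < t by rewrite /D /= in_itv /= andbT.
have : (\int[mu]_(t in D) ((g t)%:E + ((EFin \o dd) \_ A) t) <=
        \int[mu]_(t in D) ((f t)%:E + ((EFin \o uu) \_ B) t))%E.
  apply: ge0_le_integral => //.
  - by move=> t /Dpos t0; rewrite adde_ge0 // lee_fin g0.
  - exact: emeasurable_funD.
  - exact: emeasurable_funD.
  - by move=> t /Dpos; exact: mid.
rewrite ge0_integralD //; last by move=> t /Dpos t0; rewrite lee_fin g0.
rewrite ge0_integralD //; last by move=> t /Dpos t0; rewrite lee_fin f0.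
move=> h; rewrite -(@leeD2rE _ (c * (19 / 250))%:E) //.
apply: le_trans (leeD (lexx _) intdd) _; apply: le_trans h _.
exact: leeD.
Qed.

End fourier_comparison.

(** * Integral representation of absolute moments *)

Section fourier_representation.
Context {R : realType}.
Notation mu := (@lebesgue_measure R).
Implicit Types (s : seq R) (t u x y a p : R) (h k : R -> R).

(** In these three functions the quadratic Taylor polynomial at 0 is removed. The remainder is of
    order [u ^ 4] at 0 and [u ^ 2] at infinity, which is what [2 < p < 4] can integrate. *)
Definition cosrem (u : R) : R := cos u - 1 + 1 / 2 * u ^+ 2.
Definition cospow (s u : R) : R := `|cos u| `^ s - 1 + s / 2 * u ^+ 2.
Definition gaussrem (s u : R) : R := expR (- (s / 2 * u ^+ 2)) - 1 + s / 2 * u ^+ 2.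

Lemma cosremN u : cosrem (- u) = cosrem u.
Proof. by rewrite /cosrem cosN sqrrN. Qed.

Lemma cosrem_norm u : cosrem `|u| = cosrem u.
Proof. by have [|] := ger0P u; rewrite ?cosremN. Qed.

Lemma cosrem_ge0 u : 0 <= cosrem u.
Proof. by rewrite -cosrem_norm /cosrem; have := cos_geT2 (normr_ge0 u); lra. Qed.

Lemma continuous_cosrem : continuous cosrem.
Proof. by move=> u; rewrite /cosrem; apply: der_cont; der_rec. Qed.

Lemma continuous_powR_norm (s : R) : 1 <= s -> continuous (fun x : R => `|x| `^ s).
Proof.
move=> s1 x; have s0 : 0 < s by lra.
have [->|x0] := eqVneq x 0; last first.
  apply: (@continuous_comp _ _ _ (fun x : R => `|x|) (fun y => y `^ s)).
    exact: norm_continuous.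
  have /der_cont : is_derive `|x| 1 (fun y => y `^ s) (s * `|x| `^ (s - 1)).
    by apply: is_derive1_powR; rewrite normr_gt0.
  exact.
rewrite /continuous_at normr0 powR0 ?gt_eqF //.
apply/cvgrPdist_le => e e0.
have nb : \forall y \near (0 : R), `|y| <= Num.min 1 e.
  by apply: nbhs0_le; rewrite lt_min ltr01.
apply: filterS nb => y; rewrite le_min => /andP[y1 ye].
rewrite sub0r normrN ger0_norm ?powR_ge0 //; apply: le_trans ye.
have [->|y0] := eqVneq `|y| 0; first by rewrite powR0 ?gt_eqF.
by apply: ge1r_powR => //; rewrite lt0r y0 normr_ge0.
Qed.

Lemma continuous_cospow (s : R) : 1 <= s -> continuous (cospow s).
Proof.
move=> s1 u; rewrite /cospow.
apply: (@continuousD _ _ _ (fun u => `|cos u| `^ s - 1)).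
  apply: continuousB; last exact: cst_continuous.
  apply: (@continuous_comp _ _ _ cos (fun x => `|x| `^ s)).
    exact: continuous_cos.
  exact: continuous_powR_norm.
by apply: (@der_cont R (fun u => s / 2 * u ^+ 2)); der_rec.
Qed.

Lemma continuous_gaussrem (s : R) : continuous (gaussrem s).
Proof. by move=> u; rewrite /gaussrem; apply: der_cont; der_rec. Qed.

Lemma riesz_ge0 p h : (forall t, 0 < t -> 0 <= h t) -> (0 <= riesz p h)%E.
Proof.
move=> h0; apply: integral_ge0 => t; rewrite /= in_itv /= andbT lee_fin => t0.
by rewrite mulr_ge0 ?h0 ?powR_ge0.
Qed.

Lemma eq_riesz p h k : (forall t, 0 < t -> h t = k t) -> riesz p h = riesz p k.
Proof.
move=> hk; apply: eq_integral => t; rewrite inE /= in_itv /= andbT => t0.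
by rewrite hk.
Qed.

Lemma measurable_posT h : continuous h -> measurable_fun `](0 : R), +oo[ h.
Proof. by move=> ch; apply: measurable_funTS; exact: continuous_measurable_fun. Qed.

Lemma le_riesz p h k : measurable_fun `](0 : R), +oo[ h ->
  measurable_fun `](0 : R), +oo[ k -> (forall t, 0 < t -> 0 <= h t) ->
  (forall t, 0 < t -> h t <= k t) -> (riesz p h <= riesz p k)%E.
Proof.
move=> mh mk h0 hk; apply: ge0_le_integral => //.
- move=> t; rewrite /= in_itv /= andbT lee_fin => t0.
  by rewrite mulr_ge0 ?h0 ?powR_ge0.
- by apply/measurable_EFinP; exact: measurable_riesz.
- by apply/measurable_EFinP; exact: measurable_riesz.
- move=> t; rewrite /= in_itv /= andbT lee_fin => t0.
  by rewrite ler_wpM2r ?hk ?powR_ge0.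
Qed.

Lemma rieszD p h k : measurable_fun `](0 : R), +oo[ h ->
  measurable_fun `](0 : R), +oo[ k -> (forall t, 0 < t -> 0 <= h t) ->
  (forall t, 0 < t -> 0 <= k t) ->
  (riesz p (fun t => (h t + k t)%R) = riesz p h + riesz p k)%E.
Proof.
move=> mh mk h0 k0; rewrite /riesz.
under eq_integral do rewrite mulrDl EFinD.
rewrite ge0_integralD //.
- move=> t; rewrite /= in_itv /= andbT lee_fin => t0.
  by rewrite mulr_ge0 ?h0 ?powR_ge0.
- by apply/measurable_EFinP; exact: measurable_riesz.
- move=> t; rewrite /= in_itv /= andbT lee_fin => t0.
  by rewrite mulr_ge0 ?k0 ?powR_ge0.
- by apply/measurable_EFinP; exact: measurable_riesz.
Qed.

Lemma rieszZ p (c : R) h : 0 <= c -> measurable_fun `](0 : R), +oo[ h ->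
  (forall t, 0 < t -> 0 <= h t) ->
  (riesz p (fun t => (c * h t)%R) = c%:E * riesz p h)%E.
Proof.
move=> c0 mh h0; rewrite /riesz.
under eq_integral do rewrite -mulrA EFinM.
rewrite ge0_integralZl_EFin //.
- move=> t; rewrite /= in_itv /= andbT lee_fin => t0.
  by rewrite mulr_ge0 ?h0 ?powR_ge0.
- by apply/measurable_EFinP; exact: measurable_riesz.
Qed.

Lemma riesz0 p : riesz p (fun=> 0) = 0%E :> \bar R.
Proof. by apply: integral0_eq => t _; rewrite mul0r. Qed.

Lemma riesz_sum p (I : eqType) (r : seq I) (h : I -> R -> R) :
  (forall i, i \in r -> continuous (h i)) ->
  (forall i t, i \in r -> 0 <= h i t) ->
  continuous (fun t => \sum_(i <- r) h i t) /\
  (riesz p (fun t => (\sum_(i <- r) h i t)%R) = \sum_(i <- r) riesz p (h i))%E.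
Proof.
elim: r => [|i r IH] ch h0.
  rewrite big_nil (@eq_riesz _ _ (fun=> 0)) ?riesz0; last by move=> t _; rewrite big_nil.
  split=> // t; rewrite (_ : (fun t => _) = (fun=> 0)); first exact: cst_continuous.
  by apply/funext => u; rewrite big_nil.
have [ct E] : continuous (fun t => \sum_(i <- r) h i t) /\
    (riesz p (fun t => (\sum_(i <- r) h i t)%R) = \sum_(i <- r) riesz p (h i))%E.
  by apply: IH => j *; [apply: ch|apply: h0]; rewrite inE orbC; apply/orP; left.
have ci := ch i (mem_head _ _).
have sumE : (fun t => \sum_(j <- i :: r) h j t) = (fun t => h i t + \sum_(j <- r) h j t).
  by apply/funext => t; rewrite big_cons.
rewrite sumE big_cons -E; split.
  by move=> t; apply: continuousD; [exact: ci|exact: ct].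
rewrite rieszD //; try exact: measurable_posT.
- by move=> t _; rewrite h0 ?mem_head.
- move=> t _; rewrite big_seq sumr_ge0 // => j jr.
  by rewrite h0 // inE jr orbT.
Qed.

Lemma riesz_scale p h (c : R) : 0 < c -> continuous h ->
  (forall t, 0 < t -> 0 <= h t) ->
  (riesz p (fun t => h (c * t)%R) = (c `^ p)%:E * riesz p h)%E.
Proof.
move=> c0 ch h0; have cp0 : 0 < c `^ p by rewrite powR_gt0.
have cG t : 0 < t -> {for t, continuous (fun t => h t * t `^ (- (p + 1)))}.
  by move=> t0; apply: continuousM; [exact: ch|eapply der_cont; der_rec].
have G0 t : 0 < t -> 0 <= h t * t `^ (- (p + 1)).
  by move=> t0; rewrite mulr_ge0 ?h0 ?powR_ge0.
rewrite /riesz -(integral_scale c0 cG G0) /=.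
rewrite -ge0_integralZl_EFin ?ltW //; last 2 first.
- move=> t; rewrite /= in_itv /= andbT lee_fin => t0.
  by rewrite !mulr_ge0 ?h0 ?powR_ge0 ?mulr_gt0 // ltW.
- apply/measurable_EFinP; apply: measurable_funM => //.
  apply: measurable_pos => t t0; apply: continuousM.
    apply: continuous_comp; last exact: ch.
    by apply: (@der_cont R (fun t => c * t)); der_rec.
  by eapply der_cont; der_rec; rewrite mulr_gt0.
apply: eq_integral => t; rewrite inE /= in_itv /= andbT => t0; rewrite -EFinM; congr EFin.
rewrite powRM ?ltW //.
have -> : c `^ (- (p + 1)) = (c `^ p * c)^-1.
  by rewrite powRN powRD ?(gt_eqF c0) ?implybT // powRr1 ?ltW.
by field; rewrite !gt_eqF.
Qed.

(** By scaling. This is the integral representation of [|x| ^ p], with its normalizing constant left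
    unevaluated. *)
Lemma riesz_cosrem p x : 0 < p ->
  (riesz p (fun t => cosrem (t * x)) = (`|x| `^ p)%:E * riesz p cosrem)%E.
Proof.
move=> p0; have [->|x0] := eqVneq x 0.
  rewrite normr0 powR0 ?gt_eqF // mul0e -(riesz0 p); apply: eq_riesz => t _.
  by rewrite mulr0 /cosrem cos0; ring.
rewrite -riesz_scale ?normr_gt0 //; last by move=> t _; exact: cosrem_ge0.
  by apply: eq_riesz => t t0; rewrite -cosrem_norm normrM (gtr0_norm t0) mulrC.
exact: continuous_cosrem.
Qed.

Lemma continuous_rad (h : R -> R -> R) s x :
  (forall y, continuous (h ^~ y)) -> continuous (fun t => rad (h t) s x).
Proof.
move=> ch; elim: s x => [|a s IH] x; first exact: ch.
move=> t /=; apply: (@continuousM _ _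
  (fun t => rad (h t) s (x + a) + rad (h t) s (x - a)) (fun=> 2^-1)).
  by apply: (@continuousD _ _ _ (fun t => rad (h t) s (x + a))); exact: IH.
exact: cst_continuous.
Qed.

Lemma riesz_rad p s x : 0 < p ->
  (riesz p (fun t => rad (fun y => cosrem (t * y)) s x) =
   (rad (fun y => `|y| `^ p) s x)%:E * riesz p cosrem)%E.
Proof.
move=> p0.
have R1 : (0 <= riesz p cosrem)%E by apply: riesz_ge0 => t _; exact: cosrem_ge0.
have rad0 s' x' t : 0 <= rad (fun y => cosrem (t * y)) s' x'.
  rewrite -[leLHS](rad_cst 0 s' x'); apply: rad_le => y; exact: cosrem_ge0.
have radp0 s' x' : 0 <= rad (fun y => `|y| `^ p) s' x'.
  rewrite -[leLHS](rad_cst 0 s' x'); apply: rad_le => y; exact: powR_ge0.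
have mrad s' x' : measurable_fun `](0 : R), +oo[ (fun t => rad (fun y => cosrem (t * y)) s' x').
  apply: measurable_posT; apply: continuous_rad => y t.
  apply: (@continuous_comp _ _ _ (fun t => t * y) cosrem); last exact: continuous_cosrem.
  by apply: (@der_cont R (fun t => t * y)); der_rec.
elim: s x => [|a s IH] x; first exact: riesz_cosrem.
rewrite (@eq_riesz _ _ (fun t => 2^-1 * (rad (fun y => cosrem (t * y)) s (x + a) +
    rad (fun y => cosrem (t * y)) s (x - a)))); last by move=> t _; rewrite mulrC.
rewrite rieszZ //; last 2 first.
- exact: measurable_funD.
- by move=> t _; rewrite addr_ge0.
rewrite (@rieszD p (fun t => rad (fun y => cosrem (t * y)) s (x + a))
  (fun t => rad (fun y => cosrem (t * y)) s (x - a))) ?IH //.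
rewrite -ge0_muleDl ?lee_fin // muleA -EFinD -EFinM; congr (_%:E * _)%E.
by rewrite /= mulrC.
Qed.

(** Weighted AM-GM, through the tangent of the exponential: with [M] the product of the absolute
    values, a term [w * c ^ (1 / w)] is at least [M * (w + ln c - w * ln M)], and these lower bounds
    add up to [M]. *)
Lemma prod_cos_le (ws : seq (R * R)) t :
  (forall wa, wa \in ws -> 0 < wa.1) -> \sum_(wa <- ws) wa.1 = 1 ->
  \prod_(wa <- ws) cos (t * wa.2) <=
  \sum_(wa <- ws) wa.1 * `|cos (t * wa.2)| `^ (wa.1)^-1.
Proof.
move=> w0 w1.
have S0 : 0 <= \sum_(wa <- ws) wa.1 * `|cos (t * wa.2)| `^ (wa.1)^-1.
  by rewrite big_seq sumr_ge0 // => wa /w0 w; rewrite mulr_ge0 ?powR_ge0 // ltW.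
apply: le_trans (ler_norm _) _; rewrite normr_prod.
set M := \prod_(wa <- ws) _.
have [[wa wain /eqP ca0]|nz] := pselect (exists2 wa, wa \in ws & `|cos (t * wa.2)| == 0).
  by rewrite /M (big_rem wa) //= ca0 mul0r.
have c0 wa : wa \in ws -> 0 < `|cos (t * wa.2)|.
  move=> wain; rewrite lt0r normr_ge0 andbT; apply/negP => c0.
  by apply: nz; exists wa.
have M0 : 0 < M by rewrite /M big_seq prodr_gt0.
have lnM_ : ln M = \sum_(wa <- ws) ln `|cos (t * wa.2)|.
  rewrite /M; elim: ws c0 {w0 w1 S0 M M0 nz} => [|b ws IH] c0.
    by rewrite !big_nil ln1.
  have c0' wa : wa \in ws -> 0 < `|cos (t * wa.2)|.
    by move=> wain; apply: c0; rewrite inE wain orbT.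
  rewrite !big_cons lnM ?posrE ?IH ?c0 ?mem_head //.
  by rewrite big_seq prodr_gt0.
rewrite -[leRHS]mulr1 -(mulfV (lt0r_neq0 M0)) mulrCA -[leLHS]mulr1 ler_pM2l //.
have -> : 1 = \sum_(wa <- ws) (wa.1 + (ln `|cos (t * wa.2)| - wa.1 * ln M)).
  by rewrite !big_split /= w1 sumrN -mulr_suml w1 -lnM_ mul1r subrr addr0.
rewrite mulr_suml big_seq [leRHS]big_seq; apply: ler_sum => wa wain.
have w := w0 _ wain; have c := c0 _ wain.
rewrite -mulrA -{2}(lnK M0) -expRN powR_expR // -expRD.
apply: le_trans (ler_wpM2l (ltW w) (expR_ge1Dx _)).
by rewrite le_eqVlt; apply/orP; left; apply/eqP; field; rewrite gt_eqF.
Qed.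

(** At exponent 2 the double-angle formula gives the exact value. It improves on the Gaussian bound,
    and a coefficient of weight 1 / 2 needs that improvement. *)
Lemma riesz_cosrem_dbl p : 2 < p ->
  (riesz p (cospow 2) = (2 `^ (p - 1))%:E * riesz p cosrem)%E.
Proof.
move=> p2.
have E t : cospow 2 t = 2^-1 * cosrem (2 * t).
  rewrite /cospow /cosrem powR_mulrn // real_normK ?num_real //.
  have -> : cos (2 * t) = 2 * cos t ^+ 2 - 1 by rewrite mulr_natl cos_mulr2n mulr_natl.
  by field.
rewrite (eq_riesz p (fun t _ => E t)) rieszZ //; last 2 first.
- apply: measurable_posT => t; apply: (@continuous_comp _ _ _ (fun t => 2 * t) cosrem).
    by apply: (@der_cont R (fun t => 2 * t)); der_rec.
  exact: continuous_cosrem.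
- by move=> t _; exact: cosrem_ge0.
rewrite riesz_scale //; last by move=> t _; exact: cosrem_ge0.
  rewrite muleA -EFinM; congr (_%:E * _)%E.
  by rewrite powRB ?pnatr_eq0 ?implybT // powRr1 // mulrC.
exact: continuous_cosrem.
Qed.

Lemma riesz_gaussrem p (s : R) : 0 < s ->
  (riesz p (gaussrem s) = (s `^ (p / 2))%:E * riesz p (gaussrem 1))%E.
Proof.
move=> s0; have rs0 : 0 < Num.sqrt s by rewrite sqrtr_gt0.
rewrite (_ : s `^ (p / 2) = (Num.sqrt s) `^ p); last first.
  by rewrite -powR12_sqrt ?ltW // -powRrM; congr (_ `^ _); field.
rewrite -riesz_scale //; last by move=> t _; exact: gauss_rem_ge.
  apply: eq_riesz => t _; rewrite /gaussrem exprMn sqr_sqrtr ?ltW //.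
  by rewrite (_ : s / 2 * t ^+ 2 = 1 / 2 * (s * t ^+ 2)) //; field.
exact: continuous_gaussrem.
Qed.

(** When the exponent is the reciprocal of the weight, the weighted quadratic terms of the [cospow]
    add up to the quadratic term on the left, so that only AM-GM for the cosines remains. *)
Lemma riesz_rad_le p (ws : seq (R * R)) : 2 < p ->
  (forall wa, wa \in ws -> 0 < wa.1 <= 2^-1) -> \sum_(wa <- ws) wa.1 = 1 ->
  ((rad (fun y => `|y| `^ p) [seq wa.2 | wa <- ws] 0)%:E * riesz p cosrem <=
   \sum_(wa <- ws) (wa.1 * `|wa.2| `^ p)%:E * riesz p (cospow (wa.1)^-1))%E.
Proof.
move=> p2 w12 w1.
have w0 wa : wa \in ws -> 0 < wa.1 by move=> /w12 /andP[].
have w2 wa : wa \in ws -> 2 <= wa.1^-1.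
  by move=> /w12 /andP[w w']; rewrite -[leLHS]invrK lef_pV2 ?posrE.
have cts (wa : R * R) : wa \in ws -> continuous (fun t => cospow (wa.1)^-1 (t * wa.2)).
  move=> wain t; apply: (@continuous_comp _ _ _ (fun t => t * wa.2) (cospow wa.1^-1)).
    by apply: (@der_cont R (fun t => t * wa.2)); der_rec.
  by apply: continuous_cospow; have := w2 _ wain; lra.
have pos (wa : R * R) t : wa \in ws -> 0 <= cospow (wa.1)^-1 (t * wa.2).
  move=> wain; rewrite /cospow -cos_norm -[_ ^+ 2]real_normK ?num_real //.
  by apply: cos_pow_ge => //; have := w2 _ wain; lra.
rewrite -riesz_rad; last by lra.
have wcts (wa : R * R) : wa \in ws ->
    continuous (fun t => wa.1 * cospow (wa.1)^-1 (t * wa.2)).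
  move=> wain t; apply: (@continuousM _ _ (fun=> wa.1)
    (fun t => cospow (wa.1)^-1 (t * wa.2))); first exact: cst_continuous.
  exact: cts.
have wpos (wa : R * R) t : wa \in ws -> 0 <= wa.1 * cospow (wa.1)^-1 (t * wa.2).
  by move=> wain; rewrite mulr_ge0 ?pos // ltW // w0.
have [ct E] := riesz_sum p wcts wpos.
apply: (@le_trans _ _ (riesz p (fun t => \sum_(wa <- ws) wa.1 * cospow (wa.1)^-1 (t * wa.2)))).
  apply: le_riesz.
  - apply: measurable_posT; apply: continuous_rad => y t.
    apply: (@continuous_comp _ _ _ (fun t => t * y) cosrem); last exact: continuous_cosrem.
    by apply: (@der_cont R (fun t => t * y)); der_rec.
  - exact: measurable_posT.
  - move=> t _; rewrite -[leLHS](rad_cst 0 [seq wa.2 | wa <- ws] 0).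
    by apply: rad_le => y; exact: cosrem_ge0.
  - move=> t _.
    have -> : rad (fun y => cosrem (t * y)) [seq wa.2 | wa <- ws] 0 =
        \prod_(wa <- ws) cos (t * wa.2) - 1 + t ^+ 2 / 2 * \sum_(wa <- ws) wa.2 ^+ 2.
      rewrite (@eq_rad _ _ (fun y => 1 * (cos (t * y)) + 1 * (- 1 * 1 + t ^+ 2 / 2 * y ^+ 2))).
        rewrite rad_lin (rad_lin (fun=> 1)) rad_cst rad_cos rad_sqr.
        by rewrite mulr0 cos0 !big_map expr0n /=; field.
      by move=> y; rewrite /cosrem; field.
    have -> : \sum_(wa <- ws) wa.1 * cospow wa.1^-1 (t * wa.2) =
        \sum_(wa <- ws) wa.1 * `|cos (t * wa.2)| `^ (wa.1)^-1 - 1 +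
        t ^+ 2 / 2 * \sum_(wa <- ws) wa.2 ^+ 2.
      transitivity (\sum_(wa <- ws) (wa.1 * `|cos (t * wa.2)| `^ (wa.1)^-1 - wa.1 +
          t ^+ 2 / 2 * wa.2 ^+ 2)).
        rewrite big_seq [RHS]big_seq; apply: eq_bigr => wa wain; rewrite /cospow.
        by field; rewrite gt_eqF ?w0.
      by rewrite !big_split /= sumrN w1 mulr_sumr.
    by rewrite !lerD2r prod_cos_le.
rewrite E big_seq [leRHS]big_seq; apply: lee_sum => wa wain.
have wa0 := w0 _ wain; have wa2 := w2 _ wain.
rewrite rieszZ ?(ltW wa0) //; last 2 first.
- by apply: measurable_posT; exact: cts.
- by move=> t _; exact: pos.
rewrite EFinM -muleA lee_wpmul2l ?lee_fin ?(ltW wa0) //.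
have [a0|a0] := eqVneq wa.2 0.
  have pn0 : p != 0 by rewrite gt_eqF //; lra.
  rewrite a0 normr0 (powR0 pn0) mul0e.
  rewrite -(riesz0 p) le_eqVlt; apply/orP; left; apply/eqP; apply: eq_riesz => t _.
  by rewrite mulr0 /cospow cos0 normr1 powR1; ring.
rewrite -riesz_scale ?normr_gt0 //; last 2 first.
- by apply: continuous_cospow; lra.
- by move=> t t0; apply: cos_pow_ge; [lra|exact: ltW].
rewrite le_eqVlt; apply/orP; left; apply/eqP; apply: eq_riesz => t t0.
rewrite /cospow.
have -> : cos (t * wa.2) = cos (`|wa.2| * t).
  by rewrite -cos_norm normrM (gtr0_norm t0) mulrC.
by rewrite !exprMn real_normK ?num_real // [t ^+ 2 * _]mulrC.
Qed.

End fourier_representation.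

(** * Gaussian moments *)

Section gaussian_moments.
Context {R : realType}.
Notation mu := (@lebesgue_measure R).
Implicit Types (p t x a b C : R) (f g F : R -> R).

Lemma cvg0_le_inv (u : nat -> R) C (N : nat) :
  (forall n, (N <= n)%N -> `|u n| <= C / n.+1%:R) -> u n @[n --> \oo] --> 0.
Proof.
move=> h.
have : C * harmonic n @[n --> \oo] --> C * (0 : R).
  by apply: cvgM; [exact: cvg_cst|exact: cvg_harmonic].
rewrite mulr0 => cv; apply: norm_cvg0.
apply: (squeeze_cvgr _ (cvg_cst 0) cv); near=> n; rewrite normr_ge0 /=.
by apply: h; near: n; exact: nbhs_infty_ge.
Unshelve. all: by end_near. Qed.

Lemma continuous_itv_integrable f a b : 0 < a ->
  (forall x, 0 < x -> {for x, continuous f}) ->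
  mu.-integrable `[a, b] (EFin \o f).
Proof.
move=> a0 cf; apply: continuous_compact_integrable; first exact: segment_compact.
by apply: within_cont => y; rewrite in_itv /= => /andP[/(lt_le_trans a0)/cf].
Qed.

(** Integration by parts for nonnegative integrands, possibly with infinite integrals: the two
    differ by the derivative of a function that vanishes at both ends. *)
Lemma integral_eq_of_derive f g F :
  (forall x, 0 < x -> {for x, continuous f}) ->
  (forall x, 0 < x -> {for x, continuous g}) ->
  (forall x, 0 < x -> 0 <= f x) -> (forall x, 0 < x -> 0 <= g x) ->
  (forall x, 0 < x -> is_derive x 1 F (f x - g x)) ->
  F n.+1%:R^-1 @[n --> \oo] --> 0 -> F n.+1%:R @[n --> \oo] --> 0 ->
  (\int[mu]_(x in `]0%R, +oo[) (f x)%:E = \int[mu]_(x in `]0%R, +oo[) (g x)%:E)%E.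
Proof.
move=> cf cg f0 g0 dF Fl Fr.
have cvf := cvg_integral_pos (measurable_pos cf) f0.
have cvg_ := cvg_integral_pos (measurable_pos cg) g0.
have E (n : nat) : (\int[mu]_(x in `[n.+1%:R^-1%R, n.+1%:R%R]) (f x)%:E =
    \int[mu]_(x in `[n.+1%:R^-1%R, n.+1%:R%R]) (g x)%:E +
    (F n.+1%:R - F n.+1%:R^-1)%:E)%E.
  have n0 : 0 < n.+1%:R^-1 :> R by rewrite invr_gt0.
  have nn : n.+1%:R^-1 <= n.+1%:R :> R.
    by rewrite (le_trans (y := 1)) ?invf_le1 ?ler1n.
  have dF' x : n.+1%:R^-1 <= x <= n.+1%:R -> is_derive x 1 F (f x - g x).
    by move=> /andP[/(lt_le_trans n0)/dF].
  have cfg x : n.+1%:R^-1 <= x <= n.+1%:R -> {for x, continuous (fun x => f x - g x)}.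
    by move=> /andP[/(lt_le_trans n0) x0 _]; apply: continuousB; [exact: cf|exact: cg].
  rewrite -(integral_FTC_cc nn dF' cfg).
  rewrite -integralD_EFin //; last 2 first.
  - exact: continuous_itv_integrable.
  - apply: (@continuous_itv_integrable (fun x => f x - g x)) => // x x0.
    by apply: continuousB; [exact: cf|exact: cg].
  by apply: eq_integral => x _; rewrite /= -EFinD addrC subrK.
have cvF : (F n.+1%:R - F n.+1%:R^-1)%:E @[n --> \oo] --> 0%:E.
  apply: cvg_EFin; first exact: nearW.
  by rewrite -(subrr 0); apply: cvgB.
have cvs := cvgeD (fin_num_adde_defl _ (erefl : (0%:E : \bar R) \is a fin_num)) cvg_ cvF.
rewrite adde0 in cvs; rewrite (funext E) in cvf.
exact: (cvg_unique (@ereal_hausdorff R) cvf (cvs _)).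
Qed.

Definition gmom p : \bar R :=
  (\int[mu]_(x in `]0%R, +oo[) (x `^ p * expR (- x ^+ 2))%:E)%E.

Lemma gmom_cont p x : 0 < x -> {for x, continuous (fun x => x `^ p * expR (- x ^+ 2))}.
Proof. by move=> x0; eapply der_cont; der_rec. Qed.

Lemma powR_expR_tail p x : 0 <= p -> p + 2 <= x -> x `^ (p + 1) * expR (- x ^+ 2) <= x^-1.
Proof.
move=> p0 px; have x0 : 0 < x by lra.
have lx : ln x <= x by apply: ltW; exact: ln_sublinear.
rewrite powR_expR // -expRD.
apply: (@le_trans _ _ (expR (- x))).
  rewrite ler_expR.
  have : (p + 1) * ln x <= (p + 1) * x by rewrite ler_wpM2l //; lra.
  by nra.
rewrite expRN lef_pV2 ?posrE ?expR_gt0 //.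
by apply: le_trans (expR_ge1Dx x); lra.
Qed.

Lemma gmom_rec p : 0 <= p -> gmom (p + 2) = (((p + 1) / 2)%:E * gmom p)%E.
Proof.
move=> p0; rewrite /gmom -ge0_integralZl_EFin //; last 3 first.
- by move=> x _; rewrite lee_fin mulr_ge0 ?powR_ge0 ?expR_ge0.
- by apply/measurable_EFinP; apply: measurable_pos => x; exact: gmom_cont.
- by rewrite divr_ge0; lra.
under [RHS]eq_integral do rewrite -EFinM.
apply: (@integral_eq_of_derive _ _ (fun x => - 2^-1 * (x `^ (p + 1) * expR (- x ^+ 2)))).
- by move=> x; exact: gmom_cont.
- by move=> x x0; eapply der_cont; der_rec.
- by move=> x x0; rewrite mulr_ge0 ?powR_ge0 ?expR_ge0.
- by move=> x x0; rewrite !mulr_ge0 ?powR_ge0 ?expR_ge0; lra.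
- move=> x x0; der => //=.
  have -> : p + 2 = (p + 1) + 1 by ring.
  have -> : p + 1 - 1 = p by ring.
  rewrite [x `^ (p + 1 + 1)]powRD ?(gt_eqF x0) ?implybT // powRr1 ?ltW //.
  by field.
- apply: (@cvg0_le_inv _ 1 0) => n _.
  have n0 : 0 < n.+1%:R^-1 :> R by rewrite invr_gt0.
  have n1 : n.+1%:R^-1 <= 1 :> R by rewrite invf_le1 ?ler1n.
  have h1 : n.+1%:R^-1 `^ (p + 1) <= n.+1%:R^-1 :> R.
    by apply: ge1r_powR; [rewrite n0|lra].
  have h2 : expR (- (n.+1%:R^-1) ^+ 2) <= 1 :> R.
    by rewrite -expR0 ler_expR oppr_le0 sqr_ge0.
  have h3 := ler_pM (powR_ge0 _ _) (expR_ge0 _) h1 h2.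
  have h4 : 0 <= n.+1%:R^-1 `^ (p + 1) * expR (- (n.+1%:R^-1) ^+ 2) :> R.
    by rewrite mulr_ge0 ?powR_ge0 ?expR_ge0.
  rewrite normrM normrN (ger0_norm h4) ger0_norm // div1r -[leRHS]mulr1.
  by apply: le_trans h3; rewrite ler_piMl // invf_le1 ?ler1n.
- apply: (@cvg0_le_inv _ 1 (Num.truncn (p + 2))) => n pn.
  have px : p + 2 <= n.+1%:R.
    by rewrite (le_trans (ltW (truncnS_gt _))) // ler_nat ltnS.
  have h := powR_expR_tail p0 px.
  have h4 : 0 <= n.+1%:R `^ (p + 1) * expR (- n.+1%:R ^+ 2) :> R.
    by rewrite mulr_ge0 ?powR_ge0 ?expR_ge0.
  rewrite normrM normrN (ger0_norm h4) ger0_norm // div1r.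
  by apply: le_trans h; rewrite ler_piMl // invf_le1 ?ler1n.
Qed.

Lemma gmom0 : gmom 0 = (Num.sqrt pi / 2)%:E.
Proof.
rewrite /gmom -(@integral0y_gauss R).
rewrite integral_itv_obnd_cbnd; last first.
  by apply/measurable_EFinP; apply: measurable_pos => x; exact: gmom_cont.
by apply: eq_integral => x _; rewrite powRr0 mul1r.
Qed.

Lemma gmom_ge0 p : (0 <= gmom p)%E.
Proof. by apply: integral_ge0 => x _; rewrite lee_fin mulr_ge0 ?powR_ge0 ?expR_ge0. Qed.

Lemma gmom_even_fin (m : nat) : gmom m.*2%:R \is a fin_num.
Proof.
elim: m => [|m IH]; first by rewrite gmom0.
by rewrite doubleS -addn2 natrD gmom_rec // fin_numM.
Qed.

(** Here [x ^ p <= 1 + x ^ (2 * m)] for [p <= 2 * m], and the even moments are finite by recursion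
    from the Gaussian integral. *)
Lemma gmom_fin p : 0 <= p -> gmom p \is a fin_num.
Proof.
move=> p0; rewrite ge0_fin_numE ?gmom_ge0 //.
pose m := (Num.truncn p).+1.
have pm : p <= m.*2%:R.
  by rewrite (le_trans (ltW (truncnS_gt p))) // ler_nat -addnn leq_addr.
apply: (@le_lt_trans _ _ (gmom 0 + gmom m.*2%:R)%E); last first.
  apply: lte_add_pinfty; first by rewrite gmom0 ltry.
  by rewrite ltey_eq gmom_even_fin.
have mg q : measurable_fun `](0 : R), +oo[ (fun x => (x `^ q * expR (- x ^+ 2))%:E).
  by apply/measurable_EFinP; apply: measurable_pos => x; exact: gmom_cont.
have g0 q x : (0 <= (x `^ q * expR (- x ^+ 2))%:E)%E.
  by rewrite lee_fin mulr_ge0 ?powR_ge0 ?expR_ge0.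
rewrite /gmom -ge0_integralD //; [|exact: mg|exact: mg].
apply: ge0_le_integral => //.
- exact: mg.
- by apply: emeasurable_funD; exact: mg.
- move=> x; rewrite /= in_itv /= andbT => x0.
  rewrite -EFinD lee_fin -mulrDl ler_wpM2r ?expR_ge0 // powRr0.
  have [x1|x1] := leP x 1.
    rewrite -[leLHS]addr0 lerD ?powR_ge0 //.
    by rewrite -(powRr0 x); apply: ger_powR => //; rewrite x0.
  by rewrite -[leLHS]add0r lerD // ler_powR // ltW.
Qed.

Definition gm p : R := fine (gmom p).

Lemma gmE p : 0 <= p -> gmom p = (gm p)%:E.
Proof. by move=> p0; rewrite fineK ?gmom_fin. Qed.

Lemma gm_ge0 p : 0 <= gm p.
Proof. by rewrite fine_ge0 ?gmom_ge0. Qed.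

Lemma gm_rec p : 0 <= p -> gm (p + 2) = (p + 1) / 2 * gm p.
Proof.
move=> p0; apply: EFin_inj; rewrite -gmE; last lra.
by rewrite gmom_rec // EFinM gmE.
Qed.

Lemma gm0 : gm 0 = Num.sqrt pi / 2.
Proof. by rewrite /gm gmom0. Qed.

Lemma gm2 : gm 2 = Num.sqrt pi / 4.
Proof. by rewrite -[2]add0r gm_rec // gm0; field. Qed.

Lemma gm1 : gm 1 = 1 / 2.
Proof.
apply: EFin_inj; rewrite -gmE // /gmom.
have -> : (\int[mu]_(x in `]0%R, +oo[) (x `^ 1 * expR (- x ^+ 2))%:E =
    \int[mu]_(x in `[0%R, +oo[) (x * expR (- x ^+ 2))%:E)%E.
  rewrite -integral_itv_obnd_cbnd; last first.
    apply/measurable_EFinP; apply: measurable_pos => x x0.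
    by apply: (@der_cont R (fun x => x * expR (- x ^+ 2))); der_rec.
  apply: eq_integral => x; rewrite inE /= in_itv /= andbT => x0.
  by rewrite powRr1 // ltW.
have dF x : 0 <= x -> is_derive x 1 (fun x => - 2^-1 * expR (- x ^+ 2)) (x * expR (- x ^+ 2)).
  by move=> _; der; rewrite /=; field.
have cF x : 0 <= x -> {for x, continuous (fun x => x * expR (- x ^+ 2))}.
  by move=> _; apply: (@der_cont R (fun x => x * expR (- x ^+ 2))); der_rec.
have F0 x : 0 <= x -> 0 <= x * expR (- x ^+ 2) by move=> x0; rewrite mulr_ge0 ?expR_ge0.
have Fl : (fun x => - 2^-1 * expR (- x ^+ 2)) x @[x --> +oo] --> (0 : R).
  apply/cvgrPdist_le => e e0; near=> x.
  have x1 : 1 <= x by near: x; apply: nbhs_pinfty_ge; rewrite num_real.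
  have xe : e^-1 <= x by near: x; apply: nbhs_pinfty_ge; rewrite num_real.
  rewrite sub0r normrN normrM normrN !ger0_norm ?expR_ge0 //.
  have : expR (- x ^+ 2) <= e; last first.
    by have := expR_ge0 (- x ^+ 2); lra.
  rewrite expRN -[leRHS]invrK lef_pV2 ?posrE ?expR_gt0 ?invr_gt0 //.
  by apply: le_trans (expR_ge1Dx _); nra.
rewrite (integral_FTC_cy dF cF F0 Fl) expr0n /= oppr0 expR0.
by congr EFin; field.
Unshelve. all: by end_near. Qed.

End gaussian_moments.

(** * The Fourier transform of the Gaussian by its differential equation *)

Section gaussian_characteristic_function.
Context {R : realType}.
Notation mu := (@lebesgue_measure R).
Implicit Types (p t x a b C : R) (f g F : R -> R).

Let D : set (measurableTypeR R) := `]0, +oo[%classic.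

Let mD : measurable D. Proof. exact: measurable_itv. Qed.

Let DP x : D x -> 0 < x. Proof. by rewrite /D /= in_itv /= andbT. Qed.

Lemma integrable_gm p : 0 <= p ->
  mu.-integrable D (EFin \o (fun x => x `^ p * expR (- x ^+ 2))).
Proof.
move=> p0; apply/integrableP; split.
  by apply/measurable_EFinP; apply: measurable_pos => x; exact: gmom_cont.
rewrite (_ : (\int[mu]_(x in D) _)%E = gmom p); first by rewrite gmE ?ltry.
apply: eq_integral => x _; rewrite /= ger0_norm //.
by rewrite mulr_ge0 ?powR_ge0 ?expR_ge0.
Qed.

Lemma integrable_gauss_mul (h : R -> R) p C : 0 <= p -> continuous h ->
  (forall x, 0 < x -> `|h x| <= C * x `^ p) ->
  mu.-integrable D (EFin \o (fun x => h x * expR (- x ^+ 2))).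
Proof.
move=> p0 ch hC; have := integrableZl mD C (integrable_gm p0).
apply: le_integrable => //.
  apply/measurable_EFinP; apply: measurable_pos => x x0.
  apply: continuousM; first exact: ch.
  by apply: (@der_cont R (fun x => expR (- x ^+ 2))); der_rec.
move=> x /DP x0; rewrite /= lee_fin mulrA normrM [leRHS]normrM.
by apply: ler_wpM2r => //; apply: le_trans (hC x x0) _; exact: ler_norm.
Qed.

Lemma sin_norm_le (x : R) : `|sin x| <= `|x|.
Proof.
have h (y : R) : 0 <= y -> `|sin y| <= y.
  move=> y0; rewrite ler_norml sin_leT1 // andbT.
  have [y1|y1] := leP 1 y; first by have := sin_geN1 y; lra.
  by have := sin_geT3 y0; nra.
have [x0|x0] := leP 0 x; first by rewrite (ger0_norm x0); exact: h.
by rewrite (ltr0_norm x0) -normrN -sinN; apply: h; lra.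
Qed.

Let cosg t x : R := cos (t * x) * expR (- x ^+ 2).
Let sing t x : R := (- (x * sin (t * x))) * expR (- x ^+ 2).

Let int_cosg t : mu.-integrable D (EFin \o cosg t).
Proof.
apply: (@integrable_gauss_mul (fun x => cos (t * x)) 0 1) => //.
  by move=> x; apply: (@der_cont R (fun x => cos (t * x))); der_rec.
by move=> x _; rewrite powRr0 mulr1 cos_max.
Qed.

Let int_sing t : mu.-integrable D (EFin \o sing t).
Proof.
apply: (@integrable_gauss_mul (fun x => - (x * sin (t * x))) 1 1) => //.
  by move=> x; apply: (@der_cont R (fun x => - (x * sin (t * x)))); der_rec.
move=> x x0; rewrite powRr1 ?(ltW x0) // mul1r normrN normrM (gtr0_norm x0).
by rewrite ler_piMr ?sin_max // ltW.
Qed.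

Let Phi t : R := \int[mu]_(x in D) cosg t x.

Let der_Phi t : is_derive t 1 Phi (\int[mu]_(x in D) sing t x).
Proof.
have dcos x y : is_derive x 1 (fun x => cosg x y) (sing x y).
  by rewrite /cosg /sing; der; ring.
have It : (`]t - 1, t + 1[%classic : set R) t by rewrite /= in_itv /=; apply/andP; split; lra.
pose G x : R := `|x| * expR (- x ^+ 2).
have G0 y : 0 <= G y by rewrite mulr_ge0 ?expR_ge0.
have intG : mu.-integrable D (EFin \o G).
  apply: (@integrable_gauss_mul (fun x => `|x|) 1 1) => // [x|x x0].
    exact: norm_continuous.
  by rewrite powRr1 ?(ltW x0) // mul1r normr_id gtr0_norm.
have d1E x y : partial1of2 cosg x y = sing x y.
  by rewrite partial1of2E; have [_ ->] := dcos x y.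
have Gub x y : (`]t - 1, t + 1[%classic : set R) x -> D y -> `|partial1of2 cosg x y| <= G y.
  move=> _ _; rewrite d1E /sing /G normrM normrN normrM (ger0_norm (expR_ge0 _)).
  by rewrite ler_wpM2r ?expR_ge0 // ler_piMr ?sin_max.
have intf x : (`]t - 1, t + 1[%classic : set R) x -> mu.-integrable D (EFin \o cosg x).
  by move=> _; exact: int_cosg.
have derf x y : (`]t - 1, t + 1[%classic : set R) x -> D y -> derivable (cosg ^~ y) x 1.
  by move=> _ _; case: (dcos x y).
have E := differentiation_under_integral mD It intf derf G0 intG Gub.
split; first exact: (derivable_under_integral mD It intf derf G0 intG Gub).
by rewrite -derive1E E; apply: eq_Rintegral => x _; exact: d1E.
Qed.

(** Integration by parts: [t / 2 * cos (t * x) - x * sin (t * x)], multiplied by [expR (- x ^ 2)],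
    is the derivative of [sin (t * x) * expR (- x ^ 2) / 2], which vanishes at both ends. *)
Let Phi_ode t : \int[mu]_(x in D) sing t x = - (t / 2) * Phi t.
Proof.
(* The derivative [k] changes sign, while [integral_eq_of_derive] wants nonnegative integrands; [g]
   dominates [|k|], and the identity is applied to [g + k] and [g]. *)
pose g x : R := (x + `|t| / 2) * expR (- x ^+ 2).
pose k x : R := sing t x + t / 2 * cosg t x.
have absk x : 0 < x -> `|k x| <= g x.
  move=> x0; rewrite /k /g /sing /cosg mulrA -mulrDl normrM (ger0_norm (expR_ge0 _)).
  rewrite ler_wpM2r ?expR_ge0 //; apply: le_trans (ler_normD _ _) _; apply: lerD.
    by rewrite normrN normrM (gtr0_norm x0) ler_piMr ?sin_max // ltW.
  by rewrite 2!normrM (ger0_norm (_ : 0 <= 2^-1)) // ler_piMr ?cos_max // mulr_ge0.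
have ck : continuous k.
  by move=> x; rewrite /k /sing /cosg; apply: der_cont; der_rec.
have cg : continuous g by move=> x; rewrite /g; apply: der_cont; der_rec.
have intg : mu.-integrable D (EFin \o g).
  have i1 : mu.-integrable D (EFin \o (fun x => x * expR (- x ^+ 2))).
    apply: (@integrable_gauss_mul (fun x => x) 1 1) => // [x|x x0].
      exact: cvg_id.
    by rewrite powRr1 ?(ltW x0) // mul1r gtr0_norm.
  have i0 : mu.-integrable D (EFin \o (fun x => `|t| / 2 * expR (- x ^+ 2))).
    apply: (@integrable_gauss_mul (fun=> `|t| / 2) 0 (`|t| / 2)) => // [x|x x0].
      exact: cst_continuous.
    by rewrite powRr0 mulr1 ger0_norm // divr_ge0.
  have := integrableD mD i1 i0; apply: eq_integrable => // x _.
  by rewrite /= /g mulrDl.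
have E : (\int[mu]_(x in D) (g x + k x)%:E = \int[mu]_(x in D) (g x)%:E)%E.
  apply: (@integral_eq_of_derive R _ _ (fun x => 2^-1 * (sin (t * x) * expR (- x ^+ 2)))).
  - by move=> x _; apply: continuousD; [exact: cg|exact: ck].
  - by move=> x _; exact: cg.
  - by move=> x /absk; rewrite ler_norml => /andP[h _]; lra.
  - by move=> x x0; rewrite mulr_ge0 ?expR_ge0 // addr_ge0 ?divr_ge0 // ltW.
  - by move=> x _; der; rewrite /= /k /sing /cosg; field.
  - apply: (@cvg0_le_inv _ _ `|t| 0) => n _.
    have n0 : 0 < n.+1%:R^-1 :> R by rewrite invr_gt0.
    rewrite normrM normrM (ger0_norm (expR_ge0 _)).
    have s1 : `|sin (t * n.+1%:R^-1)| <= `|t| / n.+1%:R.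
      by apply: le_trans (sin_norm_le _) _; rewrite normrM (gtr0_norm n0).
    have e1 : expR (- (n.+1%:R^-1) ^+ 2) <= 1 :> R.
      by rewrite -expR0 ler_expR oppr_le0 sqr_ge0.
    rewrite [`|2^-1|]ger0_norm // -[leRHS]mul1r.
    apply: ler_pM; [by []|by rewrite mulr_ge0 ?expR_ge0|by rewrite invf_le1 ?ler1n|].
    by rewrite -[leRHS]mulr1; apply: ler_pM => //; exact: expR_ge0.
  - apply: (@cvg0_le_inv _ _ 1 0) => n _.
    rewrite !normrM (ger0_norm (expR_ge0 _)) [`|2^-1|]ger0_norm // -[leRHS]mul1r.
    apply: ler_pM; [by []|by rewrite mulr_ge0 ?expR_ge0|by rewrite invf_le1 ?ler1n|].
    rewrite div1r -[leRHS]mul1r; apply: ler_pM; [by []|exact: expR_ge0|exact: sin_max|].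
    rewrite expRN lef_pV2 ?posrE ?expR_gt0 //; apply: le_trans (expR_ge1Dx _).
    have n1 : 1 <= n.+1%:R :> R by rewrite ler1n.
    by nra.
have intk : mu.-integrable D (EFin \o k).
  apply: le_integrable intg => //.
    by apply/measurable_EFinP; apply: measurable_pos => x _; exact: ck.
  by move=> x /DP x0; rewrite /= lee_fin (le_trans (absk x x0)) // ler_norm.
have : \int[mu]_(x in D) k x = 0.
  have : (\int[mu]_(x in D) (g x)%:E + \int[mu]_(x in D) (k x)%:E = \int[mu]_(x in D) (g x)%:E)%E.
    by rewrite -integralD_EFin // -[RHS]E; apply: eq_integral => x _; rewrite EFinD.
  have gf : (\int[mu]_(x in D) (g x)%:E)%E \is a fin_num by exact: integrable_fin_num.
  have kf : (\int[mu]_(x in D) (k x)%:E)%E \is a fin_num by exact: integrable_fin_num.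
  by move=> /(congr1 fine); rewrite /Rintegral fineD //; lra.
rewrite /k RintegralD //; last exact: (integrableZl mD (t / 2) (int_cosg t)).
rewrite RintegralZl //.
by rewrite -/(Phi t); lra.
Qed.

Let Phi0 : Phi 0 = Num.sqrt pi / 2.
Proof.
rewrite -gm0 /gm /gmom; congr fine; apply: eq_integral => x _.
by rewrite /cosg mul0r cos0 powRr0.
Qed.

Let PhiE t : Phi t = Num.sqrt pi / 2 * expR (- (t ^+ 2 / 4)).
Proof.
pose H t : R := Phi t * expR (t ^+ 2 / 4).
have dH x : is_derive x 1 H 0.
  have dP := der_Phi x; rewrite Phi_ode in dP.
  by rewrite /H; der; rewrite /=; field.
have HH a b : a <= b -> H a = H b.
  move=> ab; apply/eqP; rewrite eq_le; apply/andP; split.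
    exact: (@is_derive_homo _ H (fun=> 0)).
  rewrite -lerN2; apply: (@is_derive_homo _ (fun x => - H x) (fun=> 0)) => // x _.
  by rewrite -oppr0; apply: der_opp.
have Ht : H t = Num.sqrt pi / 2.
  have <- : H 0 = Num.sqrt pi / 2 by rewrite /H Phi0 expr0n /= mul0r expR0 mulr1.
  by have [t0|/ltW t0] := leP 0 t; rewrite (HH _ _ t0).
by rewrite -Ht /H expRN mulfK ?gt_eqF ?expR_gt0.
Qed.

Lemma integral_gauss_cosrem t :
  (\int[mu]_(x in `]0%R, +oo[) (cosrem (t * x) * expR (- x ^+ 2))%:E =
   (Num.sqrt pi / 2 * gaussrem (1 / 2) t)%:E)%E.
Proof.
have i2 := integrable_gm (ler0n R 2).
pose g x : R := x `^ 2 * expR (- x ^+ 2).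
pose c x : R := cosg t x + - 1 * cosg 0 x.
have iN := integrableZl mD (- 1) (int_cosg 0).
have ic : mu.-integrable D (EFin \o c) := integrableD mD (int_cosg t) iN.
have ig : mu.-integrable D (EFin \o (fun x => t ^+ 2 / 2 * g x)).
  exact: (integrableZl mD (t ^+ 2 / 2) i2).
have ick : mu.-integrable D (EFin \o (fun x => c x + t ^+ 2 / 2 * g x)) := integrableD mD ic ig.
transitivity (\int[mu]_(x in D) (c x + t ^+ 2 / 2 * g x)%:E)%E.
  apply: eq_integral => x /[!inE] /DP x0; congr EFin.
  rewrite /c /g /cosg /cosrem mul0r cos0 powR_mulrn ?(ltW x0) //.
  by field.
rewrite -(fineK (integrable_fin_num mD ick)); congr EFin.
rewrite -[fine _]/(\int[mu]_(x in D) (c x + t ^+ 2 / 2 * g x))%R.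
rewrite RintegralD // RintegralZl // RintegralD // RintegralZl //.
rewrite -/(Phi t) -/(Phi 0) !PhiE (_ : \int[mu]_(x in D) g x = gm 2) // gm2.
rewrite /gaussrem expr0n /= mul0r oppr0 expR0.
rewrite (_ : 1 / 2 / 2 * t ^+ 2 = t ^+ 2 / 4); last by field.
by field.
Qed.

End gaussian_characteristic_function.

Section riesz_gaussian.
Context {R : realType}.
Notation mu := (@lebesgue_measure R).
Implicit Types (p t x : R).

(** Tonelli for [cosrem (y * x) * expR (- x ^ 2) * y ^ -(p + 1)]. Integrating in [y] first gives
    [x ^ p] by scaling; integrating in [x] first gives the Fourier transform. The Gaussian integral
    is thus a known multiple of the unevaluated one. *)
Lemma riesz_gauss p : 0 < p ->
  ((Num.sqrt pi / 2)%:E * riesz p (gaussrem (1 / 2)) =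
   gmom p * riesz p (@cosrem R))%E.
Proof.
move=> p0.
pose D : set (measurableTypeR R) := `]0, +oo[%classic.
have mD : measurable D by exact: measurable_itv.
have DP x : (x \in D) = (0 < x).
  by apply/idP/idP; rewrite inE /D /= in_itv /= andbT.
pose h (z : measurableTypeR R * measurableTypeR R) : \bar R :=
  (cosrem (z.2 * z.1) * expR (- z.1 ^+ 2) * z.2 `^ (- (p + 1)))%:E.
pose f := h \_ (D `*` D).
have mh : measurable_fun setT h.
  apply/measurable_EFinP; apply: measurable_funM.
    apply: measurable_funM.
      have mc := continuous_measurable_fun (@continuous_cosrem R).
      apply: (measurableT_comp mc).
      by apply: measurable_funM; [exact: measurable_snd|exact: measurable_fst].
    have ce : continuous (fun x : R => expR (- x ^+ 2)).
      by move=> x; apply: der_cont; der_rec.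
    have me := continuous_measurable_fun ce.
    by apply: (measurableT_comp me); exact: measurable_fst.
  by apply: (measurableT_comp (measurable_powR _)); exact: measurable_snd.
have mf : measurable_fun setT f.
  by apply/(measurable_restrictT _ (measurableX mD mD)); exact: measurable_funTS.
have f0 z : (0 <= f z)%E.
  rewrite /f patchE; case: ifPn => // _.
  by rewrite lee_fin !mulr_ge0 ?cosrem_ge0 ?expR_ge0 ?powR_ge0.
have fE x y : f (x, y) = if x \in D then if y \in D then
    (cosrem (y * x) * expR (- x ^+ 2) * y `^ (- (p + 1)))%:E else 0%E else 0%E.
  by rewrite /f patchE in_setX; case: (x \in D); case: (y \in D).
clearbody f.
have E := @fubini_tonelli _ _ (measurableTypeR R) (measurableTypeR R) R mu mu f mf f0.
have E1 : (\int[mu]_x \int[mu]_y f (x, y) = gmom p * riesz p (@cosrem R))%E.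
  have r0 : (0 <= riesz p (@cosrem R))%E by apply: riesz_ge0 => t _; exact: cosrem_ge0.
  have mg : measurable_fun D (fun x : R => (x `^ p * expR (- x ^+ 2))%:E).
    by apply/measurable_EFinP; apply: measurable_pos => x; exact: gmom_cont.
  have g0 x : D x -> (0 <= (x `^ p * expR (- x ^+ 2))%:E)%E.
    by move=> _; rewrite lee_fin mulr_ge0 ?powR_ge0 ?expR_ge0.
  have gZ := @ge0_integralZr _ _ _ mu D mD _ mg _ g0 r0.
  rewrite /gmom -gZ.
  rewrite [RHS]integral_mkcond; apply: eq_integral => x _; rewrite patchE.
  case: ifPn => xD; last first.
    by apply: integral0_eq => y _; rewrite fE (negbTE xD).
  have x0 : 0 < x by rewrite -DP.
  transitivity (\int[mu]_(y in D) ((expR (- x ^+ 2))%:E *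
      (cosrem (y * x) * y `^ (- (p + 1)))%:E))%E.
    rewrite [RHS]integral_mkcond; apply: eq_integral => y _.
    rewrite fE xD patchE; case: ifPn => // _.
    by rewrite -EFinM; congr EFin; ring.
  rewrite ge0_integralZl_EFin ?expR_ge0 //; last 2 first.
  - by move=> y _; rewrite lee_fin mulr_ge0 ?cosrem_ge0 ?powR_ge0.
  - apply/measurable_EFinP; apply: measurable_riesz; apply: measurable_posT => y.
    apply: (@continuous_comp _ _ _ (fun t => t * x) (@cosrem R)); last exact: continuous_cosrem.
    by apply: (@der_cont R (fun t => t * x)); der_rec.
  rewrite -[(\int[mu]_(y in D) _)%E]/(riesz p (fun y => cosrem (y * x))).
  by rewrite riesz_cosrem // gtr0_norm // muleA -EFinM mulrC.
rewrite -E1 E /riesz -ge0_integralZl_EFin ?divr_ge0 ?sqrtr_ge0 //; last 2 first.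
- by move=> y _; rewrite lee_fin mulr_ge0 ?powR_ge0 // gauss_rem_ge.
- apply/measurable_EFinP; apply: measurable_riesz; apply: measurable_posT.
  exact: continuous_gaussrem.
rewrite [LHS]integral_mkcond; apply: eq_integral => y _; rewrite patchE.
case: ifPn => yD; last first.
  by apply/esym; apply: integral0_eq => x _; rewrite fE (negbTE yD); case: ifP.
transitivity (\int[mu]_(x in D) ((y `^ (- (p + 1)))%:E *
    (cosrem (y * x) * expR (- x ^+ 2))%:E))%E; last first.
  rewrite [LHS]integral_mkcond; apply: eq_integral => x _.
  rewrite fE yD patchE; case: ifPn => // _.
  by rewrite -EFinM; congr EFin; ring.
rewrite ge0_integralZl_EFin ?powR_ge0 //; last 2 first.
- by move=> x _; rewrite lee_fin mulr_ge0 ?cosrem_ge0 ?expR_ge0.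
- have cg : continuous (fun x : R => cosrem (y * x) * expR (- x ^+ 2)).
    move=> x; have c1 : {for x, continuous (fun x : R => cosrem (y * x))}.
      apply: (@continuous_comp _ _ _ (fun t => y * t) (@cosrem R)); last exact: continuous_cosrem.
      by apply: (@der_cont R (fun t => y * t)); der_rec.
    have c2 : {for x, continuous (fun x : R => expR (- x ^+ 2))}.
      by apply: der_cont; der_rec.
    exact: (continuousM c1 c2).
  by apply/measurable_EFinP; exact: measurable_posT.
by rewrite integral_gauss_cosrem -!EFinM; congr EFin; ring.
Qed.

End riesz_gaussian.

(** * Positivity and finiteness of the normalizing integral *)

Section riesz_cosine_remainder.
Context {R : realType}.
Notation mu := (@lebesgue_measure R).
Implicit Types (p t x : R).

Lemma riesz_cosrem_gt0 p : 0 < p -> (0 < riesz p (@cosrem R))%E.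
Proof.
move=> p0; pose c : R := 1 / 30 * 2 `^ (- (p + 1)).
have c0 : 0 < c by rewrite mulr_gt0 // powR_gt0.
pose g t : R := cosrem t * t `^ (- (p + 1)).
have cg t : 0 < t -> {for t, continuous g}.
  by move=> t0; apply: continuousM; [exact: continuous_cosrem|eapply der_cont; der_rec].
have g0 t : 0 < t -> 0 <= g t by move=> t0; rewrite mulr_ge0 ?cosrem_ge0 ?powR_ge0.
apply: (@lt_le_trans _ _ (\int[mu]_(t in `[1%R, 2%R]) (g t)%:E)%E); last first.
  by apply: integral_sub_pos => //; exact: measurable_pos.
apply: (@lt_le_trans _ _ (\int[mu]_(t in `[1%R, 2%R]) c%:E)%E).
  have dc t : 1 <= t <= 2 -> is_derive t 1 (fun t : R => c * t) c.
    by move=> _; der; rewrite /= ?mulr1 //; ring.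
  have cc t : 1 <= t <= 2 -> {for t, continuous (fun _ : R => c)}.
    by move=> _; exact: cst_continuous.
  have l12 : 1 <= 2 :> R by rewrite ler1n.
  by rewrite (integral_FTC_cc l12 dc cc) lte_fin; lra.
have t12 t : (`[1%R, 2%R]%classic : set R) t -> 1 <= t <= 2 by rewrite /= in_itv.
apply: ge0_le_integral => //.
- by move=> t _; rewrite lee_fin ltW.
- apply/measurable_EFinP; apply: measurable_funS (measurable_pos cg) => //.
  by move=> t /t12 /andP[t1 _]; rewrite /= in_itv /= andbT; lra.
- move=> t /t12 /andP[t1 t2]; rewrite lee_fin; apply: ler_pM.
  + by [].
  + exact: powR_ge0.
  + rewrite /cosrem; have := @cos_geT6 R t ltac:(lra).
    have : t ^+ 4 * (1 / 30) <= t ^+ 4 * (1 / 24 - t ^+ 2 / 720).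
      by rewrite ler_wpM2l ?exprn_ge0 //; nra.
    have : 1 <= t ^+ 4 by rewrite exprn_ege1.
    lra.
  + rewrite !powRN lef_pV2 ?posrE ?powR_gt0 //; try lra.
    by rewrite ge0_ler_powR ?nnegrE //; lra.
Qed.

(** The function [F] is bounded, and its derivative is the sum of [F1], of order [t ^ (3 - p)] at 0,
    and [F2], of order [t ^ (1 - p)] at infinity. A multiple [K] of it dominates the integrand, by
    [F1] up to 1 and by [F2] beyond, which bounds the integrals over all segments at once. *)
Lemma riesz_cosrem_fin p : 2 < p < 4 -> riesz p (@cosrem R) \is a fin_num.
Proof.
move=> /andP[p2 p4].
rewrite ge0_fin_numE; last by apply: riesz_ge0 => t _; exact: cosrem_ge0.
pose c : R := (4 - p) / 2; pose d : R := (p - 2) / 2.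
pose F t : R := (t ^+ 2 * (1 + t ^+ 2)^-1) `^ c - (1 + t ^+ 2) `^ (- d).
pose F1 t : R := c * (t ^+ 2 * (1 + t ^+ 2)^-1) `^ (c - 1) * (2 * t / (1 + t ^+ 2) ^+ 2).
pose F2 t : R := d * (1 + t ^+ 2) `^ (- d - 1) * (2 * t).
have D0 t : 0 < 1 + t ^+ 2 :> R by have := sqr_ge0 t; lra.
have u0 t : 0 < t -> 0 < t ^+ 2 * (1 + t ^+ 2)^-1.
  by move=> t0; rewrite divr_gt0 ?exprn_gt0.
have dF t : 0 < t -> is_derive t 1 F (F1 t + F2 t).
  move=> t0; rewrite /F; der; rewrite ?u0 ?gt_eqF //=.
  by rewrite /F1 /F2; field; rewrite gt_eqF.
have F10 t : 0 < t -> 0 <= F1 t.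
  move=> t0; rewrite /F1 !mulr_ge0 ?powR_ge0 ?invr_ge0 ?exprn_ge0 ?(ltW (D0 t)) //.
    by rewrite /c; lra.
  exact: ltW.
have F20 t : 0 < t -> 0 <= F2 t.
  move=> t0; rewrite /F2 !mulr_ge0 ?powR_ge0 //; last exact: ltW.
  by rewrite /d; lra.
have cF t : 0 < t -> {for t, continuous (fun t => F1 t + F2 t)}.
  move=> t0; rewrite /F1 /F2; eapply der_cont; der_rec; rewrite ?u0 ?gt_eqF ?exprn_gt0 //.
pose K := (12 * c)^-1 + 2 `^ (d + 1) * (4 * d)^-1.
have K1 : 0 < (12 * c)^-1 by rewrite invr_gt0 /c; lra.
have K2 : 0 < 2 `^ (d + 1) * (4 * d)^-1.
  by rewrite mulr_gt0 ?powR_gt0 // invr_gt0 /d; lra.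
pose g t : R := cosrem t * t `^ (- (p + 1)).
have cg t : 0 < t -> {for t, continuous g}.
  by move=> t0; apply: continuousM; [exact: continuous_cosrem|eapply der_cont; der_rec].
have g0 t : 0 < t -> 0 <= g t by move=> t0; rewrite mulr_ge0 ?cosrem_ge0 ?powR_ge0.
have gF t : 0 < t -> g t <= K * (F1 t + F2 t).
  move=> t0; have F1t := F10 t t0; have F2t := F20 t t0.
  have [t1|t1] := leP t 1.
    have h : g t <= t `^ (3 - p) / 24.
      have -> : 3 - p = 4%:R + - (p + 1) by ring.
      rewrite powRD ?(gt_eqF t0) ?implybT // powR_mulrn ?(ltW t0) // mulrAC.
      rewrite ler_wpM2r ?powR_ge0 // /cosrem.
      by have := cos_leT4 (ltW t0); lra.
    have h1 : (12 * c)^-1 * F1 t >= t `^ (3 - p) / 24.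
      have uu : (t ^+ 2) `^ (c - 1) <= (t ^+ 2 * (1 + t ^+ 2)^-1) `^ (c - 1).
        have -> : c - 1 = - (1 - c) by ring.
        rewrite !powRN lef_pV2 ?posrE ?powR_gt0 ?exprn_gt0 ?u0 //.
        apply: ge0_ler_powR; rewrite ?nnegrE ?sqr_ge0 ?(ltW (u0 t t0)) //.
          by rewrite /c; lra.
        by rewrite ler_piMr ?sqr_ge0 // invf_le1 //; have := sqr_ge0 t; lra.
      have vv : 2 * t / 4 <= 2 * t / (1 + t ^+ 2) ^+ 2.
        rewrite ler_pM2l; last by lra.
        rewrite lef_pV2 ?posrE ?exprn_gt0 //.
        by have : t ^+ 2 <= 1 by [rewrite expr_le1 // ltW]; have := sqr_ge0 t; nra.
      rewrite powR_sqr (gtr0_norm t0) in uu.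
      have e : t `^ (2 * (c - 1)) * t = t `^ (3 - p).
        rewrite -[X in _ * X]powRr1 ?(ltW t0) // -powRD ?(gt_eqF t0) ?implybT //.
        by congr (_ `^ _); rewrite /c; field.
      have -> : (12 * c)^-1 * F1 t = (t ^+ 2 * (1 + t ^+ 2)^-1) `^ (c - 1) *
          (2 * t / (1 + t ^+ 2) ^+ 2) / 12.
        by rewrite /F1; field; rewrite (gt_eqF (D0 t)) /= gt_eqF // /c; lra.
      have t20 : 0 <= 2 * t / 4 by lra.
      have := ler_pM (powR_ge0 _ _) t20 uu vv.
      by rewrite -e; lra.
    by rewrite /K; nra.
  have h : g t <= t `^ (1 - p) / 2.
    have -> : 1 - p = 2%:R + - (p + 1) by ring.
    rewrite powRD ?(gt_eqF t0) ?implybT // powR_mulrn ?(ltW t0) // mulrAC.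
    rewrite ler_wpM2r ?powR_ge0 // /cosrem.
    by have := cos_le1 t; lra.
  have h1 : 2 `^ (d + 1) * (4 * d)^-1 * F2 t >= t `^ (1 - p) / 2.
    have uu : (2 * t ^+ 2) `^ (- d - 1) <= (1 + t ^+ 2) `^ (- d - 1).
      have -> : - d - 1 = - (d + 1) by ring.
      have tt0 : 0 < 2 * t ^+ 2 by rewrite mulr_gt0 ?exprn_gt0.
      rewrite !powRN lef_pV2 ?posrE ?powR_gt0 //.
      apply: ge0_ler_powR; rewrite ?nnegrE ?(ltW tt0) ?(ltW (D0 t)) //.
        by rewrite /d; lra.
      by have : 1 <= t ^+ 2 by [rewrite exprn_ege1 // ltW]; lra.
    have -> : 2 `^ (d + 1) * (4 * d)^-1 * F2 t = 2 `^ (d + 1) * (1 + t ^+ 2) `^ (- d - 1) * t / 2.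
      by rewrite /F2; field; rewrite gt_eqF // /d; lra.
    have e : 2 `^ (d + 1) * (2 * t ^+ 2) `^ (- d - 1) * t = t `^ (1 - p).
      rewrite powRM ?sqr_ge0 // powR_sqr (gtr0_norm t0) mulrA.
      rewrite -powRD ?pnatr_eq0 ?implybT // (_ : d + 1 + (- d - 1) = 0); last by ring.
      rewrite powRr0 mul1r -[X in _ * X]powRr1 ?(ltW t0) //.
      rewrite -powRD ?(gt_eqF t0) ?implybT //.
      by congr (_ `^ _); rewrite /d; field.
    rewrite -e ler_pM2r // ler_pM2r // ler_pM2l ?powR_gt0 //.
  by rewrite /K; nra.
apply: (@le_lt_trans _ _ (K * 2)%:E); last exact: ltry.
apply: integral_pos_le => [||a b a0 ab]; [exact: measurable_pos|exact: g0|].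
have xab x : a <= x <= b -> 0 < x by move=> /andP[/(lt_le_trans a0)].
have dKF x : a <= x <= b -> is_derive x 1 (fun x => K * F x) (K * (F1 x + F2 x)).
  by move=> /xab /dF ?; apply: der_mull.
have cKF x : a <= x <= b -> {for x, continuous (fun x => K * (F1 x + F2 x))}.
  by move=> /xab x0; apply: continuousM; [exact: cst_continuous|exact: cF].
apply: (@le_trans _ _ (\int[mu]_(x in `[a, b]) (K * (F1 x + F2 x))%:E)%E).
  apply: ge0_le_integral => //.
  - by move=> x; rewrite /= in_itv /= => /xab; rewrite lee_fin; exact: g0.
  - apply/measurable_EFinP; apply: subspace_continuous_measurable_fun => //.
    by apply: within_cont => x; rewrite in_itv /= => /xab; exact: cg.
  - apply/measurable_EFinP; apply: subspace_continuous_measurable_fun => //.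
    by apply: within_cont => x; rewrite in_itv /= => /cKF.
  - by move=> x; rewrite /= in_itv /= => /xab; rewrite lee_fin; exact: gF.
rewrite (integral_FTC_cc ab dKF cKF) lee_fin -mulrBr.
have b0 := lt_le_trans a0 ab.
have p1 e : 1 = 1 `^ e :> R by rewrite powR1.
have Fb x : 0 < x -> -1 <= F x <= 1.
  move=> x0; have x2 := sqr_ge0 x.
  have h1 : (x ^+ 2 * (1 + x ^+ 2)^-1) `^ c <= 1.
    rewrite [leRHS](p1 c); apply: ge0_ler_powR.
    - by rewrite /c; lra.
    - by rewrite nnegrE ltW // u0.
    - by rewrite nnegrE.
    - by rewrite ler_pdivrMr //; lra.
  have h2 : (1 + x ^+ 2) `^ (- d) <= 1.
    rewrite powRN invf_le1 ?powR_gt0 // [leLHS](p1 d); apply: ge0_ler_powR.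
    - by rewrite /d; lra.
    - by rewrite nnegrE.
    - by rewrite nnegrE ltW.
    - by lra.
  have := powR_ge0 (x ^+ 2 * (1 + x ^+ 2)^-1) c; have := powR_ge0 (1 + x ^+ 2) (- d).
  by rewrite /F => h3 h4; apply/andP; split; lra.
have /andP[_ Fb1] := Fb b b0; have /andP[Fa1 _] := Fb a a0.
by rewrite ler_pM2l ?addr_gt0 //; lra.
Qed.

End riesz_cosine_remainder.

(** * Absolute moments of the standard Gaussian and lower bounds for them *)

Section gaussian_constant.
Context {R : realType}.
Notation mu := (@lebesgue_measure R).
Implicit Types (p r s t x d : R).

(** For [p >= 0] this is the [p]-th absolute moment of a standard Gaussian variable, and the [p]-th
    power of the Khintchine constant when [p > 0]. *)
Definition gam p : R := 2 `^ (p / 2 + 1) * gm p / Num.sqrt pi.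

Let pi0 : 0 < Num.sqrt pi :> R.
Proof. by rewrite sqrtr_gt0 pi_gt0. Qed.

Lemma gam_ge0 p : 0 <= gam p.
Proof. by rewrite !mulr_ge0 ?powR_ge0 ?gm_ge0 // invr_ge0 ltW. Qed.

Lemma gam_rec p : 0 <= p -> gam (p + 2) = (p + 1) * gam p.
Proof.
move=> p0; rewrite /gam gm_rec //.
have -> : (p + 2) / 2 + 1 = p / 2 + 1 + 1 by field.
rewrite [2 `^ (_ + _ + 1)]powRD ?pnatr_eq0 ?implybT // powRr1 //.
by field; rewrite gt_eqF.
Qed.

Lemma gam2 : gam 2 = 1.
Proof.
rewrite /gam gm2 (_ : 2 / 2 + 1 = 2%:R); last by field.
by rewrite powR_mulrn //; field; rewrite gt_eqF.
Qed.

Lemma riesz_gauss1 p : 0 < p ->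
  (riesz p (gaussrem (1 : R)) = (gam p)%:E * riesz p (@cosrem R))%E.
Proof.
move=> p0; have := @riesz_gauss R p p0.
rewrite riesz_gaussrem; last by lra.
rewrite gmE ?ltW // muleA -EFinM => h.
rewrite /gam (_ : 2 `^ _ * gm p / _ = 2 `^ (p / 2) * 2 / Num.sqrt pi * gm p); last first.
  by rewrite powRD ?pnatr_eq0 ?implybT // powRr1 //; ring.
rewrite EFinM -muleA -h muleA -EFinM.
have e : 2 `^ (p / 2) * (1 / 2) `^ (p / 2) = 1 :> R.
  by rewrite -powRM // (_ : 2 * (1 / 2) = 1) ?powR1 //; field.
rewrite (_ : _ * _ = 1) ?mul1e // -[RHS]e; field; rewrite gt_eqF //.
Qed.

(** The form in which Jensen's inequality is used: a tangent-line bound between powers, integrated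
    against the Gaussian. *)
Lemma gm_lin_le (u v : R) p r s : 0 <= p -> 0 <= r -> 0 <= s ->
  (forall x, 0 < x -> u * x `^ p + v * x `^ r <= x `^ s) ->
  u * gm p + v * gm r <= gm s.
Proof.
move=> p0 r0 s0 h.
pose f c : R -> R := fun x => x `^ c * expR (- x ^+ 2).
pose D : set (measurableTypeR R) := `]0, +oo[%classic.
have mD : measurable D by exact: measurable_itv.
have iu : mu.-integrable D (fun x => u%:E * (f p x)%:E)%E.
  by apply: integrableZl => //; exact: integrable_gm.
have iv : mu.-integrable D (fun x => v%:E * (f r x)%:E)%E.
  by apply: integrableZl => //; exact: integrable_gm.
have Z c : 0 <= c -> (\int[mu]_(x in D) (f c x)%:E = (gm c)%:E)%E.
  by move=> c0; rewrite -gmE.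
rewrite -lee_fin EFinD !EFinM -!Z // -!integralZl //; try exact: integrable_gm.
rewrite -integralD //; apply: le_integral => //.
- by apply: integrableD.
- exact: integrable_gm.
move=> x; rewrite inE /D /= in_itv /= andbT => x0.
rewrite -!EFinM -EFinD lee_fin /f !mulrA -mulrDl.
by rewrite ler_pM2r ?expR_gt0 // h.
Qed.

Lemma Gamma_gm p : 0 <= p -> Gamma ((p + 1) / 2) = 2 * gm p.
Proof.
move=> p0; rewrite /Gamma /Rintegral.
pose s := (p + 1) / 2 - 1.
pose G t : R := t `^ s * expR (- t).
pose H x : R := 2 * (x `^ p * expR (- x ^+ 2)).
have cG t : 0 < t -> {for t, continuous G}.
  by move=> t0; rewrite /G; eapply der_cont; der_rec.
have cH t : 0 < t -> {for t, continuous H}.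
  by move=> t0; rewrite /H; eapply der_cont; der_rec.
have G0 t : 0 < t -> 0 <= G t by move=> _; rewrite mulr_ge0 ?powR_ge0 ?expR_ge0.
have H0 t : 0 < t -> 0 <= H t.
  by move=> _; rewrite mulr_ge0 // mulr_ge0 ?powR_ge0 ?expR_ge0.
have E1 : (\int[mu]_(x in `]0%R, +oo[) (H x)%:E <= \int[mu]_(x in `]0%R, +oo[) (G x)%:E)%E.
  have phi0 x : 0 < x -> 0 < x ^+ 2 by exact: exprn_gt0.
  have dphi x : 0 < x -> is_derive x 1 (fun x => x ^+ 2) (2 * x).
    by move=> _; der; rewrite /=; ring.
  have cphi x : 0 < x -> {for x, continuous (fun x : R => 2 * x)}.
    by move=> _; apply: (@der_cont _ (fun x => 2 * x)); der_rec.
  have phi'0 x : 0 < x -> 0 < 2 * x by move=> x0; rewrite mulr_gt0.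
  have := integral_subst_le phi0 dphi cphi phi'0 cG G0.
  apply: le_trans; rewrite le_eqVlt; apply/orP; left; apply/eqP.
  apply: eq_integral => x; rewrite inE /= in_itv /= andbT => x0; congr EFin.
  have -> : H x = 2 * (x `^ (2 * s) * x * expR (- x ^+ 2)).
    rewrite /H -[X in _ = _ * (_ * X * _)]powRr1 ?(ltW x0) // -powRD ?(gt_eqF x0) ?implybT //.
    by congr (_ * (_ `^ _ * _)); rewrite /s; field.
  by rewrite /G powR_sqr gtr0_norm //; ring.
have E2 : (\int[mu]_(x in `]0%R, +oo[) (G x)%:E <= \int[mu]_(x in `]0%R, +oo[) (H x)%:E)%E.
  pose phi x : R := x `^ 2^-1.
  pose phi' x : R := 2^-1 * x `^ (2^-1 - 1).
  have phi0 x : 0 < x -> 0 < phi x by move=> x0; exact: powR_gt0.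
  have dphi x : 0 < x -> is_derive x 1 phi (phi' x).
    by move=> x0; rewrite /phi; der; rewrite /phi' /= ?mulr1.
  have cphi x : 0 < x -> {for x, continuous phi'}.
    by move=> x0; rewrite /phi'; eapply der_cont; der_rec.
  have phi'0 x : 0 < x -> 0 < phi' x.
    by move=> x0; rewrite mulr_gt0 ?invr_gt0 ?powR_gt0.
  have := integral_subst_le phi0 dphi cphi phi'0 cH H0.
  apply: le_trans; rewrite le_eqVlt; apply/orP; left; apply/eqP.
  apply: eq_integral => x; rewrite inE /= in_itv /= andbT => x0; congr EFin.
  rewrite /G /H /phi /phi' -powR_mulrn ?powR_ge0 // -!powRrM mulVf ?pnatr_eq0 //.
  rewrite powRr1 ?(ltW x0) // (_ : s = 2^-1 * p + (2^-1 - 1)); last by rewrite /s; field.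
  by rewrite powRD ?(gt_eqF x0) ?implybT //; field.
rewrite (_ : (\int[mu]_(t in _) _)%E = (\int[mu]_(x in `]0%R, +oo[) (H x)%:E)%E); last first.
  by apply/eqP; rewrite eq_le E1 E2.
rewrite /H; under eq_integral do rewrite EFinM.
rewrite ge0_integralZl_EFin //.
- by rewrite -/(gmom p) gmE.
- by move=> x _; rewrite lee_fin mulr_ge0 ?powR_ge0 ?expR_ge0.
- by apply/measurable_EFinP; apply: measurable_pos => x; exact: gmom_cont.
Qed.

(** Comes from [ln ((k + 1) / k) >= 2 / (2 * k + 1)], which is [artanh y >= y] at
    [y = 1 / (2 * k + 1)]. *)
Lemma powR_succ_ge (k d : R) : 0 < k -> 0 <= d ->
  (2 * k + 2 * d + 1) * k `^ d <= (2 * k + 1) * (k + 1) `^ d.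
Proof.
move=> k0 d0; have k1 : 0 < k + 1 by lra.
have k2 : 0 < 2 * k + 1 by lra.
have K : 0 < (k + 1) / k by rewrite divr_gt0.
have -> : k + 1 = k * ((k + 1) / k) by rewrite mulrC divfK ?gt_eqF.
rewrite [X in _ <= _ * X]powRM ?(ltW k0) ?(ltW K) // mulrCA [_ * k `^ d]mulrC.
rewrite ler_pM2l ?powR_gt0 //.
pose y : R := (2 * k + 1)^-1.
have y01 : 0 <= y < 1 by rewrite invr_ge0 (ltW k2) invf_lt1 //; lra.
have hy : (1 + y) / (1 - y) = (k + 1) / k.
  by rewrite /y; field; rewrite (gt_eqF k0) (gt_eqF k2) /= gt_eqF //; lra.
have hl : 2 * y <= ln ((k + 1) / k).
  by rewrite -ler_expR lnK ?posrE // -hy expR2_le.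
have hp : 1 + d * (2 * y) <= ((k + 1) / k) `^ d.
  rewrite powR_expR //; apply: le_trans (expR_ge1Dx _).
  by rewrite lerD2l ler_wpM2l.
have -> : 2 * k + 2 * d + 1 = (2 * k + 1) * (1 + d * (2 * y)).
  by rewrite /y; field; rewrite gt_eqF.
by rewrite ler_pM2l.
Qed.

Let quotient_le (k d g h x y : R) : 0 <= k -> 0 < x -> 0 < y -> 0 <= g -> 0 < h ->
  (2 * k + 2 * d + 1) * x <= (2 * k + 1) * y ->
  (2 * k + 2 * d + 1) / 2 * g / (y * ((2 * k + 1) / 2 * h)) <= g / (x * h).
Proof.
move=> k0 x0 y0 g0 h0 hxy.
have k2 : 0 < (2 * k + 1) / 2 by lra.
have d1 : 0 < y * ((2 * k + 1) / 2 * h) := mulr_gt0 y0 (mulr_gt0 k2 h0).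
have d2 : 0 < x * h := mulr_gt0 x0 h0.
rewrite ler_pdivrMr // [leRHS]mulrAC ler_pdivlMr //.
have := ler_wpM2r (mulr_ge0 g0 (ltW h0)) hxy.
by move=> {d1 d2 hxy k2 k0 x0 y0 g0 h0} h1; lra.
Qed.

(* Gautschi-type bound: the ratio of the two sides decreases in [m], since
   [1 + d / (m + 1/2) <= ((m + 1) / m)^d], and tends to 1. *)
Lemma gm_ge_powR (m : nat) d : (0 < m)%N -> 0 <= d <= 1 ->
  m%:R `^ d * gm (2 * m%:R) <= gm (2 * m%:R + 2 * d) :> R.
Proof.
move=> m0 /andP[d0 d1].
have m1 k : (0 < k)%N -> 1 <= k%:R :> R by rewrite ler1n.
have gm_gt0 k : 0 < gm (2 * k%:R) :> R.
  elim: k => [|k IH]; first by rewrite mulr0 gm0 divr_gt0.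
  have k0 : 0 <= k%:R :> R by [].
  rewrite -[k.+1%:R]natr1 mulrDr mulr1 gm_rec; last lra.
  by apply: mulr_gt0 => //; lra.
pose q k : R := gm (2 * k%:R + 2 * d) / (k%:R `^ d * gm (2 * k%:R)).
have den0 k : (0 < k)%N -> 0 < k%:R `^ d * gm (2 * k%:R).
  by move=> k0; apply: mulr_gt0 => //; rewrite powR_gt0 ?ltr0n.
suff : 1 <= q m by rewrite /q ler_pdivlMr ?den0 // mul1r.
have qS k : (0 < k)%N -> q k.+1 <= q k.
  move=> k0; have kp : 0 < k%:R :> R by rewrite ltr0n.
  have e1 : gm (2 * k.+1%:R + 2 * d) = (2 * k%:R + 2 * d + 1) / 2 * gm (2 * k%:R + 2 * d).
    rewrite -gm_rec; last by rewrite addr_ge0 // mulr_ge0 // ltW.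
    by congr gm; rewrite -[k.+1%:R]natr1; ring.
  have e2 : gm (2 * k.+1%:R) = (2 * k%:R + 1) / 2 * gm (2 * k%:R) :> R.
    rewrite -gm_rec; last by rewrite mulr_ge0 // ltW.
    by congr gm; rewrite -[k.+1%:R]natr1; ring.
  rewrite /q e1 e2; apply: quotient_le; rewrite ?powR_gt0 ?ltr0n ?gm_ge0 ?(ltW kp) //.
  by rewrite -[k.+1%:R]natr1; exact: powR_succ_ge.
have qle j : q (m + j)%N <= q m.
  elim: j => [|j IH]; first by rewrite addn0.
  by rewrite addnS; apply: le_trans IH; apply: qS; rewrite addn_gt0 m0.
(* Jensen for [z ^ -d]: under the density proportional to [x ^ (2 * k) * expR (- x ^ 2)] the mean of
   [x ^ -2] is [1 / c] with [c = k - 1 / 2], so [q k] is at least [(c / k) ^ d], hence at least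
   [c / k] since [d <= 1]. *)
have qge k : (0 < k)%N -> 1 - (2 * k%:R)^-1 <= q k.
  move=> k0; have k1 := m1 k k0; have kp : 0 < k%:R :> R by lra.
  pose c : R := k%:R - 1 / 2; have c0 : 0 < c by rewrite /c; lra.
  have hlow : c `^ d * gm (2 * k%:R) <= gm (2 * k%:R + 2 * d).
    have E : gm (2 * k%:R) = c * gm (2 * k%:R - 2).
      by rewrite -{1}[2 * k%:R](subrK 2) gm_rec ?/c; [field|lra].
    have -> : c `^ d * gm (2 * k%:R) =
        c `^ d * (1 + d) * gm (2 * k%:R) + - (c `^ d * d * c) * gm (2 * k%:R - 2).
      by rewrite E; ring.
    have g1 : 0 <= 2 * k%:R :> R by lra.
    have g2 : 0 <= 2 * k%:R - 2 :> R by lra.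
    have g3 : 0 <= 2 * k%:R + 2 * d :> R by lra.
    apply: gm_lin_le => // x x0.
    have x20 : 0 < x ^+ 2 by exact: exprn_gt0.
    have := @powR_geV R (x ^+ 2 / c) d d0 ltac:(by rewrite divr_gt0).
    have e : x ^+ 2 = c * (x ^+ 2 / c) by rewrite mulrC divfK ?gt_eqF.
    have e' : x `^ (2 * k%:R + 2 * d) = x `^ (2 * k%:R) * (c `^ d * (x ^+ 2 / c) `^ d).
      rewrite powRD ?(gt_eqF x0) ?implybT // -{2}[x](gtr0_norm x0) -powR_sqr {1}e.
      by rewrite powRM ?divr_ge0 ?(ltW c0) ?(ltW x20).
    have e2 : x `^ (2 * k%:R) = x `^ (2 * k%:R - 2) * x ^+ 2.
      rewrite -powR_mulrn ?(ltW x0) // -powRD ?(gt_eqF x0) ?implybT //.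
      by congr (_ `^ _); ring.
    rewrite invf_div => hb.
    have := ler_wpM2l (mulr_ge0 (powR_ge0 x (2 * k%:R)) (powR_ge0 c d)) hb.
    rewrite e' mulrA; apply: le_trans; rewrite e2 le_eqVlt; apply/orP; left; apply/eqP.
    by field; rewrite gt_eqF.
  rewrite ler_pdivlMr ?den0 //; apply: le_trans hlow.
  rewrite mulrA ler_pM2r ?gm_gt0 //.
  have -> : c = k%:R * (1 - (2 * k%:R)^-1) by rewrite /c; field; rewrite gt_eqF.
  have u0 : 0 <= 1 - (2 * k%:R)^-1 :> R by rewrite subr_ge0 invf_le1; lra.
  rewrite powRM ?(ltW kp) // mulrC ler_pM2l ?powR_gt0 //.
  have [->|un0] := eqVneq (1 - (2 * k%:R)^-1 : R) 0; first exact: powR_ge0.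
  apply: ger1_powR => //.
  by rewrite lt_neqAle eq_sym un0 u0 /= gerBl invr_ge0; lra.
rewrite leNgt; apply/negP => q1.
(* An index beyond both [m] and the reciprocal of [1 - q m], which contradicts
   [1 - q m <= 1 / (2 * k)]. *)
pose k := (m + (Num.truncn (1 - q m)^-1).+1)%N.
have k0 : (0 < k)%N by rewrite addn_gt0 m0.
have kp : 0 < k%:R :> R by rewrite ltr0n.
have h2 : 1 - q m <= (2 * k%:R)^-1.
  by have := le_trans (qge k k0) (qle _); rewrite lerBlDl -lerBlDr.
have h1 : (1 - q m)^-1 < k%:R.
  by apply: lt_le_trans (truncnS_gt _) _; rewrite ler_nat leq_addl.
have d1' : 0 < 1 - q m by rewrite subr_gt0.
rewrite -[(1 - q m)^-1]mul1r ltr_pdivrMr // in h1.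
have h3 := ler_wpM2l (ltW kp) h2.
have : k%:R * (2 * k%:R)^-1 = 1 / 2 :> R by field; rewrite gt_eqF.
lra.
Qed.

Lemma gam_gm2 d : gam (2 + 2 * d) = 4 * 2 `^ d * (gm (2 + 2 * d) / Num.sqrt pi).
Proof.
rewrite /gam (_ : (2 + 2 * d) / 2 + 1 = 2%:R + d); last by field.
rewrite powRD ?pnatr_eq0 ?implybT // powR_mulrn //.
by ring.
Qed.

Lemma gam_ge_powR2 d : 0 <= d <= 1 -> 2 `^ d <= gam (2 + 2 * d).
Proof.
move=> d01; have := @gm_ge_powR 1 d isT d01.
rewrite mulr1 powR1 mul1r gm2 => h.
rewrite gam_gm2 -mulrA mulrCA ler_peMr ?powR_ge0 //.
by rewrite mulrA ler_pdivlMr //; lra.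
Qed.

(** The Gautschi bound at [m = 3], carried back by two steps of the recursion. Its slope at [d = 0]
    is closer to the true one than that of [gam_ge_powR2], which comes from [m = 1]. *)
Lemma gam_ge_powR6 d : 0 <= d <= 1 ->
  6 `^ d / ((1 + 2 / 3 * d) * (1 + 2 / 5 * d)) <= gam (2 + 2 * d).
Proof.
move=> d01; have := @gm_ge_powR 3 d isT d01.
have /andP[d0 d1] := d01.
have e1 : 2 * 3 = 2 + 2 + 2 :> R by ring.
have e2 : 2 * 3 + 2 * d = 2 + 2 * d + 2 + 2 by ring.
rewrite e2 e1 !gm_rec; try lra.
rewrite gm2 => h.
have u0 : 0 < 1 + 2 / 3 * d by lra.
have v0 : 0 < 1 + 2 / 5 * d by lra.
have -> : 6 `^ d = 2 `^ d * 3 `^ d by rewrite -powRM //; congr (_ `^ _); ring.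
rewrite gam_gm2 ler_pdivrMr ?mulr_gt0 //.
set g := gm _ in h *; set s := Num.sqrt pi in h *.
have -> : 4 * 2 `^ d * (g / s) * ((1 + 2 / 3 * d) * (1 + 2 / 5 * d)) =
  2 `^ d * (4 * g * ((1 + 2 / 3 * d) * (1 + 2 / 5 * d)) / s) by ring.
rewrite ler_pM2l ?powR_gt0 // ler_pdivlMr //.
by lra.
Qed.

(** Jensen for [z ^ (2 * d)], convex because [2 * d >= 1], under the density proportional to
    [x ^ 2 * expR (- x ^ 2)], whose mean is [c = 2 / sqrt pi]. Then [2 * c ^ 2 = 8 / pi] exceeds 5 /
    2, the fourth-moment bound that it has to match. *)
Lemma gam_ge_powR_half d : 2^-1 <= d -> (5 / 2) `^ d <= gam (2 + 2 * d).
Proof.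
move=> d2; have d0 : 0 <= d by lra.
set s := Num.sqrt pi : R.
have s2 : s * s = pi by rewrite -expr2 sqr_sqrtr // pi_ge0.
pose c : R := 2 / s; have c0 : 0 < c by rewrite divr_gt0.
have h : c `^ (2 * d) * gm 2 <= gm (2 + 2 * d).
  have g3 : gm 3 = c * gm 2 :> R.
    rewrite (_ : 3 = 1 + 2) ?gm_rec ?gm1 ?gm2; try lra.
    by rewrite /c -/s; field; rewrite gt_eqF.
  have -> : c `^ (2 * d) * gm 2 =
      c `^ (2 * d) * (1 - 2 * d) * gm 2 + c `^ (2 * d) * (2 * d) / c * gm 3.
    by rewrite g3; field; rewrite gt_eqF.
  have d2' : 0 <= 2 + 2 * d by lra.
  apply: gm_lin_le => // x x0; have xc : 0 <= x / c by rewrite divr_ge0 ?ltW.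
  have := @powR_ge_bernoulli R (x / c) (2 * d) ltac:(lra) xc => hb.
  have e : x `^ (2 + 2 * d) = x `^ 2 * c `^ (2 * d) * (x / c) `^ (2 * d).
    rewrite powRD ?(gt_eqF x0) ?implybT // -mulrA -powRM ?(ltW c0) //.
    by rewrite [c * _]mulrC divfK ?gt_eqF.
  have e3 : x `^ 3 = x `^ 2 * x.
    rewrite (_ : 3 = 2 + 1) ?powRD ?(gt_eqF x0) ?implybT ?powRr1 ?(ltW x0) //.
    by ring.
  have := ler_wpM2l (mulr_ge0 (powR_ge0 x 2) (powR_ge0 c (2 * d))) hb.
  rewrite e; apply: le_trans; rewrite e3 le_eqVlt; apply/orP; left; apply/eqP.
  by field; rewrite gt_eqF.
have cc : 5 / 2 <= 2 * c ^+ 2.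
  have -> : 2 * c ^+ 2 = 8 / pi.
    by rewrite /c -s2; field; rewrite gt_eqF.
  rewrite ler_pdivlMr ?pi_gt0 //.
  by have := @pihalf_lt R; lra.
apply: (@le_trans _ _ ((2 * c ^+ 2) `^ d)).
  apply: ge0_ler_powR => //; rewrite nnegrE; first by lra.
  by rewrite mulr_ge0 ?exprn_ge0 ?ltW.
rewrite powRM ?exprn_ge0 ?(ltW c0) // powR_sqr (gtr0_norm c0) gam_gm2.
have -> : 4 * 2 `^ d * (gm (2 + 2 * d) / s) = 2 `^ d * (4 * gm (2 + 2 * d) / s) by ring.
rewrite ler_pM2l ?powR_gt0 // ler_pdivlMr //.
by move: h; rewrite gm2 -/s; lra.
Qed.

End gaussian_constant.

(** * Khintchine's inequality for Rademacher averages *)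

Section small_coefficients.
Context {R : realType}.
Implicit Types (p x y z t d a : R) (s : seq R).

Lemma rad_drop0 (f : R -> R) s x : rad f [seq a <- s | a != 0] x = rad f s x.
Proof.
elim: s x => [|a s IH] x //=; have [->|a0] := eqVneq a 0 => /=; last by rewrite !IH.
by rewrite IH addr0 subr0; field.
Qed.

(** Positivity and finiteness of [riesz p cosrem] allow the common factor to be cancelled, which
    turns the extended-real estimate into one on moments. The bound [c] may depend on the weight, so
    that exact and Gaussian bounds can be mixed. *)
Lemma rad_cospow_le p (ws : seq (R * R)) (c : R -> R) : 2 < p < 4 ->
  (forall wa, wa \in ws -> 0 < wa.1 <= 2^-1) -> \sum_(wa <- ws) wa.1 = 1 ->
  (forall wa, wa \in ws ->
     (riesz p (cospow wa.1^-1) <= (c wa.1)%:E * riesz p (@cosrem R))%E) ->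
  rad (fun y => `|y| `^ p) [seq wa.2 | wa <- ws] 0 <=
  \sum_(wa <- ws) wa.1 * `|wa.2| `^ p * c wa.1.
Proof.
move=> /andP[p2 p4] w12 w1 wc.
have p0 : 0 < p by lra.
have := riesz_cosrem_gt0 p0; have := @riesz_cosrem_fin R p.
rewrite p2 p4 => /(_ isT) /fineK Rf R0.
move: (riesz_rad_le p2 w12 w1) wc; rewrite -Rf; set r := fine _ => h wc.
have r0 : 0 < r by move: R0; rewrite -Rf lte_fin.
rewrite -(ler_pM2r r0) -lee_fin EFinM; apply: le_trans h _.
rewrite mulr_suml -sumEFin big_seq [leRHS]big_seq; apply: lee_sum => wa wi.
rewrite -[X in (_ <= X%:E)%E]mulrA [leRHS]EFinM; apply: lee_wpmul2l; last by rewrite EFinM wc.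
by rewrite lee_fin mulr_ge0 ?powR_ge0 //; have /andP[/ltW] := w12 _ wi.
Qed.

Lemma riesz_cospow_le p w : 2 < p -> 0 < w <= 2^-1 ->
  (riesz p (cospow w^-1) <= (w^-1 `^ (p / 2) * gam p)%:E * riesz p (@cosrem R))%E.
Proof.
move=> p2 /andP[w0 w12]; have p0 : 0 < p by lra.
have w2 : 2 <= w^-1 by rewrite -[2]invrK lef_pV2 // posrE invr_gt0.
apply: le_trans (riesz_cos_pow_le p2 w2) _.
rewrite -/(gaussrem w^-1) riesz_gaussrem ?invr_gt0 // riesz_gauss1 // EFinM.
by rewrite muleA.
Qed.

Lemma powR_abs_sqr a p : 0 < a ^+ 2 -> `|a| `^ p = (a ^+ 2) `^ (p / 2).
Proof. by move=> a0; rewrite powR_sqr; congr (_ `^ _); field. Qed.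

(** With the weight [a ^ 2], the factor [(a ^ -2) ^ (p / 2)] cancels [|a| ^ p], and the weights sum
    to 1. Zero coefficients are dropped because weights must be positive. *)
Lemma khintchine_small p s : 2 < p < 4 -> \sum_(a <- s) a ^+ 2 = 1 ->
  (forall a, a \in s -> a ^+ 2 <= 2^-1) ->
  rad (fun y => `|y| `^ p) s 0 <= gam p.
Proof.
move=> p24 s1 s2; have /andP[p2 p4] := p24.
rewrite -rad_drop0; set s' := [seq a <- s | _].
have a0 a : a \in s' -> 0 < a ^+ 2 <= 2^-1.
  by rewrite mem_filter => /andP[a0 /s2 ->]; rewrite exprn_even_gt0 ?a0.
have s1' : \sum_(a <- s') a ^+ 2 = 1.
  rewrite big_filter -s1 [RHS](bigID (fun a => a != 0)) /= [X in _ = _ + X]big1 ?addr0 //.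
  by move=> a /negPn/eqP ->; rewrite expr0n.
have := @rad_cospow_le p [seq (a ^+ 2, a) | a <- s'] (fun w => w^-1 `^ (p / 2) * gam p) p24.
rewrite -map_comp map_id !big_map /= => h.
apply: le_trans (h _ s1' _) _ => [_ /mapP[a /a0 ? ->]//|_ /mapP[a /a0 ? ->]|].
  exact: riesz_cospow_le.
apply: (@le_trans _ _ ((\sum_(a <- s') a ^+ 2) * gam p)); last by rewrite s1' mul1r.
rewrite mulr_suml big_seq [leRHS]big_seq; apply: ler_sum => a /a0 /andP[a1 _].
have AB : (a ^+ 2) `^ (p / 2) * (a ^+ 2)^-1 `^ (p / 2) = 1.
  by rewrite -powRM ?invr_ge0 ?sqr_ge0 // divff ?gt_eqF // powR1.
rewrite powR_abs_sqr //; move: AB; set A := _ `^ _; set B := _ `^ _ => AB.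
have -> : a ^+ 2 * A * (B * gam p) = a ^+ 2 * gam p * (A * B) by ring.
by rewrite AB mulr1.
Qed.

Lemma expR_15_le : expR (15^-1) <= 31 / 29 :> R.
Proof.
have := @expR2_le R 30^-1; have -> : 2 * 30^-1 = 15^-1 :> R by field.
have -> : (1 + 30^-1) / (1 - 30^-1) = 31 / 29 :> R by field.
by apply; rewrite invr_ge0 invf_lt1 //; lra.
Qed.

Lemma powR_le_expRN (c e d : R) : 0 < c -> 0 <= d -> expR e <= c^-1 ->
  c `^ d <= expR (- (e * d)).
Proof.
move=> c0 d0 h; rewrite powR_expR // ler_expR mulrC -mulNr ler_wpM2r //.
by rewrite -ler_expR lnK ?posrE // expRN -[c]invrK lef_pV2 ?posrE ?expR_gt0 ?invr_gt0.
Qed.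

(** Equality holds at [d = 0] and the first-order terms nearly cancel. Hence the sharp lower bounds
    5 / 26 for [ln (17 / 14)] and 14 / 15 for [ln (51 / 20)], followed by second-order bounds on the
    exponentials. *)
Lemma khintchine_endpoint d : 0 <= d <= 2^-1 ->
  7 / 17 * (14 / 17) `^ d +
  10 / 17 * (20 / 51) `^ d * ((1 + 2 / 3 * d) * (1 + 2 / 5 * d)) <= 1.
Proof.
move=> /andP[d0 d2].
have h1 : (14 / 17) `^ d <= 1 - 5 / 26 * d + (5 / 26 * d) ^+ 2 / 2.
  apply: le_trans (powR_le_expRN (e := 5 / 26) _ d0 _) _; first by lra.
    have := @expR2_le R (5 / 52); have -> : 2 * (5 / 52) = 5 / 26 :> R by field.
    move=> h; apply: le_trans (h _) _; first by lra.
    have -> : (1 + 5 / 52) / (1 - 5 / 52) = 57 / 47 :> R by field.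
    by lra.
  by apply: expRN_leT2; lra.
have h2 : (20 / 51) `^ d <= 1 - 14 / 15 * d + (14 / 15 * d) ^+ 2 / 2.
  apply: le_trans (powR_le_expRN (e := 14 / 15) _ d0 _) _; first by lra.
    rewrite expRM_natl; apply: le_trans (_ : (31 / 29) ^+ 14 <= _); last by lra.
    by apply: lerXn2r; rewrite ?nnegrE ?expR_ge0 ?expR_15_le //; lra.
  by apply: expRN_leT2; lra.
have D0 : 0 <= (1 + 2 / 3 * d) * (1 + 2 / 5 * d) by nra.
have := ler_wpM2r D0 h2.
have dd : d ^+ 2 <= d / 2 by nra.
have dd0 : 0 <= d ^+ 2 by exact: sqr_ge0.
have d3 : d ^+ 3 <= d ^+ 2 / 2 by nra.
have d4 : d ^+ 4 <= d ^+ 2 / 4 by nra.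
move: h1 => {h2 D0 dd}.
set A := (14 / 17) `^ d; set B := (20 / 51) `^ d => h1 h2.
by nra.
Qed.

End small_coefficients.

(** * One coefficient whose square exceeds 1 / 2 *)

Section one_large_coefficient.
Context {R : realType}.
Implicit Types (p x y z t d a : R) (s : seq R).

Lemma powR_convex q t x y : 1 <= q -> 0 <= t <= 1 -> 0 < x -> 0 < y ->
  ((1 - t) * x + t * y) `^ q <= (1 - t) * x `^ q + t * y `^ q.
Proof.
move=> q1 /andP[t0 t1] x0 y0; set z := _ + t * y.
have z0 : 0 < z by rewrite /z; nra.
have h w : 0 < w -> z `^ q * (1 + q * (w / z - 1)) <= w `^ q.
  move=> w0; have wz : 0 <= w / z by rewrite divr_ge0 ?ltW.
  have -> : w `^ q = z `^ q * (w / z) `^ q.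
    by rewrite -powRM ?(ltW z0) // mulrC divfK ?gt_eqF.
  by rewrite ler_wpM2l ?powR_ge0 // powR_ge_bernoulli.
have hx := ler_wpM2l (_ : 0 <= 1 - t) (h x x0); have hy := ler_wpM2l t0 (h y y0).
apply: le_trans (lerD (hx ltac:(by rewrite subr_ge0)) hy).
rewrite le_eqVlt; apply/orP; left; apply/eqP.
rewrite -[LHS]mulr1 /z; field.
by rewrite gt_eqF.
Qed.

(** The case [x = 10 / 17] of [gam_ge_medium]. Bounding [gam] from below by [gam_ge_powR6] turns
    [(40 / 17) ^ d] into [(20 / 51) ^ d] and leaves [khintchine_endpoint]. *)
Lemma gam_ge_endpoint d : 0 <= d <= 2^-1 ->
  10 / 17 * (40 / 17) `^ d + 7 / 17 * (14 / 17) `^ d * gam (2 + 2 * d) <= gam (2 + 2 * d).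
Proof.
move=> d02; have /andP[d0 d2] := d02.
have d01 : 0 <= d <= 1 by lra.
have h := khintchine_endpoint d02; have := gam_ge_powR6 d01.
set D := (1 + _) * _ in h *; have D0 : 0 < D by rewrite /D; apply: mulr_gt0; lra.
rewrite ler_pdivrMr // => h6.
have e : (40 / 17) `^ d = 6 `^ d * (20 / 51) `^ d.
  by rewrite -powRM //; try lra; congr (_ `^ _); field.
move: h h6 (powR_ge0 (20 / 51) d) (gam_ge0 (2 + 2 * d)); rewrite e.
set A := (14 / 17) `^ d; set B := (20 / 51) `^ d; set C := 6 `^ d; set g := gam _.
move=> h h6 B0 g0.
have := ler_wpM2r B0 h6; have := ler_wpM2r g0 h.
lra.
Qed.

(** The left side is convex in [x], so the two endpoints suffice; at 1 / 2 the claim is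
    [2 ^ d <= gam (2 + 2 * d)]. The parameter [t] is the barycentric coordinate, with
    [34 / 3 = 1 / (10 / 17 - 1 / 2)]. *)
Lemma gam_ge_medium d x : 0 <= d <= 2^-1 -> 2^-1 <= x <= 10 / 17 ->
  2^-1 * 2 `^ d * (2 * x) `^ (1 + d) + 2^-1 * (2 * (1 - x)) `^ (1 + d) * gam (2 + 2 * d)
  <= gam (2 + 2 * d).
Proof.
move=> d02 /andP[x1 x2]; have /andP[d0 d2] := d02.
have d01 : 0 <= d <= 1 by lra.
have g2 := gam_ge_powR2 d01; have gE := gam_ge_endpoint d02.
pose t := (x - 2^-1) * (34 / 3).
have t01 : 0 <= t <= 1 by rewrite /t; apply/andP; split; lra.
have d1 : 1 <= 1 + d by lra.
have S c : 0 < c -> c `^ (1 + d) = c * c `^ d.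
  by move=> c0; rewrite powRD ?(gt_eqF c0) ?implybT // powRr1 // ltW.
have h1 := @powR_convex (1 + d) t 1 (20 / 17) d1 t01 ltac:(lra) ltac:(lra).
have h2 := @powR_convex (1 + d) t 1 (14 / 17) d1 t01 ltac:(lra) ltac:(lra).
have e1 : (1 - t) * 1 + t * (20 / 17) = 2 * x by rewrite /t; field.
have e2 : (1 - t) * 1 + t * (14 / 17) = 2 * (1 - x) by rewrite /t; field.
rewrite e1 powR1 (S (20 / 17)) in h1; last by lra.
rewrite e2 powR1 (S (14 / 17)) in h2; last by lra.
have e3 : (40 / 17) `^ d = 2 `^ d * (20 / 17) `^ d.
  by rewrite -powRM //; try lra; congr (_ `^ _); field.
rewrite e3 in gE.
have h1' := ler_wpM2l (powR_ge0 2 d) h1.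
have h2' := ler_wpM2r (gam_ge0 (2 + 2 * d)) h2.
have /andP[t0 t1] := t01.
have k1 := ler_wpM2l t0 gE.
have k2 : (1 - t) * 2 `^ d <= (1 - t) * gam (2 + 2 * d) by rewrite ler_wpM2l // subr_ge0.
move: h1' h2' k1 k2; clear; set g := gam _.
set A := (2 * x) `^ _; set B := (2 * (1 - x)) `^ _; set C := 2 `^ d.
set E := (20 / 17) `^ d; set F := (14 / 17) `^ d; move=> *; lra.
Qed.

(** The weight of [a] is lowered to 1 / 2 and the other coefficients share the remaining half in
    proportion to their squares, so every exponent is at least 2. The mismatch between weight and
    square costs something, which the exact value at exponent 2 pays for. *)
Lemma khintchine_medium p a s : 2 < p <= 3 -> a ^+ 2 + \sum_(b <- s) b ^+ 2 = 1 ->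
  2^-1 <= a ^+ 2 <= 10 / 17 ->
  rad (fun y => `|y| `^ p) (a :: s) 0 <= gam p.
Proof.
move=> /andP[p2 p3] s1 /andP[a12 a17].
pose d := p / 2 - 1; have pd : p = 2 + 2 * d by rewrite /d; field.
have d02 : 0 <= d <= 2^-1 by rewrite /d; lra.
have d01 : 0 <= d <= 1 by lra.
have g2 := gam_ge_powR2 d01.
have a0 : 0 < a ^+ 2 by lra.
pose v := 1 - a ^+ 2; have v0 : 0 < v by rewrite /v; lra.
have sv : \sum_(b <- s) b ^+ 2 = v by rewrite /v -s1; ring.
have an0 : a != 0 by apply/eqP => a00; move: a0; rewrite a00 expr0n ltxx.
rewrite -rad_drop0 /= an0; set s' := [seq b <- s | _].
have s'v : \sum_(b <- s') b ^+ 2 = v.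
  rewrite big_filter -sv [RHS](bigID (fun b => b != 0)) /= [X in _ = _ + X]big1 ?addr0 //.
  by move=> b /negPn/eqP ->; rewrite expr0n.
pose w b := b ^+ 2 / (2 * v).
have v20 : 0 < 2 * v by rewrite mulr_gt0.
have w12 b : b \in s' -> 0 < w b <= 2^-1.
  move=> bs'; have bv : b ^+ 2 <= v.
    rewrite -s'v (big_rem b) //= lerDl sumr_ge0 // => c _; exact: sqr_ge0.
  move: bs'; rewrite mem_filter => /andP[b0 _].
  rewrite divr_gt0 ?exprn_even_gt0 ?b0 //= ler_pdivrMr //; lra.
have ws : \sum_(b <- s') w b = 2^-1.
  by rewrite /w -mulr_suml s'v; field; rewrite gt_eqF.
(* The bound is a function of the weight alone, so the exact value also serves another coefficient
   of weight 1 / 2; by [cle] it is never worse than the Gaussian one. *)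
pose c (u : R) := if u == 2^-1 then 2 `^ (p - 1) else u^-1 `^ (p / 2) * gam p.
have q2 : p / 2 = 1 + d by rewrite pd; field.
have cle u : c u <= u^-1 `^ (p / 2) * gam p.
  rewrite /c; case: eqP => // ->; rewrite invrK q2 (_ : p - 1 = 1 + d + d); last first.
    by rewrite pd; ring.
  by rewrite powRD ?pnatr_eq0 ?implybT // ler_pM2l ?powR_gt0 // pd.
have cr u : 0 < u <= 2^-1 -> (riesz p (cospow u^-1) <= (c u)%:E * riesz p (@cosrem R))%E.
  move=> u2; rewrite /c; case: eqP => [->|_]; last exact: riesz_cospow_le.
  by rewrite invrK riesz_cosrem_dbl.
have := @rad_cospow_le R p ((2^-1, a) :: [seq (w b, b) | b <- s']) c _ _ _ _.
rewrite /= -map_comp map_id !big_cons !big_map /= => h.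
apply: le_trans (h _ _ _ _) _.
- by rewrite p2; lra.
- move=> wa; rewrite inE => /predU1P[->|/mapP[b bs ->]] /=; last exact: w12.
  by rewrite invr_gt0 lexx ltr0n.
- by rewrite ws; field.
- move=> wa; rewrite inE => /predU1P[->|/mapP[b bs ->]] /=; last exact/cr/w12.
  by apply: cr; rewrite invr_gt0 lexx ltr0n.
have a12' : 2^-1 <= a ^+ 2 <= 10 / 17 by rewrite a12.
rewrite -pd in g2; have := gam_ge_medium d02 a12'; rewrite -pd -/v.
apply: le_trans; rewrite lerD //.
  rewrite /c eqxx powR_abs_sqr // q2 (_ : p - 1 = 1 + d + d); last by rewrite pd; ring.
  rewrite [2 `^ (_ + _ + _)]powRD ?pnatr_eq0 ?implybT // [(2 * _) `^ _]powRM ?sqr_ge0 //.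
  by rewrite le_eqVlt; apply/orP; left; apply/eqP; ring.
apply: (@le_trans _ _ (\sum_(b <- s') w b * ((2 * v) `^ (1 + d) * gam p))); last first.
  by rewrite -mulr_suml ws mulrA.
rewrite big_seq [leRHS]big_seq; apply: ler_sum => b bs'.
have /andP[wb0 wb2] := w12 b bs'.
have b0 : 0 < b ^+ 2.
  by move: bs'; rewrite mem_filter => /andP[b0 _]; rewrite exprn_even_gt0 // b0.
rewrite -mulrA ler_pM2l //; apply: le_trans (ler_wpM2l _ (cle _)) _; first exact: powR_ge0.
rewrite powR_abs_sqr // mulrA -powRM ?sqr_ge0 ?invr_ge0 ?(ltW wb0) // q2.
by rewrite /w invf_div [b ^+ 2 * _]mulrC divfK ?gt_eqF.
Qed.

(** For [|y| <= z] the average is exactly [z ^ 3 + 3 * z * y ^ 2]. Beyond, the excess is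
    [(|y| - z) ^ 3], and [4 * z * (|y| - z) <= y ^ 2] because [(|y| - 2 * z) ^ 2 >= 0]. *)
Lemma cube_split_le y z : 0 < z ->
  (`|y + z| ^+ 3 + `|y - z| ^+ 3) / 2 <= z ^+ 3 + 3 * z * y ^+ 2 + y ^+ 6 / (64 * z ^+ 3).
Proof.
move=> z0.
wlog y0 : y / 0 <= y.
  move=> h; have [|/ltW y0] := leP 0 y; first exact: h.
  have := h (- y); rewrite oppr_ge0 => /(_ y0).
  rewrite -[`|- y + z|]normrN opprD opprK -[`|- y - z|]normrN opprD !opprK.
  by rewrite sqrrN [X in X / 2]addrC (_ : (- y) ^+ 6 = y ^+ 6) //; ring.
rewrite (ger0_norm (_ : 0 <= y + z)); last by rewrite addr_ge0 // ltW.
have z3 : 0 < 64 * z ^+ 3 by rewrite mulr_gt0 ?exprn_gt0.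
have y6 : 0 <= y ^+ 6 / (64 * z ^+ 3) by rewrite divr_ge0 ?exprn_ge0 // ltW.
have [yz|/ltW yz] := leP y z.
  rewrite ler0_norm ?subr_le0 // (_ : _ / 2 = z ^+ 3 + 3 * z * y ^+ 2); last by field.
  by rewrite lerDl.
rewrite ger0_norm ?subr_ge0 //.
have -> : ((y + z) ^+ 3 + (y - z) ^+ 3) / 2 = z ^+ 3 + 3 * z * y ^+ 2 + (y - z) ^+ 3.
  by field.
rewrite lerD2l ler_pdivlMr //.
have -> : (y - z) ^+ 3 * (64 * z ^+ 3) = (4 * z * (y - z)) ^+ 3 by ring.
have -> : y ^+ 6 = (y ^+ 2) ^+ 3 by ring.
apply: lerXn2r; rewrite ?nnegrE ?sqr_ge0 ?mulr_ge0 ?subr_ge0 ?(ltW z0) //.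
by have := sqr_ge0 (y - 2 * z); lra.
Qed.

Lemma rad_pair (f : R -> R) z s : rad f (z :: s) 0 = rad (fun y => (f (y + z) + f (y - z)) / 2) s 0.
Proof.
have -> : rad (fun y => (f (y + z) + f (y - z)) / 2) s 0 =
    rad (fun y => 2^-1 * f (y + z) + 2^-1 * f (y - z)) s 0.
  by apply: eq_rad => y; field.
by rewrite rad_lin -!rad_shift /=; field.
Qed.

(** The sum over [s] has variance [v = 1 - z ^ 2], which controls its second and sixth moments. Both
    [3 * z - 2 * z ^ 3] and [v / z] decrease on this range, so the value at 23 / 30 decides; 7 / 13
    bounds [v / z], and 56 / 39 lies just above the total. *)
Lemma rad_cube_le z s : 23 / 30 <= z -> z ^+ 2 + \sum_(b <- s) b ^+ 2 = 1 ->
  rad (fun y => `|y| ^+ 3) (z :: s) 0 <= 56 / 39.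
Proof.
move=> z23 s1; have z0 : 0 < z by lra.
pose v := 1 - z ^+ 2.
have sv : \sum_(b <- s) b ^+ 2 = v by rewrite /v -s1; ring.
have v0 : 0 <= v by rewrite -sv sum_sqr_ge0.
have z1 : z ^+ 2 <= 1 by rewrite /v in v0; lra.
rewrite rad_pair.
apply: le_trans (rad_le _ _ (fun y => cube_split_le y z0)) _.
pose k := (64 * z ^+ 3)^-1.
rewrite (eq_rad (g := fun y => 1 * (z ^+ 3 + 3 * z * y ^+ 2) + k * y ^+ 6)); last first.
  by move=> y; rewrite mul1r [k * _]mulrC.
rewrite rad_lin (eq_rad (g := fun y => z ^+ 3 * 1 + 3 * z * y ^+ 2)); last first.
  by move=> y; rewrite mulr1.
rewrite rad_lin rad_cst rad_sqr expr0n /= add0r sv.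
have := @rad_pow6_le R s 0; rewrite /= sv !expr0n /= !mulr0 !mul0r !add0r => h6.
have k0 : 0 <= k by rewrite invr_ge0 mulr_ge0 ?exprn_ge0 ?(ltW z0).
have := ler_wpM2l k0 h6.
have -> : k * (15 * v ^+ 3) = 15 / 64 * (v / z) ^+ 3 by rewrite /k; field; rewrite gt_eqF.
have vz : v / z <= 7 / 13 :> R.
  by rewrite ler_pdivrMr // /v; nra.
have vz3 : (v / z) ^+ 3 <= (7 / 13) ^+ 3.
  by apply: lerXn2r; rewrite ?nnegrE ?divr_ge0 ?(ltW z0) //; lra.
have hz : z ^+ 3 + 3 * z * v <= 23 / 30 * (3 - 2 * (23 / 30) ^+ 2).
  rewrite /v -subr_ge0.
  have -> : 23 / 30 * (3 - 2 * (23 / 30) ^+ 2) - (z ^+ 3 + 3 * z * (1 - z ^+ 2)) =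
    (z - 23 / 30) * (2 * (z ^+ 2 + z * (23 / 30) + (23 / 30) ^+ 2) - 3) by ring.
  by rewrite mulr_ge0 //; nra.
move=> h; lra.
Qed.

End one_large_coefficient.

(** * Remaining cases, the recursion in the exponent, and the Rademacher inequality *)

Section khintchine_rademacher.
Context {R : realType}.
Implicit Types (p r u v x y z t d a : R) (s : seq R).

Lemma rad_norm_head (f : R -> R) a s : rad f (a :: s) 0 = rad f (`|a| :: s) 0.
Proof.
rewrite /= !add0r; have [_|_] := ger0P a; first by [].
by rewrite opprK [X in _ = X / 2]addrC.
Qed.

Lemma powR_normD2 y d : 0 < d -> `|y| `^ (2 + 2 * d) = y ^+ 2 * `|y| `^ (2 * d).
Proof.
move=> d0; have [->|y0] := eqVneq y 0.
  by rewrite normr0 expr0n mul0r powR0 // gt_eqF //; lra.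
rewrite powRD ?normr_eq0 ?y0 ?implybT // powR_mulrn ?normr_ge0 //.
by rewrite real_normK ?num_real.
Qed.

(** Applying [1 + u <= expR u] to both denominators gives the exponent [16 / 15 = 2 / 3 + 2 / 5].
    What remains is [expR (16 / 15) <= 6 / (56 / 39) ^ 2], which holds with little room and so
    limits the admissible third moment. *)
Lemma gam_ge_powR56 d : 0 <= d <= 1 -> (56 / 39) `^ (2 * d) <= gam (2 + 2 * d).
Proof.
move=> d01; apply: le_trans (gam_ge_powR6 d01); have /andP[d0 d1] := d01.
have u0 : 0 < 1 + 2 / 3 * d by lra.
have v0 : 0 < 1 + 2 / 5 * d by lra.
rewrite ler_pdivlMr ?mulr_gt0 //.
have hD : (1 + 2 / 3 * d) * (1 + 2 / 5 * d) <= expR (16 / 15 * d).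
  have -> : 16 / 15 * d = 2 / 3 * d + 2 / 5 * d by field.
  by rewrite expRD; apply: ler_pM; rewrite ?(ltW u0) ?(ltW v0) ?expR_ge1Dx.
have b0 : 0 < 56 / 39 :> R by rewrite divr_gt0.
have hB : expR (16 / 15) <= 6 / (56 / 39) ^+ 2 :> R.
  rewrite expRM_natl; apply: le_trans (_ : (31 / 29) ^+ 16 <= _); last by lra.
  by apply: lerXn2r; rewrite ?nnegrE ?expR_ge0 ?expR_15_le //; lra.
have hB' : expR (16 / 15 * d) <= (6 / (56 / 39) ^+ 2) `^ d.
  rewrite powR_expR; last by rewrite divr_gt0 // exprn_gt0.
  rewrite ler_expR mulrC ler_wpM2l //.
  by rewrite -ler_expR lnK ?posrE // divr_gt0 // exprn_gt0.
have := ler_wpM2l (powR_ge0 (56 / 39) (2 * d)) (le_trans hD hB').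
move=> h; apply: le_trans h _.
rewrite -{1}[56 / 39](gtr0_norm b0) -powR_sqr -powRM ?exprn_ge0 ?(ltW b0) //.
by rewrite mulrC divfK // gt_eqF // exprn_gt0.
Qed.

(** Interpolates [|S| ^ p] between [S ^ 2] and [|S| ^ 3] by the tangent at the third-moment bound
    [B], so the expectation is at most [B ^ (2 * d)]. *)
Lemma khintchine_large p a s : 2 < p <= 3 -> a ^+ 2 + \sum_(b <- s) b ^+ 2 = 1 ->
  10 / 17 <= a ^+ 2 ->
  rad (fun y => `|y| `^ p) (a :: s) 0 <= gam p.
Proof.
move=> /andP[p2 p3] s1 a17; rewrite rad_norm_head.
set z := `|a|; have z2 : z ^+ 2 = a ^+ 2 by rewrite real_normK ?num_real.
rewrite -z2 in s1 a17; have z0 : 0 <= z by exact: normr_ge0.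
(* The square of 23 / 30 is just below 10 / 17; this is where the two treatments of a large
   coefficient meet. *)
have z23 : 23 / 30 <= z by nra.
pose d := p / 2 - 1; have pd : p = 2 + 2 * d by rewrite /d; field.
have d0 : 0 < d by rewrite /d; lra.
have d2 : 0 <= 2 * d <= 1 by rewrite /d; lra.
have d01 : 0 <= d <= 1 by lra.
rewrite pd; apply: le_trans (gam_ge_powR56 d01).
have h3 := rad_cube_le z23 s1; set B : R := 56 / 39 in h3 *.
have B0 : 0 < B by rewrite divr_gt0.
have -> : B `^ (2 * d) = B `^ (2 * d) * (1 - 2 * d) * 1 + B `^ (2 * d) * (2 * d) / B * B.
  by field; rewrite gt_eqF.
apply: (@le_trans _ _ (rad (fun y => B `^ (2 * d) * (1 - 2 * d) * y ^+ 2 +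
    B `^ (2 * d) * (2 * d) / B * `|y| ^+ 3) (z :: s) 0)).
  apply: rad_le => y; rewrite powR_normD2 //.
  have := ler_wpM2l (sqr_ge0 y) (powR_le_interp d2 (normr_ge0 y) B0).
  move=> h; apply: le_trans h _; rewrite le_eqVlt; apply/orP; left; apply/eqP.
  rewrite -[y ^+ 2]real_normK ?num_real //.
  by field; rewrite gt_eqF.
rewrite rad_lin rad_sqr big_cons s1 expr0n add0r lerD2l ler_wpM2l //.
by rewrite divr_ge0 ?(ltW B0) // mulr_ge0 ?powR_ge0 //; have /andP[] := d2.
Qed.

(** The fourth moment is 3 minus twice the sum of the fourth powers, hence at most 5 / 2 when one
    square is at least 1 / 2. The [p]-th moment is interpolated between the second and the
    fourth. *)
Lemma khintchine_fourth p a s : 3 <= p < 4 -> a ^+ 2 + \sum_(b <- s) b ^+ 2 = 1 ->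
  2^-1 <= a ^+ 2 ->
  rad (fun y => `|y| `^ p) (a :: s) 0 <= gam p.
Proof.
move=> /andP[p3 p4] s1 a2.
pose d := p / 2 - 1; have pd : p = 2 + 2 * d by rewrite /d; field.
have d0 : 0 < d by rewrite /d; lra.
have d2 : 2^-1 <= d by rewrite /d; lra.
have d01 : 0 <= d <= 1 by rewrite /d; lra.
rewrite pd; apply: le_trans (gam_ge_powR_half d2).
have B0 : 0 < 5 / 2 :> R by lra.
have -> : (5 / 2) `^ d = (5 / 2) `^ d * (1 - d) * 1 + (5 / 2) `^ d * d / (5 / 2) * (5 / 2).
  by field.
apply: (@le_trans _ _ (rad (fun y => (5 / 2) `^ d * (1 - d) * y ^+ 2 +
    (5 / 2) `^ d * d / (5 / 2) * y ^+ 4) (a :: s) 0)).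
  apply: rad_le => y; rewrite powR_normD2 // -powR_sqr.
  have := ler_wpM2l (sqr_ge0 y) (powR_le_interp d01 (sqr_ge0 y) B0).
  move=> h; apply: le_trans h _; rewrite le_eqVlt; apply/orP; left; apply/eqP.
  by field.
rewrite rad_lin rad_sqr rad_pow4 !big_cons s1 !expr0n add0r lerD2l ler_wpM2l //.
  by rewrite !mulr_ge0 ?powR_ge0 ?(ltW d0) // invr_ge0 ltW.
have : 0 <= \sum_(j <- s) j ^+ 4 by apply: sumr_ge0 => b _; exact: exprn_even_ge0.
have -> : a ^+ 4 = (a ^+ 2) ^+ 2 by ring.
by rewrite /=; nra.
Qed.

Lemma khintchine_unit p s : 2 < p < 4 -> \sum_(a <- s) a ^+ 2 = 1 ->
  rad (fun y => `|y| `^ p) s 0 <= gam p.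
Proof.
move=> p24 s1; have /andP[p2 p4] := p24.
have [/hasP[a as_ a2]|/hasPn h] := boolP (has (fun a => 2^-1 < a ^+ 2) s); last first.
  by apply: khintchine_small => // a /h; rewrite -leNgt.
have s1' : a ^+ 2 + \sum_(b <- rem a s) b ^+ 2 = 1.
  by move: s1; rewrite (big_rem a).
rewrite (rad_rem _ _ as_).
have [p3|p3] := leP 3 p; first by apply: khintchine_fourth; rewrite ?p3 // ltW.
have [a17|a17] := leP (10 / 17) (a ^+ 2).
  by apply: khintchine_large; rewrite // p2 ltW.
by apply: khintchine_medium; rewrite // ?p2 ltW ?(ltW a17) // ltW.
Qed.

(** The left side is the integral of the convex function [(r + 1) * |x| ^ r] over [[v, u]], which
    the trapezoid rule overestimates. On one side of 0 the error is monotone in the right endpoint;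
    across 0 the coarse bound [(r + 1) / 2 >= 1] suffices. *)
Lemma powR_trapezoid r u v : 1 <= r -> v <= u ->
  u * `|u| `^ r - v * `|v| `^ r <= (r + 1) / 2 * (u - v) * (`|u| `^ r + `|v| `^ r).
Proof.
move=> r1; have r0 : 0 < r by lra.
have pos v' u' : 0 < v' -> v' <= u' ->
    u' * `|u'| `^ r - v' * `|v'| `^ r <= (r + 1) / 2 * (u' - v') * (`|u'| `^ r + `|v'| `^ r).
  move=> v0 vu; have u0 := lt_le_trans v0 vu.
  rewrite !gtr0_norm // -subr_ge0.
  pose K x := (r + 1) / 2 * (x - v') * (x `^ r + v' `^ r) - (x * x `^ r - v' * v' `^ r).
  pose K' x := (r + 1) / 2 * (v' `^ r - x `^ r + r * (x - v') * x `^ (r - 1)).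
  have K0 : K v' = 0 by rewrite /K; ring.
  rewrite -[leLHS]K0; apply: (@is_derive_homo _ K K') => // x /andP[vx xu].
    have x0 := lt_le_trans v0 vx.
    rewrite /K; der => //; rewrite /K' /=.
    by rewrite -(@mulr_powRB1 _ x r) ?(ltW x0) //; field.
  have x0 := lt_le_trans v0 vx.
  rewrite mulr_ge0 //; first by lra.
  have vx0 : 0 <= v' / x by rewrite divr_ge0 ?ltW.
  have := powR_ge_bernoulli r1 vx0.
  move=> /(ler_wpM2l (powR_ge0 x r)).
  rewrite -powRM ?(ltW x0) // mulrCA divff ?gt_eqF // mulr1.
  rewrite -(@mulr_powRB1 _ x r) ?(ltW x0) //.
  set A := x `^ (r - 1); have -> : x * A * (1 + r * (v' / x - 1)) = A * (x + r * (v' - x)).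
    by field; rewrite gt_eqF.
  by lra.
have mixed v' u' : v' <= 0 -> 0 <= u' ->
    u' * `|u'| `^ r - v' * `|v'| `^ r <= (r + 1) / 2 * (u' - v') * (`|u'| `^ r + `|v'| `^ r).
  move=> v0 u0; have := powR_ge0 `|u'| r; have := powR_ge0 `|v'| r.
  set U := `|u'| `^ r; set V := `|v'| `^ r => V0 U0.
  apply: (@le_trans _ _ (1 * ((u' - v') * (U + V)))); first by nra.
  rewrite -mulrA ler_wpM2r //; last by lra.
  by rewrite mulr_ge0 ?addr_ge0 //; lra.
move=> vu; have [v0|v0] := ltP 0 v; first exact: pos.
have [u0|u0] := leP 0 u; first exact: mixed.
have := pos (- u) (- v); rewrite oppr_gt0 lerN2 !normrN => /(_ u0 vu).
lra.
Qed.

(** A discrete Gaussian integration by parts: flipping one sign changes [y * |y| ^ r] by at most the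
    trapezoid bound. The free starting point [x] carries the induction; at 0 the first term on the
    right vanishes. *)
Lemma rad_stein_le r s x : 1 <= r ->
  rad (fun y => y * (y * `|y| `^ r)) s x <= x * rad (fun y => y * `|y| `^ r) s x +
    (r + 1) * (\sum_(a <- s) a ^+ 2) * rad (fun y => `|y| `^ r) s x.
Proof.
move=> r1; elim: s x => [|a s IH] x; first by rewrite big_nil /=; lra.
rewrite big_cons /=.
have IH1 := IH (x + a); have IH2 := IH (x - a).
set F := rad _ s in IH1 IH2 *; set P := rad _ s in IH1 IH2 *; set G := rad _ s in IH1 IH2 *.
set V := \sum_(b <- s) _ in IH1 IH2 *.
have T : a * (P (x + a) - P (x - a)) <= (r + 1) * a ^+ 2 * (G (x + a) + G (x - a)).
  rewrite /P /G !rad_shift.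
  pose f y := (y + a) * `|y + a| `^ r; pose g y := (y - a) * `|y - a| `^ r.
  pose f' y := `|y + a| `^ r; pose g' y := `|y - a| `^ r.
  have -> : a * (rad f s x - rad g s x) = rad (fun y => a * f y + (- a) * g y) s x.
    by rewrite rad_lin; ring.
  have -> : (r + 1) * a ^+ 2 * (rad f' s x + rad g' s x) =
      rad (fun y => (r + 1) * a ^+ 2 * f' y + (r + 1) * a ^+ 2 * g' y) s x.
    by rewrite rad_lin; ring.
  apply: rad_le => y; rewrite /f /g /f' /g'.
  have [a0|/ltW a0] := leP 0 a.
    have ya : y - a <= y + a by lra.
    by have := ler_wpM2l a0 (powR_trapezoid r1 ya); lra.
  have ya : y + a <= y - a by lra.
  have a0' : 0 <= - a by lra.
  by have := ler_wpM2l a0' (powR_trapezoid r1 ya); lra.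
lra.
Qed.

Lemma khintchine_rec p s : 3 <= p ->
  rad (fun y => `|y| `^ p) s 0 <=
  (p - 1) * (\sum_(a <- s) a ^+ 2) * rad (fun y => `|y| `^ (p - 2)) s 0.
Proof.
move=> p3; have := @rad_stein_le (p - 2) s 0 ltac:(lra).
rewrite mul0r add0r (_ : p - 2 + 1 = p - 1); last by ring.
apply: le_trans; apply: rad_le => y.
have [->|y0] := eqVneq y 0; first by rewrite normr0 mul0r powR0 // gt_eqF //; lra.
rewrite mulrA -expr2 -[y ^+ 2]real_normK ?num_real // -powR_mulrn // -powRD.
  by rewrite (_ : 2 + (p - 2) = p) //; ring.
by rewrite normr_eq0 y0 implybT.
Qed.

Lemma khintchine_rad p s : 2 <= p ->
  rad (fun y => `|y| `^ p) s 0 <= gam p * (\sum_(a <- s) a ^+ 2) `^ (p / 2).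
Proof.
move=> p2; have [n] : exists n : nat, p < 2 * n%:R + 2.
  exists (Num.truncn p).+1; have := @truncnS_gt R p.
  set k := _.+1%:R; have : 0 <= k by []. by lra.
elim: n p p2 => [|n IH] p p2 pn; first by rewrite mulr0 add0r ltNge p2 in pn.
set V := \sum_(a <- s) a ^+ 2; have V0 : 0 <= V by exact: sum_sqr_ge0.
have [p4|p4] := ltP p 4; last first.
  have pe : (p - 2) / 2 + 1 = p / 2 by field.
  apply: le_trans (khintchine_rec _ _) _; first by lra.
  have h : rad (fun y => `|y| `^ (p - 2)) s 0 <= gam (p - 2) * V `^ ((p - 2) / 2).
    by apply: IH; [lra|move: pn; rewrite -natr1; lra].
  have p10 : 0 <= (p - 1) * V by rewrite mulr_ge0 //; lra.
  apply: le_trans (ler_wpM2l p10 h) _.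
  have -> : p = p - 2 + 2 by ring.
  rewrite gam_rec; last by lra.
  rewrite (_ : (p - 2 + 2) / 2 = (p - 2) / 2 + 1); last by field.
  have [->|Vn0] := eqVneq V 0.
    by rewrite mulr0 mul0r mulr_ge0 ?powR_ge0 // mulr_ge0 ?gam_ge0 //; lra.
  rewrite powRD ?Vn0 ?implybT // powRr1 //.
  by rewrite le_eqVlt; apply/orP; left; apply/eqP; rewrite (addrK 2); ring.
(* The recursion from [p = 4] lands on [p = 2], where the integral representation diverges and the
   inequality is an identity between second moments. *)
move: p2; rewrite le_eqVlt => /predU1P[<-|p2].
  have -> : V = rad (fun y => y ^+ 2) s 0 by rewrite rad_sqr expr0n add0r.
  rewrite gam2 mul1r divff // powRr1; last by rewrite rad_sqr expr0n add0r.
  by apply: rad_le => y; rewrite powR_mulrn // real_normK ?num_real.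
have [V00|Vn0] := eqVneq V 0.
  have s0 : all (fun a => a == 0) s.
    apply/allP => a as_; rewrite -sqrf_eq0; move/eqP: V00.
    rewrite psumr_eq0 => [|b _]; last exact: sqr_ge0.
    by move=> /allP /(_ a as_).
  rewrite -rad_drop0 (_ : [seq a <- s | a != 0] = [::]) /=.
    rewrite normr0 powR0; last by rewrite gt_eqF //; lra.
    by rewrite mulr_ge0 ?gam_ge0 ?powR_ge0.
  apply/eqP; rewrite -[_ == _]negbK -has_filter -all_predC.
  by apply: sub_all s0 => a /= ->.
pose c := Num.sqrt V; have Vp : 0 < V by rewrite lt_neqAle eq_sym Vn0.
have c0 : 0 < c by rewrite sqrtr_gt0.
have c2 : c ^+ 2 = V by rewrite sqr_sqrtr.
have s1 : \sum_(a <- [seq c^-1 * a | a <- s]) a ^+ 2 = 1.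
  rewrite big_map (eq_bigr (fun a => c ^- 2 * a ^+ 2)) => [|a _]; last by rewrite exprMn exprVn.
  by rewrite -mulr_sumr -/V c2 mulVf.
have := @khintchine_unit p _ _ s1; rewrite p2 p4 => /(_ isT).
have -> : rad (fun y => `|y| `^ p) s 0 =
    V `^ (p / 2) * rad (fun y => `|y| `^ p) [seq c^-1 * a | a <- s] 0.
  rewrite -[X in _ = _ * rad _ _ X](mulr0 c^-1) rad_scale -rad_mull.
  apply: eq_rad => y; rewrite normrM powRM // (ger0_norm (_ : 0 <= c^-1)); last first.
    by rewrite invr_ge0 ltW.
  rewrite mulrA -c2 powR_sqr (gtr0_norm c0) (_ : 2 * (p / 2) = p); last by field.
  by rewrite -powRM ?invr_ge0 ?(ltW c0) // divff ?gt_eqF // powR1 mul1r.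
by rewrite mulrC; apply: ler_wpM2r; exact: powR_ge0.
Qed.

End khintchine_rademacher.

(** * Multiplicative systems *)

Section multiplicative_systems.
Context {R : realType}.
Implicit Types (p x t : R).

(** Convexity in the form used on one coordinate of the cube: [t] is replaced by a random sign of
    mean [t]. *)
Definition chord_convex (f : R -> R) := forall x a t, -1 <= t <= 1 ->
  f (x + a * t) <= (1 + t) / 2 * f (x + a) + (1 - t) / 2 * f (x - a).

Lemma chord_convex_powR p : 1 <= p -> chord_convex (fun x => `|x| `^ p).
Proof.
move=> p1 x a t /andP[t1 t2]; have p0 : 0 < p by lra.
pose u := (1 - t) / 2; have u01 : 0 <= u <= 1 by rewrite /u; apply/andP; split; lra.
have -> : (1 + t) / 2 = 1 - u by rewrite /u; field.
have -> : x + a * t = (1 - u) * (x + a) + u * (x - a) by rewrite /u; field.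
rewrite -/u; set y := x + a; set z := x - a.
have /andP[u0 u1] := u01; clearbody u y z.
apply: (@le_trans _ _ (((1 - u) * `|y| + u * `|z|) `^ p)).
  apply: ge0_ler_powR; rewrite ?nnegrE ?normr_ge0 ?(ltW p0) //.
    by rewrite addr_ge0 ?mulr_ge0 ?normr_ge0 ?subr_ge0.
  by apply: le_trans (ler_normD _ _) _; rewrite !normrM (ger0_norm u0) ger0_norm ?subr_ge0.
(* The inequality [powR_convex] is stated at positive points; a zero endpoint reduces to
   [u ^ p <= u] on the unit interval. *)
have [y0|y0] := eqVneq `|y| 0.
  rewrite y0 mulr0 add0r powR0 ?gt_eqF // mulr0 add0r powRM ?normr_ge0 //.
  rewrite ler_wpM2r ?powR_ge0 //.
  have [->|un0] := eqVneq u 0; first by rewrite powR0 ?gt_eqF.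
  by apply: ge1r_powR; rewrite // lt_neqAle eq_sym un0 u0.
have [z0|z0] := eqVneq `|z| 0.
  rewrite z0 mulr0 addr0 powR0 ?gt_eqF // mulr0 addr0 powRM ?normr_ge0 ?subr_ge0 //.
  rewrite ler_wpM2r ?powR_ge0 //.
  have [->|un0] := eqVneq (1 - u) 0; first by rewrite powR0 ?gt_eqF.
  by apply: ge1r_powR; rewrite // lt_neqAle eq_sym un0 subr_ge0 u1 gerBl.
by apply: powR_convex; rewrite // lt_neqAle eq_sym ?y0 ?z0 normr_ge0.
Qed.

(** [L] lists the nonconstant monomials of the interpolant by coefficient and index set. The
    coefficients stay existential because these monomials will integrate to 0. Keeping the index
    sets inside [l] ensures that multiplying by the new [t k] never produces a square. *)
Lemma chord_convex_multilinear_le n (f : R -> R) (a : 'I_n -> R) (l : seq 'I_n) x :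
  chord_convex f -> uniq l ->
  exists L : seq (R * {set 'I_n}),
    (forall cA, cA \in L -> cA.2 != finset.set0 /\ {subset cA.2 <= l}) /\
    forall t : 'I_n -> R, (forall k, -1 <= t k <= 1) ->
      f (x + \sum_(k <- l) a k * t k) <=
      rad f [seq a k | k <- l] x + \sum_(cA <- L) cA.1 * \prod_(k in cA.2) t k.
Proof.
move=> cf; elim: l x => [|k l IH] x /=.
  by move=> _; exists [::]; split=> // t _; rewrite !big_nil !addr0.
move=> /andP[kl ul].
have [L [L1 L2]] := IH (x + a k) ul; have [M [M1 M2]] := IH (x - a k) ul.
set rL := rad f _ (x + a k) in L2 *; set rM := rad f _ (x - a k) in M2 *.
pose lift (c : R) (cA : R * {set 'I_n}) := (c * cA.1, (k |: cA.2)%SET).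
pose half (cA : R * {set 'I_n}) := (2^-1 * cA.1, cA.2).
(* The expansion of [(1 + t k) / 2] times the first bound plus [(1 - t k) / 2] times the second,
   without its constant [(rL + rM) / 2]. *)
exists ((2^-1 * (rL - rM), [set k]%SET) :: [seq half cA | cA <- L] ++ [seq half cA | cA <- M]
  ++ [seq lift 2^-1 cA | cA <- L] ++ [seq lift (- 2^-1) cA | cA <- M]).
split.
  move=> cA; rewrite inE !mem_cat => /predU1P[->|] /=.
    split; first by apply/finset.set0Pn; exists k; rewrite finset.in_set1.
    by move=> i; rewrite finset.in_set1 => /eqP ->; rewrite mem_head.
  have sub (A : {set 'I_n}) : {subset A <= l} -> {subset A <= k :: l}.
    by move=> Al i /Al il; rewrite inE il orbT.
  have lift0 c (cB : R * {set 'I_n}) : (lift c cB).2 != finset.set0.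
    by apply/finset.set0Pn; exists k; rewrite finset.setU11.
  have liftl c (cB : R * {set 'I_n}) : {subset cB.2 <= l} -> {subset (lift c cB).2 <= k :: l}.
    move=> Bl i; rewrite /= finset.in_setU1 => /predU1P[->|/Bl il]; first exact: mem_head.
    by rewrite inE il orbT.
  by case/or4P => /mapP[cB cBin ->]; split; rewrite ?lift0 //;
    do [by case: (L1 _ cBin) | by case: (M1 _ cBin)
      | by apply/sub; case: (L1 _ cBin) | by apply/sub; case: (M1 _ cBin)
      | by apply: liftl; case: (L1 _ cBin) | by apply: liftl; case: (M1 _ cBin)].
move=> t t1; have := L2 t t1; have := M2 t t1.
rewrite !big_cons !big_cat !big_map /= big_set1.
have E1 (N : seq (R * {set 'I_n})) :
    \sum_(cA <- N) 2^-1 * cA.1 * \prod_(k in cA.2) t k =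
    2^-1 * \sum_(cA <- N) cA.1 * \prod_(k in cA.2) t k.
  by rewrite mulr_sumr; apply: eq_bigr => cA _; rewrite mulrA.
have E2 c (N : seq (R * {set 'I_n})) :
    (forall cA, cA \in N -> cA.2 != finset.set0 /\ {subset cA.2 <= l}) ->
    \sum_(cA <- N) c * cA.1 * \prod_(i in (k |: cA.2)%SET) t i =
    c * t k * \sum_(cA <- N) cA.1 * \prod_(k in cA.2) t k.
  move=> N1; rewrite mulr_sumr; apply: eq_big_seq => cA /N1[_ Al].
  by rewrite big_setU1 /=; [ring|apply: contra kl => /Al].
rewrite !E1 !E2 //.
set S := \sum_(cA <- L) _; set T := \sum_(cA <- M) _ => hM hL.
have /andP[t0 t2] := t1 k.
have := cf (x + \sum_(j <- l) a j * t j) (a k) (t k) (t1 k).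
set s := \sum_(j <- l) _ in hM hL *.
rewrite (addrAC x s (a k)) (addrAC x s (- a k)) => h.
rewrite [a k * t k + s]addrC [x + (s + _)]addrA; apply: le_trans h _.
have c1 : 0 <= (1 + t k) / 2 by lra.
have c2 : 0 <= (1 - t k) / 2 by lra.
have := lerD (ler_wpM2l c1 hL) (ler_wpM2l c2 hM).
lra.
Qed.

Lemma integral_multiplicative_le d (T : measurableType d) (P : probability T R) n
    (phi : 'I_n -> {RV P >-> R}) (a : 'I_n -> R) (f : R -> R) :
  (forall A : {set 'I_n}, A != finset.set0 ->
     ('E_P[fun w => (\prod_(k in A) phi k w)%R] = 0)%E) ->
  {ae P, forall w, forall k, `|phi k w| <= 1} ->
  continuous f -> (forall x, 0 <= f x) -> chord_convex f ->
  (\int[P]_w (f (\sum_(k < n) a k * phi k w))%:E <=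
   (rad f [seq a k | k <- enum 'I_n] 0)%:E)%E.
Proof.
move=> E0 ae1 cf f0 ccf.
(* The bound by 1 holds almost surely, while the interpolation wants it at every point. Truncation
   to [[-1, 1]] changes the variables on a null set only, and makes all products bounded, hence
   integrable. *)
pose clip y : R := Num.max (-1) (- Num.max (-1) (- y)).
have clip1 y : -1 <= clip y <= 1.
  apply/andP; split; first by rewrite le_max lexx.
  rewrite ge_max; apply/andP; split; first by lra.
  by rewrite lerNl le_max lexx.
have clip_id y : `|y| <= 1 -> clip y = y.
  rewrite ler_norml => /andP[y1 y2]; have y3 : -1 <= - y by rewrite lerN2.
  by rewrite /clip (max_idPr y3) opprK (max_idPr y1).
have mclip : measurable_fun setT clip.
  apply: measurable_maxr => //; apply: measurable_funN; exact: measurable_maxr.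
have mphi k : measurable_fun setT (phi k) by exact: measurable_funPT.
pose psi k w := clip (phi k w).
have mpsi k : measurable_fun setT (psi k).
  exact: (measurableT_comp mclip).
have aepsi : {ae P, forall w, forall k, phi k w = psi k w}.
  by apply: filterS ae1 => w h k; rewrite /psi clip_id.
have mprod (g : 'I_n -> T -> R) (A : {set 'I_n}) : (forall k, measurable_fun setT (g k)) ->
    measurable_fun setT (fun w => \prod_(k in A) g k w).
  move=> mg; under eq_fun do rewrite -big_enum /=.
  by apply: measurable_prod => k _.
have ipsi (A : {set 'I_n}) : P.-integrable setT (fun w => (\prod_(k in A) psi k w)%:E).
  apply: (le_integrable measurableT _ _
    (@finite_measure_integrable_cst _ _ _ P setT 1 measurableT)).
    by apply/measurable_EFinP; exact: mprod.
  move=> w _ /=; rewrite lee_fin normr1 normr_prod prodr_ile1 // => k _.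
  by rewrite normr_ge0 /= ler_norml clip1.
have Epsi (A : {set 'I_n}) : A != finset.set0 ->
    (\int[P]_w (\prod_(k in A) psi k w)%:E = 0)%E.
  move=> A0; apply: etrans (E0 A A0); rewrite expectation.unlock; apply: ae_eq_integral => //.
  - by apply/measurable_EFinP; exact: mprod.
  - by apply/measurable_EFinP; exact: mprod.
  - apply: filterS aepsi => w h _ /=; congr EFin.
    by apply: eq_bigr => k _; rewrite h.
have [L [L1 L2]] := @chord_convex_multilinear_le n f a (enum 'I_n) 0 ccf (enum_uniq _).
set r := rad f _ 0 in L2 *.
have msum (g : 'I_n -> T -> R) : (forall k, measurable_fun setT (g k)) ->
    measurable_fun setT (fun w => (f (\sum_(k < n) a k * g k w))%:E).
  move=> mg; apply/measurable_EFinP.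
  apply: (measurableT_comp (continuous_measurable_fun cf)).
  by apply: measurable_sum => k; apply: measurable_funM.
rewrite (ge0_ae_eq_integral (g := fun w => (f (\sum_(k < n) a k * psi k w))%:E)) //; last 5 first.
- exact: msum.
- exact: msum.
- by move=> w _; rewrite lee_fin.
- by move=> w _; rewrite lee_fin.
- apply: filterS aepsi => w h _; congr (EFin (f _)).
  by apply: eq_bigr => k _; rewrite h.
pose G w := (r%:E + \sum_(cA <- L) cA.1%:E * (\prod_(k in cA.2) psi k w)%:E)%E.
have icA (cA : R * {set 'I_n}) :
    P.-integrable setT (fun w => (cA.1%:E * (\prod_(k in cA.2) psi k w)%:E)%E).
  by apply: integrableZl => //; exact: ipsi.
have iS : P.-integrable setT (fun w => (\sum_(cA <- L) cA.1%:E * (\prod_(k in cA.2) psi k w)%:E)%E).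
  by apply: integrable_sum => // cA _; exact: icA.
have ir : P.-integrable setT (fun w : T => r%:E).
  exact: (@finite_measure_integrable_cst _ _ _ P setT r measurableT).
have iG : P.-integrable setT G by apply: integrableD.
have GE w : G w = (r + \sum_(cA <- L) cA.1 * \prod_(k in cA.2) psi k w)%:E.
  by rewrite /G EFinD -sumEFin; congr (_ + _)%E; apply: eq_bigr => cA _; rewrite EFinM.
have fG w : ((f (\sum_(k < n) a k * psi k w))%:E <= G w)%E.
  rewrite GE lee_fin; have := L2 (psi^~ w) (fun k => clip1 _).
  by rewrite add0r big_enum.
apply: (@le_trans _ _ (\int[P]_w G w)%E).
  apply: ge0_le_integral => //.
  - by move=> w _; rewrite lee_fin.
  - exact: msum.
  - exact: (measurable_int _ iG).
rewrite /G integralD // integral_cst // integral_sum // big1_seq ?adde0.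
  by rewrite -[X in (_ <= X)%E]mule1 [X in (_ * X <= _)%E]probability_setT.
by move=> cA /L1[A0 _]; rewrite integralZl ?ipsi // Epsi // mule0.
Qed.

End multiplicative_systems.

Section haagerup_constant.
Context {R : realType}.

(** The exponent [1 / p] turns the factor [2 ^ (p / 2)] of the Gaussian moment into the square root
    of 2. *)
Lemma khintchine_const_gam (p : R) : 0 < p -> khintchine_const p = gam p `^ p^-1.
Proof.
move=> p0; rewrite /khintchine_const Gamma_gm ?(ltW p0) //.
have sp : 0 < Num.sqrt pi :> R by rewrite sqrtr_gt0 pi_gt0.
have -> : gam p = 2 `^ (p / 2) * (2 * gm p / Num.sqrt pi).
  by rewrite /gam powRD ?pnatr_eq0 ?implybT // powRr1 //; ring.
have g0 : 0 <= 2 * gm p / Num.sqrt pi by rewrite divr_ge0 ?mulr_ge0 ?gm_ge0 // ltW.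
rewrite [in RHS]powRM ?powR_ge0 //.
rewrite -powRrM (_ : p / 2 * p^-1 = 2^-1); last by field; rewrite gt_eqF.
by rewrite powR12_sqrt.
Qed.

End haagerup_constant.

Theorem corollary1p2 (d : measure_display) (T : measurableType d)
    (R : realType) (P : probability T R) (n : nat)
    (phi : 'I_n -> {RV P >-> R})
    (phi_mult : multiplicative_system phi)
    (phi_le1 : forall k : 'I_n, ('N[P]_+oo[EFin \o phi k] <= 1)%E)
    (a : 'I_n -> R) (p : R) (p_gt2 : 2 < p) :
  ('N[P]_(p%:E)[EFin \o (fun x => \sum_(k < n) a k * phi k x)%R] <=
     (khintchine_const p * Num.sqrt (\sum_(k < n) a k ^+ 2))%:E)%E.
Proof.
have p0 : 0 < p by lra.
have ae1 : {ae P, forall w, forall k, `|phi k w| <= 1}.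
  apply: filter_forall => k; have := phi_le1 k.
  (* The norm at [+oo] is the essential supremum only for a space of positive mass, hence the appeal
     to the total mass 1. *)
  rewrite Lnorm.unlock /= probability_setT lte01 => /ess_supP.
  by apply: filterS => w /=; rewrite lee_fin.
have p1 : 1 <= p by lra.
have h := @integral_multiplicative_le R _ _ P n phi a (fun x => `|x| `^ p)
  phi_mult.2 ae1 (@continuous_powR_norm R p p1) (fun x => powR_ge0 _ _)
  (chord_convex_powR p1).
have k := @khintchine_rad R p [seq a k | k <- enum 'I_n] (ltW p_gt2).
rewrite big_map big_enum /= in k.
set V := \sum_(k < n) _ in k *.
have V0 : 0 <= V by apply: sumr_ge0 => i _; exact: sqr_ge0.
rewrite Lnorm.unlock khintchine_const_gam //.
have -> : gam p `^ p^-1 * Num.sqrt V = (gam p * V `^ (p / 2)) `^ p^-1.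
  rewrite powRM ?gam_ge0 ?powR_ge0 // -powRrM (_ : p / 2 * p^-1 = 2^-1).
    by rewrite powR12_sqrt.
  by field; rewrite gt_eqF.
rewrite -poweR_EFin; apply: gt0_ler_poweR.
- by rewrite invr_ge0 ltW.
- by rewrite in_itv /= leey andbT; apply: integral_ge0 => w _; rewrite lee_fin powR_ge0.
- by rewrite in_itv /= leey andbT lee_fin mulr_ge0 ?gam_ge0 ?powR_ge0.
apply: le_trans (le_trans h _); last by rewrite lee_fin.
by rewrite le_eqVlt; apply/orP; left; apply/eqP; apply: eq_integral.
Qed.
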